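(* The following eleven identities hold (all square roots positive reals): $$\frac{\sqrt{15^3}}{3\pi}=\sum_{n\ge0}c_n\frac{8+63n}{(-15^3)^n},\qquad \frac{\sqrt{20^3}}{8\pi}=\sum_{n\ge0}c_n\frac{3+28n}{(20^3)^n},$$ $$\frac{\sqrt{32^3}}{4\pi}=\sum_{n\ge0}c_n\frac{15+154n}{(-32^3)^n},\qquad \frac{\sqrt{2\cdot30^3}}{72\pi}=\sum_{n\ge0}c_n\frac{1+11n}{(2\cdot30^3)^n},$$ $$\frac{\sqrt2\sqrt{66^3}}{48\pi}=\sum_{n\ge0}c_n\frac{5+63n}{(66^3)^n},\qquad \frac{\sqrt{96^3}}{12\pi}=\sum_{n\ge0}c_n\frac{25+342n}{(-96^3)^n},$$ $$\frac{\sqrt{3\cdot160^3}}{36\pi}=\sum_{n\ge0}c_n\frac{31+506n}{(-3\cdot160^3)^n},\qquad \frac{\sqrt{255^3}}{162\pi}=\sum_{n\ge0}c_n\frac{8+133n}{(255^3)^n},$$ $$\frac{\sqrt{960^3}}{36\pi}=\sum_{n\ge0}c_n\frac{263+5418n}{(-960^3)^n},\qquad \frac{\sqrt{5280^3}}{12\pi}=\sum_{n\ge0}c_n\frac{10177+261702n}{(-5280^3)^n},$$ $$\frac{\sqrt{640320^3}}{12\pi}=\sum_{n\ge0}c_n\frac{13591409+545140134\,n}{(-640320^3)^n}\quad\text{(Chudnovsky formula)}.$$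
   Context: Here $c_n=\dfrac{(6n)!}{(3n)!\,(n!)^3}$ for integers $n\ge0$. *)

(* Defs.v *)
From Stdlib Require Import Reals Factorial.
Open Scope R_scope.

Definition c (n : nat) : R :=
  INR (fact (6 * n)) / (INR (fact (3 * n)) * INR (fact n) ^ 3).

(* Main.v *)
(* Write the series as [a f^2 + b x d(f^2)/dx] with [f = 2F1(1/12, 5/12; 1; x)], [x = 1728 / j]: this
   is Clausen's identity.  Comparing differential equations, [f] is, up to an algebraic factor, the
   real period of a real elliptic curve [y^2 = P(x) = 4 x^3 - g2 x - g3] of invariant [j], and its
   derivative yields the second-kind real period.  For the eleven values of [j], the curve has
   complex multiplication by [sqrt (- D)].  On the [x]-line this is a real rational map [R] with
   [- D P(R) = P R'^2], which carries the interval from the largest root of [P] to [+oo] onto the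
   interval from [-oo] to the smallest root of [P]; the change of variables [R] turns the real
   periods into the imaginary ones, with an explicit second-kind correction governed by a constant
   [s].  Legendre's relation between these four periods then becomes a quadratic relation between
   the two real ones, whose right-hand side is a multiple of [pi / sqrt D]; this is the claim.
   The map [R] is obtained from the polynomial [V] whose roots are the abscissas of the kernel of
   [sqrt (- D)], by [R = - x + s + (log V)'' / D] (derivatives along the invariant vector field),
   and the differential equation of [R] is a bilinear equation for [V], checked by computation.
   Type I is the case [j > 1728] (three real roots), type II the case [j < 0] (one real root). *)
Require Import Defs.
From Stdlib Require Import Reals.
From Coquelicot Require Import Coquelicot.
From Stdlib Require Import Lra Lia ZArith List Bool Ranalysis5 Factorial.
Import ListNotations.
Open Scope R_scope.

(** * Complete elliptic integrals *)

(** Nothing here is done over the complex numbers. Since [sqrt (- D)] is purely imaginary, it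
    exchanges the curve with its twist by -1; on abscissas it is therefore a real map, and
    substitutions in real integrals replace lattices and modular forms. The delicate point is the
    second-kind integral, which diverges. It is regularized by subtracting [u], and the linear terms
    on the two sides must cancel exactly, so that expansions of [R0] and [T] at infinity are needed
    with explicit error terms. The arithmetic of each series is carried by [g2], [g3], [s] and the
    kernel: the ratio of [a] to [b] is read off from [s * g2 = 3 * g3 * (6 * a / b - 1)]. For j < 0
    the order has discriminant - D with D = 7, 11, 19, 27, 43, 67, 163; for j > 1728 it is
    Z[sqrt (- D)] with D = 2, 3, 4, 7. All these orders have class number one, which is why rational
    [g2], [g3], [s] exist. For D = 163 the kernel polynomial has degree 81, whence the certificates
    on lists of integers. *)

Definition quad (m t : R) : R := sin t ^ 2 + m * cos t ^ 2.

Definition quad_int (f : R -> R) (m : R) : R :=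
  RInt (fun t => f t / sqrt (quad m t)) 0 (PI / 2).

(* [kappa m] is the complete elliptic integral [K (sqrt (1 - m))]. *)
Definition kappa : R -> R := quad_int (fun _ => 1).

Definition sigma : R -> R := quad_int (fun t => sin t ^ 2).

(** The derivative of [kappa], written through [sigma] so as to avoid the exponent 3/2 that
    differentiation under the integral sign produces. *)
Definition kappa' (m : R) : R := - (sigma m / (2 * m)).

Ltac eqR := match goal with |- @eq _ ?a ?b => change (@eq R a b) end.

Ltac hier_R :=
  repeat (unfold minus, scal, plus, opp, zero, one, mult; simpl); eqR.

Lemma sin_cos_sqr t : sin t ^ 2 + cos t ^ 2 = 1.
Proof. generalize (sin2_cos2 t); unfold Rsqr; lra. Qed.

Lemma quad_pos m t : 0 < m -> 0 < quad m t.
Proof.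
  intros Hm; unfold quad; generalize (sin_cos_sqr t) (pow2_ge_0 (sin t)) (pow2_ge_0 (cos t)).
  intros H1 H2 H3; destruct (Req_dec (cos t ^ 2) 0) as [E|E]; [rewrite E; lra|].
  assert (0 < m * cos t ^ 2) by (apply Rmult_lt_0_compat; lra); lra.
Qed.

Lemma sqrt_quad_pos m t : 0 < m -> 0 < sqrt (quad m t).
Proof. intros; apply sqrt_lt_R0, quad_pos; assumption. Qed.

Lemma continuous_R_of_derive (f : R -> R) x : ex_derive f x -> continuous f x.
Proof. exact (ex_derive_continuous f x). Qed.

Lemma quad_continuous m t : 0 < m -> continuous (fun u => sqrt (quad m u)) t.
Proof.
  intros Hm; apply continuous_R_of_derive; unfold quad; auto_derive.
  exact (quad_pos m t Hm).
Qed.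

Lemma continuous_mult_R (f g : R -> R) x :
  continuous f x -> continuous g x -> continuous (fun y => f y * g y) x.
Proof. exact (continuous_mult f g x). Qed.

Lemma continuous_inv_R (g : R -> R) x :
  continuous g x -> g x <> 0 -> continuous (fun y => / g y) x.
Proof.
  intros Hg Hn; apply continuity_pt_filterlim, continuity_pt_inv; trivial.
  apply continuity_pt_filterlim, Hg.
Qed.

Lemma ex_quad_int f m :
  0 < m -> (forall t, continuous f t) ->
  ex_RInt (fun t => f t / sqrt (quad m t)) 0 (PI / 2).
Proof.
  intros Hm Hf; apply (ex_RInt_continuous (V := R_CompleteNormedModule)); intros t _.
  apply continuous_mult_R; [apply Hf|].
  apply continuous_inv_R; [apply quad_continuous, Hm|].
  apply Rgt_not_eq, sqrt_quad_pos, Hm.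
Qed.

Lemma is_derive_inv_sqrt_quad c m t :
  0 < m ->
  is_derive (fun u => c / sqrt (quad u t)) m
    (- (c * cos t ^ 2 / (2 * (quad m t * sqrt (quad m t))))).
Proof.
  intros Hm; generalize (quad_pos m t Hm); unfold quad.
  generalize (sin t ^ 2) (cos t ^ 2); intros a b Hq.
  assert (Hs := sqrt_lt_R0 _ Hq).
  auto_derive.
  - repeat split; [exact Hq|apply Rgt_not_eq, Hs].
  - set (q := a + m * b) in *.
    assert (E : sqrt q * sqrt q = q) by (apply sqrt_sqrt; lra).
    set (s := sqrt q) in *; rewrite <- E; field; lra.
Qed.

Lemma quad_int_derive f m :
  0 < m -> (forall t, continuous f t) ->
  is_derive (quad_int f) m
    (RInt (fun t => - (f t * cos t ^ 2 / (2 * (quad m t * sqrt (quad m t))))) 0 (PI / 2)).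
Proof.
  intros Hm Hf.
  assert (Hloc : locally m (fun u => 0 < u)) by (apply (open_gt 0); exact Hm).
  rewrite (RInt_ext _ (fun t => Derive (fun u => f t / sqrt (quad u t)) m)).
  2:{ intros t _; symmetry; apply is_derive_unique, is_derive_inv_sqrt_quad, Hm. }
  apply (is_derive_RInt_param (fun u t => f t / sqrt (quad u t))).
  - apply (filter_imp (fun u => 0 < u)); [|exact Hloc].
    intros u Hu t _; eexists; apply is_derive_inv_sqrt_quad, Hu.
  - intros t _.
    apply (continuity_2d_pt_ext_loc
      (fun u v => f v * (- (cos v ^ 2 / (2 * (quad u v * sqrt (quad u v))))))).
    + destruct Hloc as [eps He]; exists eps; intros u v Hu _.
      symmetry; erewrite is_derive_unique; [|apply is_derive_inv_sqrt_quad; apply (He u Hu)].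
      unfold Rdiv; ring.
    + assert (C : forall g : R -> R, (forall t, continuous g t) ->
        continuity_2d_pt (fun _ v : R => g v) m t).
      { intros g Hg; apply (continuity_1d_2d_pt_comp g (fun _ v => v)).
        - apply continuity_pt_filterlim, Hg.
        - apply continuity_2d_pt_id2. }
      assert (Cq : continuity_2d_pt quad m t).
      { apply continuity_2d_pt_plus.
        - apply (C (fun v => sin v ^ 2)); intros; apply continuous_R_of_derive; auto_derive; trivial.
        - apply continuity_2d_pt_mult; [apply continuity_2d_pt_id1|].
          apply (C (fun v => cos v ^ 2)); intros; apply continuous_R_of_derive; auto_derive; trivial. }
      assert (Hs := sqrt_quad_pos m t Hm); assert (Hq := quad_pos m t Hm).
      apply continuity_2d_pt_mult; [apply (C f Hf)|].
      apply continuity_2d_pt_opp, continuity_2d_pt_mult.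
      { apply (C (fun v => cos v ^ 2)); intros; apply continuous_R_of_derive; auto_derive; trivial. }
      apply continuity_2d_pt_inv.
      * apply continuity_2d_pt_mult; [apply continuity_2d_pt_const|].
        apply continuity_2d_pt_mult; [exact Cq|].
        apply (continuity_1d_2d_pt_comp sqrt quad); [|exact Cq].
        apply continuity_pt_sqrt; lra.
      * apply Rgt_not_eq; repeat apply Rmult_lt_0_compat; lra.
  - apply (filter_imp (fun u => 0 < u)); [|exact Hloc].
    intros u Hu; apply ex_quad_int; trivial.
Qed.

Lemma sin_pow2_continuous t : continuous (fun u => sin u ^ 2) t.
Proof. apply continuous_R_of_derive; auto_derive; trivial. Qed.

Lemma one_continuous t : continuous (fun _ : R => 1) t.
Proof. apply continuous_const. Qed.

Lemma RInt_null_derive (F df : R -> R) :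
  F 0 = 0 -> F (PI / 2) = 0 ->
  (forall t, is_derive F t (df t)) -> (forall t, continuous df t) ->
  is_RInt df 0 (PI / 2) 0.
Proof.
  intros H0 H1 Hd Hc.
  replace 0 with (minus (F (PI / 2)) (F 0)) at 2
    by (rewrite H0, H1; unfold minus, plus, opp; simpl; ring).
  apply (is_RInt_derive (V := R_CompleteNormedModule)); intros; [apply Hd|apply Hc].
Qed.

Lemma ex_RInt_cont (f : R -> R) a b : (forall t, continuous f t) -> ex_RInt f a b.
Proof. intros Hf; apply (ex_RInt_continuous (V := R_CompleteNormedModule)); intros; apply Hf. Qed.


Lemma is_derive_quad m t : is_derive (quad m) t (2 * (1 - m) * sin t * cos t).
Proof. unfold quad; auto_derive; [trivial|ring]. Qed.

Lemma is_derive_div_sqrt_quad (n : R -> R) n' m t :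
  0 < m -> is_derive n t n' ->
  is_derive (fun u => n u / sqrt (quad m u)) t
    ((n' * quad m t - n t * ((1 - m) * sin t * cos t)) / (quad m t * sqrt (quad m t))).
Proof.
  intros Hm Hn; assert (Hq := quad_pos m t Hm); assert (Hs := sqrt_quad_pos m t Hm).
  assert (Hd := is_derive_quad m t).
  evar_last.
  - apply (is_derive_div n (fun u => sqrt (quad m u))); [exact Hn| |apply Rgt_not_eq, Hs].
    apply (is_derive_comp sqrt (quad m)); [|exact Hd].
    apply is_derive_Reals, derivable_pt_lim_sqrt, Hq.
  - unfold scal, mult, minus, plus, opp, scal; simpl; unfold mult; simpl.
    assert (E : sqrt (quad m t) * sqrt (quad m t) = quad m t) by (apply sqrt_sqrt; lra).
    set (s := sqrt (quad m t)) in *; rewrite <- E; field; lra.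
Qed.

Lemma continuous_div_quad32 (f : R -> R) m t :
  0 < m -> continuous f t ->
  continuous (fun u => f u / (quad m u * sqrt (quad m u))) t.
Proof.
  intros Hm Hf; apply continuous_mult_R; [exact Hf|].
  assert (Hq := quad_pos m t Hm); assert (Hs := sqrt_quad_pos m t Hm).
  apply continuous_inv_R.
  - apply continuous_mult_R; [|apply quad_continuous, Hm].
    apply continuous_R_of_derive; eexists; apply is_derive_quad.
  - apply Rgt_not_eq, Rmult_lt_0_compat; assumption.
Qed.

Ltac cont_elem := solve [apply continuous_R_of_derive; unfold quad; auto_derive; trivial].

(** Integration by parts in ready-made form: [n / sqrt quad] vanishes at both ends, so its
    derivative may be added to any integrand. With [n] equal to [sin t * cos t] this lowers the
    exponent 3/2 to 1/2. *)
Lemma RInt_derive_div_sqrt_quad (n n' : R -> R) m :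
  0 < m -> n 0 = 0 -> n (PI / 2) = 0 ->
  (forall t, is_derive n t (n' t)) -> (forall t, continuous n' t) ->
  is_RInt (fun t => (n' t * quad m t - n t * ((1 - m) * sin t * cos t)) /
    (quad m t * sqrt (quad m t))) 0 (PI / 2) 0.
Proof.
  intros Hm H0 H1 Hd Hc.
  apply (RInt_null_derive (fun t => n t / sqrt (quad m t))).
  - rewrite H0; unfold Rdiv; ring.
  - rewrite H1; unfold Rdiv; ring.
  - intros t; apply is_derive_div_sqrt_quad; [exact Hm|apply Hd].
  - intros t; apply (continuous_div_quad32 (fun t => n' t * quad m t - n t * ((1 - m) * sin t * cos t))).
    + exact Hm.
    + apply (continuous_minus (fun t => n' t * quad m t) (fun t => n t * ((1 - m) * sin t * cos t)));
        apply continuous_mult_R; try apply Hc; try cont_elem.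
      apply continuous_R_of_derive; eexists; apply Hd.
Qed.

Lemma div_sqrt_quad a m t :
  0 < m -> a / sqrt (quad m t) = a * quad m t / (quad m t * sqrt (quad m t)).
Proof.
  intros Hm; assert (Hq := quad_pos m t Hm); assert (Hs := sqrt_quad_pos m t Hm).
  field; lra.
Qed.

Lemma is_derive_sin_cos t : is_derive (fun t => sin t * cos t) t (cos t ^ 2 - sin t ^ 2).
Proof. auto_derive; [trivial|ring]. Qed.

Lemma sin_cos_continuous t : continuous (fun t => cos t ^ 2 - sin t ^ 2) t.
Proof. cont_elem. Qed.

Lemma is_derive_kappa m : 0 < m -> is_derive kappa m (kappa' m).
Proof.
  intros Hm.
  evar_last; [exact (quad_int_derive (fun _ => 1) m Hm one_continuous)|].
  unfold kappa', sigma, quad_int.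
  assert (Hn := RInt_derive_div_sqrt_quad (fun t => sin t * cos t) _ m Hm
    ltac:(simpl; rewrite sin_0; ring) ltac:(simpl; rewrite cos_PI2; ring)
    is_derive_sin_cos sin_cos_continuous).
  assert (Hs : is_RInt (fun t => sin t ^ 2 / sqrt (quad m t)) 0 (PI / 2)
    (RInt (fun t => sin t ^ 2 / sqrt (quad m t)) 0 (PI / 2))).
  { apply (RInt_correct (V := R_CompleteNormedModule)), ex_quad_int; [exact Hm|exact sin_pow2_continuous]. }
  set (S := RInt _ _ _) in Hs |- *.
  apply is_RInt_unique.
  (* The derivative of sin t cos t / sqrt(quad), added to sin^2 t / sqrt(quad), is exactly m cos^2 t
     / quad^(3/2). *)
  assert (H := is_RInt_scal _ _ _ (- / (2 * m)) _ (is_RInt_plus _ _ _ _ _ _ Hn Hs)).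
  evar_last.
  - eapply is_RInt_ext; [|exact H]; intros t _.
    unfold scal, plus; simpl; unfold mult; simpl.
    rewrite (div_sqrt_quad (sin t * (sin t * 1)) m t Hm).
    assert (Hq := quad_pos m t Hm); assert (Hr := sqrt_quad_pos m t Hm).
    assert (Hsc := sin_cos_sqr t).
    set (r := sqrt (quad m t)) in *.
    apply (Rmult_eq_reg_r (2 * m * (quad m t * r))).
    2:{ apply Rgt_not_eq; repeat apply Rmult_lt_0_compat; lra. }
    field_simplify; try lra.
    unfold quad; replace (cos t ^ 4) with (cos t ^ 2 * cos t ^ 2) by ring.
    replace (cos t ^ 2) with (1 - sin t ^ 2) by lra; ring.
  - unfold scal, plus; simpl; unfold mult; simpl; field; lra.
Qed.

(** Legendre's differential equation in self-adjoint form. This form is invariant under m -> 1 - m,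
    which makes the Wronskian [legendre] constant, and it is the form in which hypergeometric
    solutions are compared with [kappa]. *)
Lemma is_derive_kappa' m :
  0 < m -> is_derive (fun u => u * (1 - u) * kappa' u) m (kappa m / 4).
Proof.
  intros Hm.
  apply (is_derive_ext_loc (fun u => - / 2 * ((1 - u) * sigma u))).
  { apply (filter_imp (fun u => 0 < u)); [|apply (open_gt 0); exact Hm].
    intros u Hu; unfold kappa'; eqR; field; lra. }
  assert (Hd := quad_int_derive (fun t => sin t ^ 2) m Hm sin_pow2_continuous).
  fold sigma in Hd.
  assert (Hc : is_RInt (fun t => sin t ^ 2 * cos t ^ 2 / (2 * (quad m t * sqrt (quad m t)))) 0 (PI / 2)
    (- RInt (fun t => - (sin t ^ 2 * cos t ^ 2 / (2 * (quad m t * sqrt (quad m t))))) 0 (PI / 2))).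
  { assert (Hx : ex_RInt (fun t => - (sin t ^ 2 * cos t ^ 2 / (2 * (quad m t * sqrt (quad m t)))))
      0 (PI / 2)).
    { apply ex_RInt_cont; intros t.
      apply (continuous_ext (fun t => (- (sin t ^ 2 * cos t ^ 2) / 2) / (quad m t * sqrt (quad m t)))).
      - intros u; assert (Hq := quad_pos m u Hm); assert (Hs := sqrt_quad_pos m u Hm); eqR; field; lra.
      - apply (continuous_div_quad32 (fun t => - (sin t ^ 2 * cos t ^ 2) / 2)); [exact Hm|cont_elem]. }
    apply (is_RInt_ext (fun t => opp (- (sin t ^ 2 * cos t ^ 2 / (2 * (quad m t * sqrt (quad m t))))))).
    - intros t _; hier_R; ring.
    - apply (is_RInt_opp (V := R_NormedModule)), (RInt_correct (V := R_CompleteNormedModule)), Hx. }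
  set (D := RInt _ _ _) in Hd, Hc.
  (* [D] is the derivative of [sigma]; the relation is again an identity of integrands up to the
     derivative of sin t cos t / sqrt(quad). *)
  assert (Hk : kappa m = 2 * sigma m + (1 - m) * (2 * - D)).
  2:{ evar_last.
      - apply (is_derive_scal (fun u => (1 - u) * sigma u)).
        apply (is_derive_mult (fun u => 1 - u) sigma); [|exact Hd|intros; apply Rmult_comm].
        apply (is_derive_minus (fun _ => 1) (fun u => u)); [apply is_derive_const|apply is_derive_id].
      - hier_R; rewrite Hk; field. }
  assert (Hn := RInt_derive_div_sqrt_quad (fun t => sin t * cos t) _ m Hm
    ltac:(simpl; rewrite sin_0; ring) ltac:(simpl; rewrite cos_PI2; ring)
    is_derive_sin_cos sin_cos_continuous).
  assert (Hs : is_RInt (fun t => sin t ^ 2 / sqrt (quad m t)) 0 (PI / 2) (sigma m)).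
  { apply (RInt_correct (V := R_CompleteNormedModule)), ex_quad_int; [exact Hm|exact sin_pow2_continuous]. }
  apply is_RInt_unique.
  assert (H := is_RInt_plus _ _ _ _ _ _ (is_RInt_plus _ _ _ _ _ _ (is_RInt_scal _ _ _ 2 _ Hs)
    (is_RInt_scal _ _ _ ((1 - m) * 2) _ Hc)) Hn).
  evar_last.
  - eapply is_RInt_ext; [|exact H]; intros t _.
    unfold scal, plus; simpl; unfold mult; simpl.
    rewrite (div_sqrt_quad 1 m t Hm).
    assert (Hq := quad_pos m t Hm); assert (Hr := sqrt_quad_pos m t Hm).
    assert (Hsc := sin_cos_sqr t).
    rewrite (div_sqrt_quad (sin t * (sin t * 1)) m t Hm).
    set (r := sqrt (quad m t)) in *.
    apply (Rmult_eq_reg_r (2 * m * (quad m t * r))).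
    2:{ apply Rgt_not_eq; repeat apply Rmult_lt_0_compat; lra. }
    field_simplify; try lra.
    unfold quad; replace (cos t ^ 4) with (cos t ^ 2 * cos t ^ 2) by ring.
    replace (cos t ^ 2) with (1 - sin t ^ 2) by lra; ring.
  - unfold scal, plus; simpl; unfold mult; simpl; field; lra.
Qed.

Lemma is_derive_Rmult (f g : R -> R) x df dg :
  is_derive f x df -> is_derive g x dg ->
  is_derive (fun u => f u * g u) x (df * g x + f x * dg).
Proof. intros Hf Hg; apply (is_derive_mult f g); trivial; intros; apply Rmult_comm. Qed.

Lemma derive_0_const (f : R -> R) a b :
  (forall x, Rmin a b <= x <= Rmax a b -> is_derive f x 0) -> f a = f b.
Proof.
  intros Hf; destruct (MVT_gen f a b (fun _ => 0)) as [c [_ Hc]]; [| |lra].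
  - intros x Hx; apply Hf; lra.
  - intros x Hx; apply continuity_pt_filterlim, continuous_R_of_derive; eexists; apply Hf, Hx.
Qed.

(** The Wronskian of m -> [kappa m] and m -> [kappa (1 - m)], times m (1 - m). The plus sign comes
    from the chain rule, which changes the sign of [kappa' (1 - m)]. *)
Definition legendre (m : R) : R :=
  kappa m * (m * (1 - m) * kappa' (1 - m)) + kappa (1 - m) * (m * (1 - m) * kappa' m).

Lemma legendre_const a b : 0 < a < 1 -> 0 < b < 1 -> legendre a = legendre b.
Proof.
  intros Ha Hb; apply derive_0_const; intros x Hx.
  assert (H : 0 < x < 1).
  { revert Hx; unfold Rmin, Rmax; destruct (Rle_dec a b); lra. }
  clear Hx a b Ha Hb.
  assert (D1 := is_derive_kappa x ltac:(lra)); assert (D2 := is_derive_kappa (1 - x) ltac:(lra)).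
  assert (D3 := is_derive_kappa' x ltac:(lra)); assert (D4 := is_derive_kappa' (1 - x) ltac:(lra)).
  assert (Di : is_derive (fun u => 1 - u) x (- 1)) by (auto_derive; [trivial|ring]).
  apply (is_derive_comp _ (fun u => 1 - u) x _ _ D2) in Di as D5.
  apply (is_derive_comp _ (fun u => 1 - u) x _ _ D4) in Di as D6.
  apply (is_derive_ext (fun u => kappa u * ((1 - u) * (1 - (1 - u)) * kappa' (1 - u)) +
    kappa (1 - u) * (u * (1 - u) * kappa' u))).
  { intros u; unfold legendre; eqR; ring. }
  evar_last.
  - exact (is_derive_plus (V := R_NormedModule) _ _ _ _ _
      (is_derive_Rmult _ _ _ _ _ D1 D6) (is_derive_Rmult _ _ _ _ _ D5 D3)).
  - hier_R; field.
Qed.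

Lemma quad_1 t : quad 1 t = 1.
Proof. generalize (sin_cos_sqr t); unfold quad; lra. Qed.

Lemma kappa_1 : kappa 1 = PI / 2.
Proof.
  unfold kappa, quad_int; rewrite (RInt_ext _ (fun _ => 1)).
  - rewrite RInt_const; hier_R; ring.
  - intros t _; rewrite quad_1, sqrt_1; eqR; field.
Qed.

Lemma PI2_pos : 0 < PI / 2.
Proof. generalize PI_RGT_0; lra. Qed.

Lemma kappa_pos m : 0 < m -> 0 < kappa m.
Proof.
  intros Hm; apply (RInt_gt_0 (fun t => 1 / sqrt (quad m t))); [apply PI2_pos| |].
  - intros t _; apply Rdiv_lt_0_compat; [lra|apply sqrt_quad_pos, Hm].
  - intros t _; apply continuous_mult_R; [apply one_continuous|].
    apply continuous_inv_R; [apply quad_continuous, Hm|apply Rgt_not_eq, sqrt_quad_pos, Hm].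
Qed.

(** [kappa] is unbounded near 0, but the crude estimate [m <= quad m t] already forces [m * kappa m]
    to vanish in the limit. *)
Lemma mul_kappa_le m : 0 < m <= 1 -> m * kappa m <= PI / 2 * sqrt m.
Proof.
  intros Hm; assert (Hs : 0 < sqrt m) by (apply sqrt_lt_R0; lra).
  assert (E : sqrt m * sqrt m = m) by (apply sqrt_sqrt; lra).
  assert (H : kappa m <= PI / 2 * / sqrt m).
  { replace (PI / 2 * / sqrt m) with (RInt (fun _ => / sqrt m) 0 (PI / 2))
      by (rewrite RInt_const; hier_R; ring).
    apply RInt_le; [generalize PI2_pos; lra| | |].
    - apply (ex_quad_int (fun _ => 1)); [lra|exact one_continuous].
    - apply ex_RInt_const.
    - intros t _; unfold Rdiv; rewrite Rmult_1_l; apply Rinv_le_contravar; [exact Hs|].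
      apply sqrt_le_1_alt; unfold quad; generalize (sin_cos_sqr t) (pow2_ge_0 (sin t)); nra. }
  apply Rle_trans with (m * (PI / 2 * / sqrt m)); [apply Rmult_le_compat_l; lra|].
  rewrite <- E at 1; right; field; lra.
Qed.

Lemma RInt_sin : RInt sin 0 (PI / 2) = 1.
Proof.
  apply is_RInt_unique; evar_last.
  - apply (is_RInt_derive (V := R_CompleteNormedModule) (fun t => - cos t)).
    + intros t _; auto_derive; [trivial|ring].
    + intros t _; cont_elem.
  - hier_R; rewrite cos_PI2, cos_0; ring.
Qed.

(** On the interval, sin t <= sqrt(quad) <= sin t + sqrt m, so the integrand stays within sqrt m of
    sin t, whose integral is 1. *)
Lemma sigma_near_0 m : 0 < m <= 1 -> 1 - PI / 2 * sqrt m <= sigma m <= 1.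
Proof.
  intros Hm; assert (Hs : 0 < sqrt m) by (apply sqrt_lt_R0; lra).
  assert (E : sqrt m * sqrt m = m) by (apply sqrt_sqrt; lra).
  assert (Hx : ex_RInt (fun t => sin t ^ 2 / sqrt (quad m t)) 0 (PI / 2))
    by (apply ex_quad_int; [lra|exact sin_pow2_continuous]).
  assert (Hsin : ex_RInt sin 0 (PI / 2)) by (apply ex_RInt_cont; intros; cont_elem).
  assert (Hb : forall t, 0 < t < PI / 2 ->
    sin t - sqrt m <= sin t ^ 2 / sqrt (quad m t) <= sin t).
  { intros t Ht; assert (Hq := sqrt_quad_pos m t ltac:(lra)).
    assert (Ht0 : 0 < sin t) by (apply sin_gt_0; generalize PI_RGT_0; lra).
    assert (Eq : sqrt (quad m t) * sqrt (quad m t) = quad m t)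
      by (apply sqrt_sqrt; generalize (quad_pos m t ltac:(lra)); lra).
    assert (Hge : sin t <= sqrt (quad m t)).
    { rewrite <- (sqrt_pow2 (sin t)) by lra; apply sqrt_le_1_alt; unfold quad.
      generalize (pow2_ge_0 (cos t)); nra. }
    assert (Hle : sqrt (quad m t) <= sin t + sqrt m).
    { rewrite <- (sqrt_pow2 (sin t + sqrt m)) by lra; apply sqrt_le_1_alt; unfold quad.
      generalize (sin_cos_sqr t) (pow2_ge_0 (sin t)); nra. }
    set (r := sqrt (quad m t)) in *.
    split; apply (Rmult_le_reg_r r); try exact Hq; unfold Rdiv;
      rewrite ?Rmult_assoc, ?Rinv_l, ?Rmult_1_r by lra; nra. }
  split.
  - replace (1 - PI / 2 * sqrt m) with (RInt (fun t => sin t - sqrt m) 0 (PI / 2)).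
    + apply RInt_le; [generalize PI2_pos; lra| |exact Hx|intros; apply Hb; assumption].
      apply ex_RInt_cont; intros; cont_elem.
    + assert (H := RInt_minus (V := R_CompleteNormedModule) sin (fun _ => sqrt m) 0 (PI / 2) Hsin (ex_RInt_const _ _ _)).
      etransitivity; [exact H|]; rewrite RInt_sin, RInt_const; hier_R; ring.
  - rewrite <- RInt_sin; apply RInt_le; [generalize PI2_pos; lra|exact Hx|exact Hsin|].
    intros; apply Hb; assumption.
Qed.

Lemma is_lim_seq_eq u (l l' : R) : is_lim_seq u l -> l = l' -> is_lim_seq u l'.
Proof. intros H <-; exact H. Qed.

Lemma is_lim_seq_inv_INR : is_lim_seq (fun n => / (INR n + 2)) 0.
Proof.
  replace (Finite 0) with (Rbar_inv p_infty) by reflexivity.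
  apply is_lim_seq_inv; [|discriminate].
  apply (is_lim_seq_plus _ _ p_infty 2); [apply is_lim_seq_INR|apply is_lim_seq_const|reflexivity].
Qed.

(* Legendre's relation [E K' + E' K - K K' = pi / 2]. *)
Lemma legendre_relation m : 0 < m < 1 -> legendre m = - (PI / 4).
Proof.
  intros Hm.
  (* The constant is found by letting the argument tend to 0 along this sequence, which stays in the
     interval from 0 to 1/2. *)
  set (e := fun n => / (INR n + 2)).
  assert (He : forall n, 0 < e n <= / 2).
  { intros n; unfold e; generalize (pos_INR n); intros H; split.
    - apply Rinv_0_lt_compat; lra.
    - apply Rinv_le_contravar; lra. }
  assert (L0 : is_lim_seq e 0) by exact is_lim_seq_inv_INR.
  assert (L1 : is_lim_seq (fun n => 1 - e n) 1).
  { apply (is_lim_seq_eq _ (1 - 0)); [|ring].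
    apply is_lim_seq_minus'; [apply is_lim_seq_const|exact L0]. }
  assert (Ls : is_lim_seq (fun n => sqrt (e n)) 0).
  { rewrite <- sqrt_0; apply is_lim_seq_continuous; [apply continuity_pt_sqrt; lra|exact L0]. }
  assert (Lps : is_lim_seq (fun n => PI / 2 * sqrt (e n)) 0).
  { apply (is_lim_seq_eq _ (PI / 2 * 0)); [|ring].
    apply is_lim_seq_mult'; [apply is_lim_seq_const|exact Ls]. }
  assert (Lk : is_lim_seq (fun n => e n * kappa (e n)) 0).
  { apply is_lim_seq_le_le with (fun _ => 0) (fun n => PI / 2 * sqrt (e n)); [|apply is_lim_seq_const|exact Lps].
    intros n; specialize (He n); split; [|apply mul_kappa_le; lra].
    apply Rmult_le_pos; [lra|left; apply kappa_pos; lra]. }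
  assert (Lg : is_lim_seq (fun n => sigma (e n)) 1).
  { apply is_lim_seq_le_le with (fun n => 1 - PI / 2 * sqrt (e n)) (fun _ => 1); [| |apply is_lim_seq_const].
    - intros n; apply sigma_near_0; specialize (He n); lra.
    - apply (is_lim_seq_eq _ (1 - 0)); [|ring].
      apply is_lim_seq_minus'; [apply is_lim_seq_const|exact Lps]. }
  assert (Lg1 : is_lim_seq (fun n => sigma (1 - e n)) (sigma 1)).
  { apply is_lim_seq_continuous; [|exact L1].
    apply continuity_pt_filterlim, continuous_R_of_derive; eexists.
    apply (quad_int_derive (fun t => sin t ^ 2)); [lra|exact sin_pow2_continuous]. }
  assert (Lk1 : is_lim_seq (fun n => kappa (1 - e n)) (PI / 2)).
  { rewrite <- kappa_1; apply is_lim_seq_continuous; [|exact L1].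
    apply continuity_pt_filterlim, continuous_R_of_derive; eexists; apply is_derive_kappa; lra. }
  (* Once [kappa'] is expressed by [sigma], the divergent factor [kappa (e n)] occurs only
     multiplied by [e n]; the other term tends to - (PI / 2) / 2. *)
  assert (L : is_lim_seq (fun n => legendre (e n))
    (- / 2 * (0 * sigma 1) + - / 2 * ((PI / 2) * (1 * 1)))).
  { apply (is_lim_seq_ext (fun n => - / 2 * ((e n * kappa (e n)) * sigma (1 - e n)) +
      - / 2 * (kappa (1 - e n) * ((1 - e n) * sigma (e n))))).
    - intros n; specialize (He n); unfold legendre, kappa'; eqR; field; lra.
    - apply is_lim_seq_plus'; (apply is_lim_seq_mult'; [apply is_lim_seq_const|]).
      + apply is_lim_seq_mult'; assumption.
      + apply is_lim_seq_mult'; [assumption|apply is_lim_seq_mult'; assumption]. }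
  apply (is_lim_seq_ext _ (fun _ => legendre m)) in L.
  2:{ intros n; apply legendre_const; [specialize (He n); lra|exact Hm]. }
  apply is_lim_seq_unique in L; rewrite Lim_seq_const in L.
  injection L; lra.
Qed.

(** * Clausen's identity *)

(** Says that the radius of convergence is at least 1, in the pointwise form that the lemmas on
    derivatives and products of power series take. *)
Definition analytic1 (a : nat -> R) : Prop :=
  forall x, Rabs x < 1 -> Rbar_lt (Rabs x) (CV_radius a).

Lemma analytic1_intro a : (forall x, Rabs x < 1 -> ex_pseries a x) -> analytic1 a.
Proof.
  intros Ha x Hx; set (y := (Rabs x + 1) / 2).
  assert (Hy : Rabs y = y) by (apply Rabs_pos_eq; unfold y; generalize (Rabs_pos x); lra).
  destruct (Rbar_le_lt_dec (Rabs y) (CV_radius a)) as [H|H].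
  - eapply Rbar_lt_le_trans; [|exact H]; simpl; rewrite Hy; unfold y; lra.
  - exfalso; apply (CV_disk_outside _ _ H).
    apply ex_series_lim_0; apply -> ex_pseries_R; apply Ha; rewrite Hy; unfold y; lra.
Qed.

Lemma analytic1_ex a x : analytic1 a -> Rabs x < 1 -> ex_pseries a x.
Proof. intros Ha Hx; apply CV_radius_inside, Ha, Hx. Qed.

Lemma analytic1_bounded a M : (forall n, Rabs (a n) <= M) -> analytic1 a.
Proof.
  intros Ha x Hx; destruct (CV_radius_bounded a) as [Hub _].
  eapply Rbar_lt_le_trans; [|apply (Hub 1); exists M]; [exact Hx|].
  intros n; rewrite pow1, Rmult_1_r; apply Ha.
Qed.

(** The Euler operator x d/dx on coefficients; hypergeometric recurrences are polynomial in it. *)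
Definition theta (a : nat -> R) (n : nat) : R := INR n * a n.

Lemma theta_incr_derive a n : PS_incr_1 (PS_derive a) n = theta a n.
Proof. destruct n; unfold PS_incr_1, PS_derive, theta; [simpl; hier_R; ring|reflexivity]. Qed.

Lemma analytic1_ext a b : (forall n, a n = b n) -> analytic1 a -> analytic1 b.
Proof. intros E Ha x Hx; rewrite <- (CV_radius_ext _ _ E); apply Ha, Hx. Qed.

Lemma analytic1_theta a : analytic1 a -> analytic1 (theta a).
Proof.
  intros Ha; apply (analytic1_ext (PS_incr_1 (PS_derive a))); [apply theta_incr_derive|].
  intros x Hx; rewrite CV_radius_incr_1, CV_radius_derive; apply Ha, Hx.
Qed.

Lemma analytic1_incr a : analytic1 a -> analytic1 (PS_incr_1 a).
Proof. intros Ha x Hx; rewrite CV_radius_incr_1; apply Ha, Hx. Qed.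

Lemma analytic1_plus a b : analytic1 a -> analytic1 b -> analytic1 (PS_plus a b).
Proof.
  intros Ha Hb; apply analytic1_intro; intros x Hx.
  apply ex_pseries_plus; apply analytic1_ex; assumption.
Qed.

Lemma analytic1_scal c a : analytic1 a -> analytic1 (PS_scal c a).
Proof.
  intros Ha; apply analytic1_intro; intros x Hx.
  apply ex_pseries_scal; [apply Rmult_comm|apply analytic1_ex; assumption].
Qed.

Lemma analytic1_mult a b : analytic1 a -> analytic1 b -> analytic1 (PS_mult a b).
Proof.
  intros Ha Hb; apply analytic1_intro; intros x Hx; eexists; apply is_pseries_mult.
  - apply PSeries_correct, analytic1_ex; eassumption.
  - apply PSeries_correct, analytic1_ex; eassumption.
  - apply Ha, Hx.
  - apply Hb, Hx.
Qed.

Lemma PSeries_theta_eq a x : PSeries (theta a) x = x * PSeries (PS_derive a) x.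
Proof.
  rewrite <- PSeries_incr_1; apply PSeries_ext; intros n; symmetry; apply theta_incr_derive.
Qed.

Lemma is_derive_PSeries1 a x :
  analytic1 a -> Rabs x < 1 -> is_derive (PSeries a) x (PSeries (PS_derive a) x).
Proof. intros Ha Hx; apply is_derive_PSeries, Ha, Hx. Qed.

Lemma locally_abs_lt_1 x : Rabs x < 1 -> locally x (fun y => Rabs y < 1).
Proof.
  intros Hx; apply (filter_imp (fun y => -1 < y /\ y < 1)).
  - intros y Hy; apply Rabs_def1; lra.
  - apply Rabs_def2 in Hx; apply filter_and; [apply (open_gt (-1))|apply (open_lt 1)]; lra.
Qed.

(** Transports a closed form of a sum through the Euler operator. Iterated, it gives the derivatives
    of the square of [phi] without touching the coefficients of the Cauchy product. *)
Lemma PSeries_theta a (f : R -> R) x df :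
  analytic1 a -> Rabs x < 1 -> (forall y, Rabs y < 1 -> PSeries a y = f y) ->
  is_derive f x df -> PSeries (theta a) x = x * df.
Proof.
  intros Ha Hx E Hf; rewrite PSeries_theta_eq; f_equal.
  rewrite <- (is_derive_unique _ _ _ (is_derive_PSeries1 a x Ha Hx)).
  apply is_derive_unique; apply (is_derive_ext_loc f); [|exact Hf].
  apply (filter_imp (fun y => Rabs y < 1)); [|apply locally_abs_lt_1, Hx].
  intros y Hy; symmetry; apply E, Hy.
Qed.

Lemma PSeries_unique a b :
  analytic1 a -> analytic1 b -> (forall x, Rabs x < 1 -> PSeries a x = PSeries b x) ->
  forall n, a n = b n.
Proof.
  intros Ha Hb E n.
  assert (H0 : Rabs 0 < 1) by (rewrite Rabs_R0; lra).
  apply PSeries_ext_recip.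
  - generalize (Ha 0 H0); rewrite Rabs_R0; trivial.
  - generalize (Hb 0 H0); rewrite Rabs_R0; trivial.
  - apply (filter_imp (fun y => Rabs y < 1)); [exact E|apply locally_abs_lt_1, H0].
Qed.

(* Coefficients of 2F1(1/12, 5/12; 1; x). *)
Fixpoint gauss (n : nat) : R :=
  match n with
  | O => 1
  | S k => gauss k * ((INR k + 1 / 12) * (INR k + 5 / 12) / (INR k + 1) ^ 2)
  end.

Lemma gauss_rec k :
  gauss (S k) * (INR k + 1) ^ 2 = gauss k * ((INR k + 1 / 12) * (INR k + 5 / 12)).
Proof. cbn [gauss]; generalize (pos_INR k); intros; field; lra. Qed.

(* Coefficients of 3F2(1/6, 1/2, 5/6; 1, 1; x). *)
Fixpoint clausen (n : nat) : R :=
  match n with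
  | O => 1
  | S k => clausen k * ((INR k + 1 / 6) * (INR k + 1 / 2) * (INR k + 5 / 6) / (INR k + 1) ^ 3)
  end.

Lemma gauss_bounds n : 0 < gauss n <= 1.
Proof.
  induction n as [|n IH]; cbn [gauss]; [lra|].
  assert (Hn := pos_INR n).
  set (r := _ / _); assert (0 < r <= 1); [|nra].
  assert (0 < (INR n + 1) ^ 2) by (apply pow_lt; lra).
  unfold r; split; [apply Rdiv_lt_0_compat; nra|].
  apply Rle_div_l; [lra|nra].
Qed.

Lemma clausen_bounds n : 0 < clausen n <= 1.
Proof.
  induction n as [|n IH]; cbn [clausen]; [lra|].
  assert (Hn := pos_INR n).
  set (r := _ / _); assert (0 < r <= 1); [|nra].
  assert (0 < (INR n + 1) ^ 3) by (apply pow_lt; lra).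
  assert (0 < (INR n + 1 / 6) * (INR n + 1 / 2) * (INR n + 5 / 6))
    by (repeat apply Rmult_lt_0_compat; lra).
  unfold r; split; [apply Rdiv_lt_0_compat; lra|].
  apply Rle_div_l; [lra|].
  assert (0 <= INR n * INR n) by nra; assert (0 <= INR n * INR n * INR n) by nra; nra.
Qed.

Lemma analytic1_gauss : analytic1 gauss.
Proof.
  apply (analytic1_bounded _ 1); intros n; generalize (gauss_bounds n); intros H.
  rewrite Rabs_pos_eq; lra.
Qed.

Lemma analytic1_clausen : analytic1 clausen.
Proof.
  apply (analytic1_bounded _ 1); intros n; generalize (clausen_bounds n); intros H.
  rewrite Rabs_pos_eq; lra.
Qed.

Definition phi : R -> R := PSeries gauss.
Definition phi1 : R -> R := PSeries (PS_derive gauss).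
Definition phi2 : R -> R := PSeries (PS_derive (PS_derive gauss)).
Definition phi3 : R -> R := PSeries (PS_derive (PS_derive (PS_derive gauss))).

Lemma analytic1_derive a : analytic1 a -> analytic1 (PS_derive a).
Proof. intros Ha x Hx; rewrite CV_radius_derive; apply Ha, Hx. Qed.

Lemma is_derive_phi x : Rabs x < 1 -> is_derive phi x (phi1 x).
Proof. apply is_derive_PSeries1, analytic1_gauss. Qed.

Lemma is_derive_phi1 x : Rabs x < 1 -> is_derive phi1 x (phi2 x).
Proof. apply is_derive_PSeries1, analytic1_derive, analytic1_gauss. Qed.

Lemma is_derive_phi2 x : Rabs x < 1 -> is_derive phi2 x (phi3 x).
Proof. apply is_derive_PSeries1, analytic1_derive, analytic1_derive, analytic1_gauss. Qed.

Lemma phi_0 : phi 0 = 1.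
Proof. unfold phi; rewrite PSeries_0; reflexivity. Qed.

Lemma gauss_equation x :
  Rabs x < 1 -> x * (1 - x) * phi2 x + (1 - 3 / 2 * x) * phi1 x - 5 / 144 * phi x = 0.
Proof.
  intros Hx; assert (A0 := analytic1_gauss).
  assert (A1 := analytic1_derive _ A0); assert (A2 := analytic1_derive _ A1).
  (* The negative terms are moved to the right, so that the two sides agree coefficient by
     coefficient through [gauss_rec]. Here 5/144 = (1/12)(5/12) and 3/2 = 1 + 1/12 + 5/12. *)
  set (L := PS_plus (PS_derive gauss) (PS_incr_1 (PS_derive (PS_derive gauss)))).
  set (Rr := PS_plus (PS_plus (PS_incr_1 (PS_incr_1 (PS_derive (PS_derive gauss))))
     (PS_scal (3 / 2) (PS_incr_1 (PS_derive gauss)))) (PS_scal (5 / 144) gauss)).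
  assert (E : PSeries L x = PSeries Rr x).
  { apply PSeries_ext; intros n; unfold L, Rr; clear; generalize gauss_rec.
    generalize gauss; intros a Hs.
    unfold PS_plus, PS_scal, PS_incr_1, PS_derive.
    destruct n as [|[|n]]; rewrite ?S_INR; hier_R.
    - generalize (Hs O); simpl; lra.
    - generalize (Hs 1%nat); simpl; lra.
    - generalize (Hs (S (S n))); rewrite !S_INR; clear; destruct n; [simpl|rewrite ?S_INR]; lra. }
  unfold L, Rr in E.
  rewrite !PSeries_plus, !PSeries_scal, !PSeries_incr_1 in E.
  - unfold phi, phi1, phi2; lra.
  - apply analytic1_ex; [|exact Hx]; apply analytic1_incr, analytic1_incr; assumption.
  - apply analytic1_ex; [|exact Hx]; apply analytic1_scal, analytic1_incr; assumption.
  - apply analytic1_ex; [|exact Hx]; apply analytic1_plus; [apply analytic1_incr, analytic1_incr; assumption|].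
    apply analytic1_scal, analytic1_incr; assumption.
  - apply analytic1_ex; [|exact Hx]; apply analytic1_scal; assumption.
  - apply analytic1_ex; [|exact Hx]; assumption.
  - apply analytic1_ex; [|exact Hx]; apply analytic1_incr; assumption.
Qed.

Lemma gauss_equation' x :
  Rabs x < 1 ->
  x * (1 - x) * phi3 x + (2 - 7 / 2 * x) * phi2 x - (3 / 2 + 5 / 144) * phi1 x = 0.
Proof.
  intros Hx.
  assert (D0 := is_derive_phi x Hx); assert (D1 := is_derive_phi1 x Hx);
  assert (D2 := is_derive_phi2 x Hx).
  assert (Da : is_derive (fun x => x * (1 - x)) x (1 - 2 * x)) by (auto_derive; [trivial|ring]).
  assert (Db : is_derive (fun x => 1 - 3 / 2 * x) x (- (3 / 2))) by (auto_derive; [trivial|ring]).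
  assert (D := is_derive_minus _ _ _ _ _ (is_derive_plus (V := R_NormedModule) _ _ _ _ _
    (is_derive_Rmult _ _ _ _ _ Da D2) (is_derive_Rmult _ _ _ _ _ Db D1))
    (is_derive_scal _ _ (5 / 144) _ D0)).
  apply (is_derive_ext_loc _ (fun _ => 0)) in D.
  - apply is_derive_unique in D; rewrite Derive_const in D; revert D; repeat (unfold minus, scal, plus, opp, zero, one, mult; simpl); lra.
  - apply (filter_imp (fun y => Rabs y < 1)); [|apply locally_abs_lt_1, Hx].
    intros y Hy; rewrite <- (gauss_equation y Hy); hier_R; ring.
Qed.

(** The square of [phi] solves theta^3 y = x (theta + 1/6)(theta + 1/2)(theta + 5/6) y. Uniqueness
    of coefficients turns this equation into the recurrence of [clausen], and both sequences start
    at 1. *)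
Lemma clausen_identity x : Rabs x < 1 -> PSeries clausen x = phi x ^ 2.
Proof.
  set (d := PS_mult gauss gauss).
  assert (A : analytic1 d) by (apply analytic1_mult; exact analytic1_gauss).
  assert (A1 := analytic1_theta _ A); assert (A2 := analytic1_theta _ A1);
  assert (A3 := analytic1_theta _ A2).
  assert (E0 : forall y, Rabs y < 1 -> PSeries d y = phi y * phi y).
  { intros y Hy; apply PSeries_mult; apply analytic1_gauss, Hy. }
  assert (E1 : forall y, Rabs y < 1 -> PSeries (theta d) y = y * (2 * (phi y * phi1 y))).
  { intros y Hy; apply (PSeries_theta d _ y _ A Hy E0).
    assert (D0 := is_derive_phi y Hy).
    evar_last; [exact (is_derive_Rmult _ _ _ _ _ D0 D0)|hier_R; ring]. }
  assert (E2 : forall y, Rabs y < 1 -> PSeries (theta (theta d)) y =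
    y * (2 * (phi y * phi1 y) + y * (2 * (phi1 y * phi1 y + phi y * phi2 y)))).
  { intros y Hy; apply (PSeries_theta (theta d) _ y _ A1 Hy E1).
    assert (D0 := is_derive_phi y Hy); assert (D1 := is_derive_phi1 y Hy).
    evar_last; [exact (is_derive_Rmult _ _ _ _ _ (is_derive_id y)
      (is_derive_scal _ _ 2 _ (is_derive_Rmult _ _ _ _ _ D0 D1)))|hier_R; ring]. }
  assert (E3 : forall y, Rabs y < 1 -> PSeries (theta (theta (theta d))) y =
    y * (2 * (phi y * phi1 y) + 3 * y * (2 * (phi1 y * phi1 y + phi y * phi2 y))
      + y ^ 2 * (2 * (3 * phi1 y * phi2 y + phi y * phi3 y)))).
  { intros y Hy; apply (PSeries_theta (theta (theta d)) _ y _ A2 Hy E2).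
    assert (D0 := is_derive_phi y Hy); assert (D1 := is_derive_phi1 y Hy);
    assert (D2 := is_derive_phi2 y Hy); assert (Di := is_derive_id (K := R_AbsRing) y).
    evar_last; [exact (is_derive_Rmult _ _ _ _ _ Di
      (is_derive_plus (V := R_NormedModule) _ _ _ _ _
       (is_derive_scal _ _ 2 _ (is_derive_Rmult _ _ _ _ _ D0 D1))
       (is_derive_Rmult _ _ _ _ _ Di (is_derive_scal _ _ 2 _
         (is_derive_plus (V := R_NormedModule) _ _ _ _ _
           (is_derive_Rmult _ _ _ _ _ D1 D1) (is_derive_Rmult _ _ _ _ _ D0 D2))))))|hier_R; ring]. }
  (* 3/2, 23/36 and 5/72 are the elementary symmetric functions of 1/6, 1/2 and 5/6. *)
  set (r := PS_plus (PS_plus (theta (theta (theta d))) (PS_scal (3 / 2) (theta (theta d))))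
    (PS_plus (PS_scal (23 / 36) (theta d)) (PS_scal (5 / 72) d))).
  assert (B0 := analytic1_scal (5 / 72) _ A); assert (B1 := analytic1_scal (23 / 36) _ A1);
  assert (B2 := analytic1_scal (3 / 2) _ A2).
  assert (C1 := analytic1_plus _ _ A3 B2); assert (C0 := analytic1_plus _ _ B1 B0).
  assert (Ar : analytic1 r) by exact (analytic1_plus _ _ C1 C0).
  assert (Er : forall n, theta (theta (theta d)) n = PS_incr_1 r n).
  { apply PSeries_unique; [exact A3|apply analytic1_incr, Ar|].
    intros y Hy; rewrite PSeries_incr_1; unfold r; rewrite !PSeries_plus, !PSeries_scal.
    all: try (apply analytic1_ex; [assumption|exact Hy]).
    rewrite E3, E2, E1, E0 by exact Hy.
    assert (H0 := gauss_equation y Hy); assert (H1 := gauss_equation' y Hy).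
    apply Rminus_diag_uniq.
    (* The third-order equation of the square is a combination of the Gauss equation and its
       derivative, with coefficients in [y], [phi] and [phi1]. *)
    match goal with |- ?e = 0 => replace e with
     (2 * y ^ 2 * phi y * (y * (1 - y) * phi3 y + (2 - 7 / 2 * y) * phi2 y
         - (3 / 2 + 5 / 144) * phi1 y)
      + (6 * y ^ 2 * phi1 y + 2 * y * phi y) * (y * (1 - y) * phi2 y + (1 - 3 / 2 * y) * phi1 y - 5 / 144 * phi y)) end.
    - rewrite H0, H1; ring.
    - field. }
  assert (Ed : forall n, d n = clausen n).
  { induction n as [|n IH].
    - unfold d, PS_mult; simpl; ring.
    - assert (H : INR (S n) * (INR (S n) * (INR (S n) * d (S n))) =
        INR n * (INR n * (INR n * d n)) + 3 / 2 * (INR n * (INR n * d n))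
        + (23 / 36 * (INR n * d n) + 5 / 72 * d n)) by exact (Er (S n)).
      rewrite IH, S_INR in H; cbn [clausen]; assert (Hn := pos_INR n).
      assert (0 < (INR n + 1) ^ 3) by (apply pow_lt; lra).
      apply (Rmult_eq_reg_l ((INR n + 1) ^ 3)); [|lra].
      transitivity ((INR n + 1) * ((INR n + 1) * ((INR n + 1) * d (S n)))); [ring|].
      rewrite H; field; lra. }
  intros Hx; rewrite <- (PSeries_ext d); [rewrite E0 by exact Hx; ring|exact Ed].
Qed.

(** * Hypergeometric expression of the periods *)

Lemma is_derive_continuity_pt (f : R -> R) x l : is_derive f x l -> continuity_pt f x.
Proof. intros H; apply continuity_pt_filterlim, continuous_R_of_derive; exists l; exact H. Qed.

(* [kappa] is, up to a constant, the only solution of its equation that is regular at [1]: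
   the Wronskian of two such solutions, multiplied by [m (1 - m)], is constant and vanishes at [1]. *)
Lemma kappa_unique (psi psi' : R -> R) m0 :
  0 < m0 < 1 -> psi 1 = 1 ->
  (forall m, m0 <= m <= 1 -> is_derive psi m (psi' m)) ->
  (forall m, m0 <= m <= 1 -> is_derive (fun u => u * (1 - u) * psi' u) m (psi m / 4)) ->
  kappa m0 = PI / 2 * psi m0 /\ kappa' m0 = PI / 2 * psi' m0.
Proof.
  intros Hm P1 D1 D2.
  set (w := fun m => kappa m * (m * (1 - m) * psi' m) - psi m * (m * (1 - m) * kappa' m)).
  assert (W : forall m, m0 <= m <= 1 -> w m = 0).
  { intros m Hx; replace 0 with (w 1) by (unfold w; ring).
    apply derive_0_const; intros x; rewrite Rmin_left, Rmax_right by lra; intros Hx'.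
    evar_last.
    - exact (is_derive_minus (V := R_NormedModule) _ _ _ _ _
        (is_derive_Rmult _ _ _ _ _ (is_derive_kappa x ltac:(lra)) (D2 x ltac:(lra)))
        (is_derive_Rmult _ _ _ _ _ (D1 x ltac:(lra)) (is_derive_kappa' x ltac:(lra)))).
    - hier_R; field. }
  assert (W' : forall m, m0 <= m < 1 -> kappa m * psi' m = psi m * kappa' m).
  { intros m Hx; assert (H := W m ltac:(lra)); unfold w in H.
    apply (Rmult_eq_reg_l (m * (1 - m))); [lra|].
    apply Rgt_not_eq, Rmult_lt_0_compat; lra. }
  assert (Q : forall m, m0 <= m <= 1 -> is_derive (fun u => psi u / kappa u) m
    ((psi' m * kappa m - psi m * kappa' m) / kappa m ^ 2)).
  { intros m Hx; apply (is_derive_div psi kappa); [apply D1, Hx|apply is_derive_kappa; lra|].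
    apply Rgt_not_eq, kappa_pos; lra. }
  assert (E : psi m0 / kappa m0 = psi 1 / kappa 1).
  { destruct (MVT_gen (fun u => psi u / kappa u) m0 1
      (fun m => (psi' m * kappa m - psi m * kappa' m) / kappa m ^ 2)) as [c [_ Hc]].
    - intros x; rewrite Rmin_left, Rmax_right by lra; intros Hx; apply Q; lra.
    - intros x; rewrite Rmin_left, Rmax_right by lra; intros Hx.
      apply (is_derive_continuity_pt _ _ _ (Q x ltac:(lra))).
    - destruct (MVT_gen (fun u => psi u / kappa u) m0 1 (fun _ => 0)) as [c' [_ Hc']].
      + intros x; rewrite Rmin_left, Rmax_right by lra; intros Hx.
        evar_last; [apply Q; lra|]; rewrite (Rmult_comm (psi' x)), W' by lra.
        hier_R; field; apply Rgt_not_eq, kappa_pos; lra.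
      + intros x; rewrite Rmin_left, Rmax_right by lra; intros Hx.
        apply (is_derive_continuity_pt _ _ _ (Q x ltac:(lra))).
      + lra. }
  assert (Kp := kappa_pos m0 ltac:(lra)); assert (K1 := kappa_1); assert (P2 := PI2_pos).
  assert (Ek : kappa m0 = PI / 2 * psi m0).
  { rewrite P1, K1 in E.
    apply (f_equal (fun z => z * kappa m0 * (PI / 2))) in E; field_simplify in E; lra. }
  split; [exact Ek|].
  assert (H := W' m0 ltac:(lra)); rewrite Ek in H.
  apply (Rmult_eq_reg_l (psi m0)); [lra|].
  intros Z; rewrite Z in Ek; lra.
Qed.

(** For t < 1 this is (1 - t)^(-1/4), the algebraic factor between [kappa] and [phi]. *)
Definition weight (t : R) : R := exp (- (ln (1 - t) / 4)).

Lemma weight_pos t : 0 < weight t.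
Proof. apply exp_pos. Qed.

Lemma weight_pow4 t : t < 1 -> weight t ^ 4 = / (1 - t).
Proof.
  intros Ht; unfold weight; set (a := - (ln (1 - t) / 4)).
  replace (exp a ^ 4) with (exp (a + a + a + a)) by (rewrite !exp_plus; ring).
  replace (a + a + a + a) with (- ln (1 - t)) by (unfold a; field).
  rewrite exp_Ropp, exp_ln; lra.
Qed.

Lemma is_derive_Rcomp (f g : R -> R) x df dg :
  is_derive f (g x) df -> is_derive g x dg -> is_derive (fun u => f (g u)) x (dg * df).
Proof. exact (is_derive_comp f g x df dg). Qed.

Lemma is_derive_weight k m :
  0 < 1 - k * (m * (1 - m)) ->
  is_derive (fun u => weight (k * (u * (1 - u)))) m
    (k * (1 - 2 * m) / (4 * (1 - k * (m * (1 - m)))) * weight (k * (m * (1 - m)))).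
Proof.
  intros H; unfold weight; auto_derive; [lra|].
  unfold Rminus, Rdiv in *; field; lra.
Qed.

(** The candidate [weight * phi X] is substituted into the equation of [kappa], [l] being the
    logarithmic derivative of the weight. The last three hypotheses match the coefficients of
    [phi2], [phi] and [phi1] after subtracting [K] times the Gauss equation; [X 1 = 0] makes the
    candidate regular at the end 1, where [kappa] is known. *)
Lemma kappa_hypergeometric k (X X' X'' l l' K : R -> R) m0 :
  0 < m0 < 1 ->
  (forall m, m0 <= m <= 1 -> 0 < 1 - k * (m * (1 - m))) ->
  (forall m, m0 <= m <= 1 -> Rabs (X m) < 1) ->
  (forall m, m0 <= m <= 1 -> is_derive X m (X' m)) ->
  (forall m, m0 <= m <= 1 -> is_derive (fun u => u * (1 - u) * X' u) m (X'' m)) ->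
  (forall m, m0 <= m <= 1 -> l m = k * (1 - 2 * m) / (4 * (1 - k * (m * (1 - m))))) ->
  (forall m, m0 <= m <= 1 -> is_derive (fun u => u * (1 - u) * l u) m (l' m)) ->
  X 1 = 0 ->
  (forall m, m0 <= m <= 1 -> m * (1 - m) * X' m ^ 2 = K m * (X m * (1 - X m))) ->
  (forall m, m0 <= m <= 1 -> m * (1 - m) * l m ^ 2 + l' m + 5 / 144 * K m = 1 / 4) ->
  (forall m, m0 <= m <= 1 ->
     2 * (m * (1 - m)) * l m * X' m + X'' m - K m * (1 - 3 / 2 * X m) = 0) ->
  kappa m0 = PI / 2 * (weight (k * (m0 * (1 - m0))) * phi (X m0)) /\
  kappa' m0 = PI / 2 * (weight (k * (m0 * (1 - m0))) * (l m0 * phi (X m0) + X' m0 * phi1 (X m0))).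
Proof.
  intros Hm Hk HX DX DX' Hl Dl X1 HK H0 H1.
  apply (kappa_unique (fun m => weight (k * (m * (1 - m))) * phi (X m))
    (fun m => weight (k * (m * (1 - m))) * (l m * phi (X m) + X' m * phi1 (X m)))).
  - exact Hm.
  - rewrite X1, phi_0; unfold weight; replace (1 - k * (1 * (1 - 1))) with 1 by ring.
    rewrite ln_1; replace (- (0 / 4)) with 0 by field; rewrite exp_0; ring.
  - intros m Hx; assert (D := is_derive_weight k m (Hk m Hx)); rewrite <- Hl in D by exact Hx.
    evar_last; [exact (is_derive_Rmult _ _ _ _ _ D
      (is_derive_Rcomp _ _ _ _ _ (is_derive_phi _ (HX m Hx)) (DX m Hx)))|].
    hier_R; ring.
  - intros m Hx; assert (D := is_derive_weight k m (Hk m Hx)); rewrite <- Hl in D by exact Hx.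
    assert (P0 := is_derive_Rcomp _ _ _ _ _ (is_derive_phi _ (HX m Hx)) (DX m Hx)).
    assert (P1 := is_derive_Rcomp _ _ _ _ _ (is_derive_phi1 _ (HX m Hx)) (DX m Hx)).
    apply (is_derive_ext (fun u => weight (k * (u * (1 - u))) *
      (u * (1 - u) * l u * phi (X u) + u * (1 - u) * X' u * phi1 (X u)))).
    { intros u; eqR; ring. }
    evar_last; [exact (is_derive_Rmult _ _ _ _ _ D (is_derive_plus (V := R_NormedModule) _ _ _ _ _
      (is_derive_Rmult _ _ _ _ _ (Dl m Hx) P0) (is_derive_Rmult _ _ _ _ _ (DX' m Hx) P1)))|].
    hier_R.
    assert (G := gauss_equation _ (HX m Hx)).
    specialize (HK m Hx); specialize (H0 m Hx); specialize (H1 m Hx).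
    set (W := weight _); set (F0 := phi _) in *; set (F1 := phi1 _) in *; set (F2 := phi2 _) in *.
    transitivity (W * ((m * (1 - m) * l m ^ 2 + l' m + 5 / 144 * K m) * F0
      + (2 * (m * (1 - m)) * l m * X' m + X'' m - K m * (1 - 3 / 2 * X m)) * F1
      + (m * (1 - m) * X' m ^ 2 - K m * (X m * (1 - X m))) * F2
      + K m * (X m * (1 - X m) * F2 + (1 - 3 / 2 * X m) * F1 - 5 / 144 * F0))); [ring|].
    rewrite H0, H1, HK, G; field.
Qed.

Lemma mul_compl_bounds m0 m : 1 / 2 < m0 -> m0 <= m <= 1 -> 0 <= m * (1 - m) <= m0 * (1 - m0).
Proof. intros; nra. Qed.

(* With [t = m (1 - m)], these are [1728 / j] for the cubics [v (v + 1) (v + m)] and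
   [v (v^2 + 2 (2 m - 1) v + 1)] respectively. *)
Definition X_I (t : R) : R := 27 * t ^ 2 / (4 * (1 - t) ^ 3).
Definition X_II (t : R) : R := - 108 * t / (1 - 16 * t) ^ 3.

Lemma kappa_I m :
  1 / 2 < m < 1 -> let t := m * (1 - m) in
  kappa m = PI / 2 * (weight t * phi (X_I t)) /\
  kappa' m = PI / 2 * (weight t * ((1 - 2 * m) / (4 * (1 - t)) * phi (X_I t)
    + (1 - 2 * m) * (27 * t * (2 + t)) / (4 * (1 - t) ^ 4) * phi1 (X_I t))).
Proof.
  intros Hm t.
  replace t with (1 * (m * (1 - m))) at 1 3 by (unfold t; ring).
  assert (T : forall u, m <= u <= 1 -> 0 <= u * (1 - u) < 1 / 4).
  { intros u Hu; assert (H := mul_compl_bounds m u ltac:(lra) Hu); nra. }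
  apply (kappa_hypergeometric 1 (fun m => X_I (m * (1 - m)))
    (fun m => let t := m * (1 - m) in (1 - 2 * m) * (27 * t * (2 + t)) / (4 * (1 - t) ^ 4))
    (fun m => let t := m * (1 - m) in
       - 27 * t ^ 2 * (2 + t) / (2 * (1 - t) ^ 4)
       + (1 - 2 * m) ^ 2 * (27 * (4 * t + 7 * t ^ 2 + t ^ 3)) / (4 * (1 - t) ^ 5))
    (fun m => (1 - 2 * m) / (4 * (1 - m * (1 - m))))
    (fun m => let t := m * (1 - m) in
       - t / (2 * (1 - t)) + (1 - 2 * m) ^ 2 / (4 * (1 - t) ^ 2))
    (fun m => let t := m * (1 - m) in 27 * t / (1 - t) ^ 2)); unfold X_I.
  - lra.
  - intros u Hu; generalize (T u Hu); lra.
  - intros u Hu; assert (H := T u Hu); set (s := u * (1 - u)) in *.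
    assert (0 < (1 - s) ^ 3) by (apply pow_lt; lra).
    rewrite Rabs_pos_eq.
    + apply Rlt_div_l; [lra|].
      (* 4 (1 - s)^3 - 27 s^2 = (1 - 4 s)(2 + s)^2, so [X_I s < 1] amounts to s < 1/4. *)
      assert (0 < (1 - 4 * s) * (2 + s) ^ 2) by (apply Rmult_lt_0_compat; nra); nra.
    + apply Rdiv_le_0_compat; nra.
  - intros u Hu; assert (H := T u Hu); auto_derive; [|field; lra].
    apply Rgt_not_eq, Rmult_lt_0_compat; [lra|]. apply (pow_lt _ 3); lra.
  - intros u Hu; assert (H := T u Hu); auto_derive; [|field; lra].
    apply Rgt_not_eq, Rmult_lt_0_compat; [lra|]. apply (pow_lt _ 4); lra.
  - intros u Hu; assert (H := T u Hu); field; lra.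
  - intros u Hu; assert (H := T u Hu); auto_derive; [lra|field; lra].
  - unfold Rdiv; ring.
  - intros u Hu; assert (H := T u Hu); field; lra.
  - intros u Hu; assert (H := T u Hu); field; lra.
  - intros u Hu; assert (H := T u Hu); field; lra.
Qed.

Lemma kappa_II m :
  1 / 2 < m < 1 -> let t := m * (1 - m) in
  16 * t < 1 -> 108 * t < (1 - 16 * t) ^ 3 ->
  kappa m = PI / 2 * (weight (16 * t) * phi (X_II t)) /\
  kappa' m = PI / 2 * (weight (16 * t) * (4 * (1 - 2 * m) / (1 - 16 * t) * phi (X_II t)
    + - 108 * (1 - 2 * m) * (1 + 32 * t) / (1 - 16 * t) ^ 4 * phi1 (X_II t))).
Proof.
  intros Hm t H1 H2.
  (* To the right of 1/2 the product u (1 - u) decreases, so the two bounds assumed at [m] hold on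
     the whole path to 1. *)
  assert (T : forall u, m <= u <= 1 -> 0 <= u * (1 - u) <= t /\ 16 * (u * (1 - u)) < 1).
  { intros u Hu; assert (H := mul_compl_bounds m u ltac:(lra) Hu); fold t in H; lra. }
  apply (kappa_hypergeometric 16 (fun m => X_II (m * (1 - m)))
    (fun m => let t := m * (1 - m) in - 108 * (1 - 2 * m) * (1 + 32 * t) / (1 - 16 * t) ^ 4)
    (fun m => let t := m * (1 - m) in - 108 * (- 2 * t * (1 + 32 * t) / (1 - 16 * t) ^ 4
       + (1 - 2 * m) ^ 2 * ((1 + 64 * t) * (1 - 16 * t) + 64 * t * (1 + 32 * t)) / (1 - 16 * t) ^ 5))
    (fun m => 4 * (1 - 2 * m) / (1 - 16 * (m * (1 - m))))
    (fun m => let t := m * (1 - m) in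
       - 8 * t / (1 - 16 * t) + 4 * (1 - 2 * m) ^ 2 / (1 - 16 * t) ^ 2)
    (fun m => let t := m * (1 - m) in - 108 / (1 - 16 * t) ^ 2)); unfold X_II.
  - lra.
  - intros u Hu; generalize (T u Hu); lra.
  - intros u Hu; assert (H := T u Hu); set (s := u * (1 - u)) in *.
    assert (0 < (1 - 16 * s) ^ 3) by (apply pow_lt; lra).
    assert ((1 - 16 * t) ^ 3 <= (1 - 16 * s) ^ 3) by (apply pow_incr; lra).
    replace (- 108 * s / (1 - 16 * s) ^ 3) with (- (108 * s / (1 - 16 * s) ^ 3)) by (field; lra).
    rewrite Rabs_Ropp, Rabs_pos_eq.
    + apply Rlt_div_l; lra.
    + apply Rdiv_le_0_compat; lra.
  - intros u Hu; assert (H := T u Hu); auto_derive; [|field; lra].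
    apply Rgt_not_eq, (pow_lt _ 3); lra.
  - intros u Hu; assert (H := T u Hu); auto_derive; [|field; lra].
    apply Rgt_not_eq, (pow_lt _ 4); lra.
  - intros u Hu; assert (H := T u Hu); field; lra.
  - intros u Hu; assert (H := T u Hu); auto_derive; [lra|field; lra].
  - unfold Rdiv; ring.
  - intros u Hu; assert (H := T u Hu); field; lra.
  - intros u Hu; assert (H := T u Hu); field; lra.
  - intros u Hu; assert (H := T u Hu); field; lra.
Qed.

(** * Real and imaginary periods of a real cubic *)

(* [A] is the complete integral of [1 / sqrt (u^4 + beta u^2 + gamma)] over the half line, and
   [Z] the regularized complete integral of [u^2 / sqrt (u^4 + beta u^2 + gamma)]. *)
Definition periods (beta gamma A Z : R) : Prop :=
  exists H Y : R -> R,
    (forall u, 0 < u -> is_derive H u (/ sqrt (u ^ 4 + beta * u ^ 2 + gamma))) /\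
    (forall u, 0 < u -> is_derive Y u (u ^ 2 / sqrt (u ^ 4 + beta * u ^ 2 + gamma))) /\
    (H 0 = 0 /\ continuous H 0) /\ (Y 0 = 0 /\ continuous Y 0) /\
    is_lim H p_infty A /\ is_lim (fun u => Y u - u) p_infty Z.

Lemma is_lim_inv_bound (f : R -> R) C M :
  (forall u, M < u -> 0 < u -> Rabs (f u) <= C / u) -> is_lim f p_infty 0.
Proof.
  intros Hf; apply is_lim_spec; intros eps.
  exists (Rmax (Rmax M 0) (C / eps)); intros u Hu.
  assert (Rmax M 0 < u) by (eapply Rle_lt_trans; [apply Rmax_l|exact Hu]).
  assert (M < u) by (eapply Rle_lt_trans; [apply Rmax_l|eassumption]).
  assert (0 < u) by (eapply Rle_lt_trans; [apply Rmax_r|eassumption]).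
  assert (C / eps < u) by (eapply Rle_lt_trans; [apply Rmax_r|exact Hu]).
  rewrite Rminus_0_r; eapply Rle_lt_trans; [apply Hf; assumption|].
  assert (He := cond_pos eps).
  apply Rlt_div_l; [assumption|]; apply Rlt_div_l in H2; [lra|assumption].
Qed.

Lemma is_lim_comp_cont (F g : R -> R) l :
  continuous F l -> is_lim g p_infty l -> is_lim (fun u => F (g u)) p_infty (F l).
Proof. intros HF Hg; exact (filterlim_comp _ _ _ g F _ _ _ Hg HF). Qed.

Lemma is_lim_atan_p : is_lim atan p_infty (PI / 2).
Proof.
  apply is_lim_spec; intros eps; assert (He := cond_pos eps); assert (Hp := PI2_pos).
  set (y := Rmax 0 (PI / 2 - eps)).
  assert (Hy : 0 <= y < PI / 2).
  { unfold y; split; [apply Rmax_l|apply Rmax_lub_lt; lra]. }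
  assert (Hy' : PI / 2 - eps <= y) by apply Rmax_r.
  exists (tan y); intros u Hu.
  apply atan_increasing in Hu; rewrite atan_tan in Hu by lra.
  generalize (atan_bound u); intros; apply Rabs_def1; lra.
Qed.

Lemma is_lim_eq (f : R -> R) (l l' : R) : is_lim f p_infty l -> l = l' -> is_lim f p_infty l'.
Proof. intros H <-; exact H. Qed.

(** The convergent part of the second-kind integrals, once an algebraic function of linear growth is
    split off. *)
Definition kappa3 (m : R) : R := RInt (fun t => / (quad m t * sqrt (quad m t))) 0 (PI / 2).

Lemma quad32_continuous m t : 0 < m -> continuous (fun u => / (quad m u * sqrt (quad m u))) t.
Proof.
  intros Hm; apply (continuous_ext (fun u => 1 / (quad m u * sqrt (quad m u)))).
  - intros u; apply Rmult_1_l.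
  - apply (continuous_div_quad32 (fun _ => 1)); [exact Hm|apply one_continuous].
Qed.

Lemma quad12_continuous m t : 0 < m -> continuous (fun u => / sqrt (quad m u)) t.
Proof.
  intros Hm; apply continuous_inv_R; [apply quad_continuous, Hm|].
  apply Rgt_not_eq, sqrt_quad_pos, Hm.
Qed.

Lemma kappa_eq m : kappa m = RInt (fun t => / sqrt (quad m t)) 0 (PI / 2).
Proof. apply RInt_ext; intros t _; eqR; apply Rmult_1_l. Qed.

(** Multiplying and dividing 1 / sqrt(quad) by quad = 1 - (1 - m) cos^2 t produces [kappa3] and the
    integral that differentiation of [kappa] gives. *)
Lemma kappa3_eq m : 0 < m -> kappa3 m = kappa m - 2 * (1 - m) * kappa' m.
Proof.
  intros Hm; assert (D := is_derive_kappa m Hm).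
  assert (D' := quad_int_derive (fun _ => 1) m Hm one_continuous); fold kappa in D'.
  rewrite <- (is_derive_unique _ _ _ D); rewrite (is_derive_unique kappa _ _ D').
  assert (I3 : is_RInt (fun t => / (quad m t * sqrt (quad m t))) 0 (PI / 2) (kappa3 m)).
  { apply (RInt_correct (V := R_CompleteNormedModule)), ex_RInt_cont; intros; apply quad32_continuous, Hm. }
  set (J := RInt _ 0 (PI / 2)).
  assert (I2 : is_RInt (fun t => - (1 * cos t ^ 2 / (2 * (quad m t * sqrt (quad m t))))) 0 (PI / 2) J).
  { apply (RInt_correct (V := R_CompleteNormedModule)), ex_RInt_cont; intros t.
    apply (continuous_ext (fun t => (- cos t ^ 2 / 2) / (quad m t * sqrt (quad m t)))).
    - intros u; assert (Hq := quad_pos m u Hm); assert (Hs := sqrt_quad_pos m u Hm); eqR; field; lra.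
    - apply (continuous_div_quad32 (fun t => - cos t ^ 2 / 2)); [exact Hm|cont_elem]. }
  assert (I1 := is_RInt_plus _ _ _ _ _ _ I3 (is_RInt_scal _ _ _ (2 * (1 - m)) _ I2)).
  apply Rplus_eq_reg_r with (2 * (1 - m) * J); transitivity (kappa m); [|ring].
  rewrite kappa_eq; symmetry; apply is_RInt_unique.
  apply (is_RInt_ext _ (fun t => / sqrt (quad m t))) in I1; [exact I1|].
  intros t _; hier_R; assert (Hq := quad_pos m t Hm); assert (Hs := sqrt_quad_pos m t Hm).
  assert (E : quad m t = 1 - (1 - m) * cos t ^ 2) by (unfold quad; generalize (sin_cos_sqr t); lra).
  set (s := sqrt (quad m t)) in *.
  apply (Rmult_eq_reg_r (quad m t * s)); [|apply Rgt_not_eq, Rmult_lt_0_compat; assumption].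
  field_simplify; try lra.
  all: rewrite ?E; ring.
Qed.

Lemma is_derive_RInt_cont (f : R -> R) x :
  (forall t, continuous f t) -> is_derive (fun y => RInt f 0 y) x (f x).
Proof.
  intros Hf; apply (is_derive_RInt f _ 0); [|apply Hf].
  exists (mkposreal 1 Rlt_0_1); intros y _.
  apply (RInt_correct (V := R_CompleteNormedModule)), ex_RInt_cont, Hf.
Qed.

Lemma RInt_00 (f : R -> R) : RInt f 0 0 = 0.
Proof. apply (RInt_point (V := R_CompleteNormedModule)). Qed.

Lemma quad_atan m u : quad m (atan u) = (u ^ 2 + m) / (1 + u ^ 2).
Proof.
  unfold quad; rewrite cos_atan, sin_atan; unfold Rsqr.
  assert (H : 0 < 1 + u * u) by nra.
  assert (E : sqrt (1 + u * u) ^ 2 = 1 + u * u) by (apply pow2_sqrt; lra).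
  assert (Hs := sqrt_lt_R0 _ H).
  replace (1 + u ^ 2) with (1 + u * u) by ring; rewrite <- E at 3; field; lra.
Qed.

Lemma sqrt_div_sqr a b : 0 <= a -> 0 < b -> sqrt (a / b ^ 2) = sqrt a / b.
Proof.
  intros Ha Hb; rewrite sqrt_div_alt by (apply pow_lt, Hb).
  f_equal; apply sqrt_pow2; lra.
Qed.

(** The quartic is (u^2 + 1)(u^2 + m), and u = tan t reduces it to [quad]. In the second-kind
    antiderivative the algebraic function [h] carries the growth, h(u) - u being O(1/u); the rest is
    - m times the incomplete [kappa3]. *)
Lemma periods_I m :
  0 < m -> periods (1 + m) m (kappa m) (- m * kappa m + 2 * m * (1 - m) * kappa' m).
Proof.
  intros Hm.
  set (F := fun x => RInt (fun t => / sqrt (quad m t)) 0 x).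
  set (F3 := fun x => RInt (fun t => / (quad m t * sqrt (quad m t))) 0 x).
  assert (DF : forall x, is_derive F x (/ sqrt (quad m x))).
  { intros x; apply (is_derive_RInt_cont (fun t => / sqrt (quad m t))); intros; apply quad12_continuous, Hm. }
  assert (DF3 : forall x, is_derive F3 x (/ (quad m x * sqrt (quad m x)))).
  { intros x; apply (is_derive_RInt_cont (fun t => / (quad m t * sqrt (quad m t)))); intros; apply quad32_continuous, Hm. }
  assert (Da : forall u, is_derive atan u (/ (1 + u ^ 2))).
  { intros u; auto_derive; [trivial|]. unfold Rsqr; field; nra. }
  set (h := fun u => u * sqrt (1 + u ^ 2) / sqrt (u ^ 2 + m)).
  assert (Sq : forall u, sqrt (quad m (atan u)) = sqrt (u ^ 2 + m) / sqrt (1 + u ^ 2)).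
  { intros u; rewrite quad_atan; apply sqrt_div_alt; nra. }
  assert (SQ : forall u, sqrt (u ^ 4 + (1 + m) * u ^ 2 + m) = sqrt (u ^ 2 + m) * sqrt (1 + u ^ 2)).
  { intros u; rewrite <- sqrt_mult by nra; f_equal; ring. }
  assert (Hpos : forall u, 0 < sqrt (u ^ 2 + m) /\ 0 < sqrt (1 + u ^ 2)).
  { intros u; split; apply sqrt_lt_R0; nra. }
  assert (Hsq : forall u, sqrt (u ^ 2 + m) ^ 2 = u ^ 2 + m /\ sqrt (1 + u ^ 2) ^ 2 = 1 + u ^ 2).
  { intros u; split; apply pow2_sqrt; nra. }
  assert (DH : forall u, is_derive (fun u => F (atan u)) u (/ sqrt (u ^ 4 + (1 + m) * u ^ 2 + m))).
  { intros u; evar_last; [exact (is_derive_Rcomp _ _ _ _ _ (DF (atan u)) (Da u))|].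
    rewrite Sq, SQ; destruct (Hpos u), (Hsq u) as [_ E].
    set (a := sqrt (u ^ 2 + m)) in *; set (b := sqrt (1 + u ^ 2)) in *.
    rewrite <- E; field; lra. }
  assert (Dh : forall u, is_derive h u
    ((u ^ 4 + 2 * m * u ^ 2 + m) / (sqrt (1 + u ^ 2) * sqrt (u ^ 2 + m) ^ 3))).
  { intros u; destruct (Hpos u) as [Ha Hb], (Hsq u) as [Ea Eb].
    unfold h; auto_derive.
    - repeat split; try nra; apply Rgt_not_eq; replace (u * (u * 1)) with (u ^ 2) by ring; assumption.
    - replace (u * (u * 1)) with (u ^ 2) by ring.
      set (a := sqrt (u ^ 2 + m)) in *; set (b := sqrt (1 + u ^ 2)) in *.
      replace m with (a ^ 2 - u ^ 2) by lra.
      apply (Rmult_eq_reg_r (b * a ^ 3)); [|apply Rgt_not_eq, Rmult_lt_0_compat; [lra|apply pow_lt; lra]].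
      field_simplify; try lra; rewrite Eb; ring. }
  assert (DY : forall u, is_derive (fun u => h u - m * F3 (atan u)) u
     (u ^ 2 / sqrt (u ^ 4 + (1 + m) * u ^ 2 + m))).
  { intros u; evar_last.
    - exact (is_derive_minus (V := R_NormedModule) _ _ _ _ _ (Dh u) (is_derive_scal _ _ m _
        (is_derive_Rcomp _ _ _ _ _ (DF3 (atan u)) (Da u)))).
    - rewrite Sq, SQ, quad_atan.
      destruct (Hpos u) as [Ha Hb], (Hsq u) as [Ea Eb].
      set (a := sqrt (u ^ 2 + m)) in *; set (b := sqrt (1 + u ^ 2)) in *.
      rewrite <- Ea, <- Eb; hier_R.
      apply (Rmult_eq_reg_r (b * a ^ 3)); [|apply Rgt_not_eq, Rmult_lt_0_compat; [lra|apply pow_lt; lra]].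
      field_simplify; try lra.
      rewrite Ea, Eb; ring. }
  exists (fun u => F (atan u)), (fun u => h u - m * F3 (atan u)).
  refine (conj _ (conj _ (conj (conj _ _) (conj (conj _ _) (conj _ _))))).
  - intros; apply DH.
  - intros; apply DY.
  - rewrite atan_0; apply RInt_00.
  - apply continuous_R_of_derive; eexists; apply DH.
  - unfold h; rewrite atan_0; unfold F3; rewrite RInt_00; unfold Rdiv; ring.
  - apply continuous_R_of_derive; eexists; apply DY.
  - rewrite kappa_eq; apply (is_lim_comp_cont F); [|apply is_lim_atan_p].
    apply continuous_R_of_derive; eexists; apply DF.
  - apply (is_lim_ext (fun u => (h u - u) - m * F3 (atan u))); [intros; ring|].
    apply (is_lim_eq _ (0 - m * F3 (PI / 2))).
    + apply is_lim_minus'; [|apply (is_lim_scal_l _ m p_infty (F3 (PI / 2)))].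
      * apply (is_lim_inv_bound _ (Rabs (1 - m)) 0); intros u _ Hu.
        destruct (Hpos u) as [Ha Hb], (Hsq u) as [Ea Eb]; unfold h.
        assert (Hua : u <= sqrt (u ^ 2 + m)) by (rewrite <- (sqrt_pow2 u) at 1; [apply sqrt_le_1_alt|]; lra).
        assert (Hub : u <= sqrt (1 + u ^ 2)) by (rewrite <- (sqrt_pow2 u) at 1; [apply sqrt_le_1_alt|]; lra).
        set (a := sqrt (u ^ 2 + m)) in *; set (b := sqrt (1 + u ^ 2)) in *.
        replace (u * b / a - u) with ((1 - m) * (u / (a * (a + b)))).
        -- rewrite Rabs_mult; unfold Rdiv; apply Rmult_le_compat_l; [apply Rabs_pos|].
           rewrite Rabs_pos_eq.
           ++ apply Rle_div_l; [apply Rmult_lt_0_compat; lra|].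
              apply (Rmult_le_reg_l u); [lra|].
              replace (u * (/ u * (a * (a + b)))) with (a * (a + b)) by (field; lra); nra.
           ++ apply Rlt_le, Rdiv_lt_0_compat; [lra|apply Rmult_lt_0_compat; lra].
        -- apply (Rmult_eq_reg_r (a * (a + b))); [|apply Rgt_not_eq, Rmult_lt_0_compat; lra].
           field_simplify; try lra. rewrite Ea, Eb; ring.
      * apply (is_lim_comp_cont F3); [|apply is_lim_atan_p].
        apply continuous_R_of_derive; eexists; apply DF3.
    + change (F3 (PI / 2)) with (kappa3 m); rewrite kappa3_eq by exact Hm; ring.
Qed.

Lemma quad_even m t : quad m (- t) = quad m t.
Proof. unfold quad; rewrite sin_neg, cos_neg; ring. Qed.

Lemma RInt_even_opp (f : R -> R) x :
  (forall t, continuous f t) -> (forall t, f (- t) = f t) -> RInt f 0 (- x) = - RInt f 0 x.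
Proof.
  intros Hc Hf.
  assert (D : forall y, is_derive (fun y => RInt f 0 (- y) + RInt f 0 y) y 0).
  { intros y; assert (Dn : is_derive (fun y => - y) y (- 1)) by (auto_derive; [trivial|ring]).
    evar_last; [exact (is_derive_plus (V := R_NormedModule) _ _ _ _ _
      (is_derive_Rcomp _ _ _ _ _ (is_derive_RInt_cont f (- y) Hc) Dn) (is_derive_RInt_cont f y Hc))|].
    rewrite Hf; hier_R; ring. }
  assert (E := derive_0_const _ x 0 (fun y _ => D y)); simpl in E.
  rewrite Ropp_0, RInt_00 in E; lra.
Qed.

(* The substitution [alpha = 2 atan u - pi / 2] is Landen's transformation. *)
Lemma quad_landen m u :
  quad m (2 * atan u - PI / 2) = (u ^ 4 + 2 * (2 * m - 1) * u ^ 2 + 1) / (1 + u ^ 2) ^ 2.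
Proof.
  unfold quad; rewrite sin_minus, cos_minus, cos_PI2, sin_PI2, sin_2a, cos_2a, cos_atan, sin_atan.
  unfold Rsqr; assert (H : 0 < 1 + u * u) by nra.
  assert (E : sqrt (1 + u * u) ^ 2 = 1 + u * u) by (apply pow2_sqrt; lra).
  assert (Hs := sqrt_lt_R0 _ H); replace (1 + u ^ 2) with (1 + u * u) by ring.
  set (s := sqrt (1 + u * u)) in *; rewrite <- E.
  apply (Rmult_eq_reg_r (s ^ 4)); [|apply pow_nonzero; lra].
  field_simplify; try lra.
Qed.

(** Over the half line the Landen angle runs from - PI / 2 to PI / 2, so evenness gives twice the
    complete integrals; the factor 2 of the differential of the angle compensates. As in the other
    type, [h] carries the linear growth. *)
Lemma periods_II m :
  0 < m < 1 ->
  periods (2 * (2 * m - 1)) 1 (kappa m) ((1 - 2 * m) * kappa m + 4 * m * (1 - m) * kappa' m).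
Proof.
  intros Hm; set (r := 2 * m - 1).
  set (F := fun x => RInt (fun t => / sqrt (quad m t)) 0 x).
  set (F3 := fun x => RInt (fun t => / (quad m t * sqrt (quad m t))) 0 x).
  assert (DF : forall x, is_derive F x (/ sqrt (quad m x))).
  { intros x; apply (is_derive_RInt_cont (fun t => / sqrt (quad m t))); intros; apply quad12_continuous; lra. }
  assert (DF3 : forall x, is_derive F3 x (/ (quad m x * sqrt (quad m x)))).
  { intros x; apply (is_derive_RInt_cont (fun t => / (quad m t * sqrt (quad m t)))); intros; apply quad32_continuous; lra. }
  set (al := fun u => 2 * atan u - PI / 2).
  assert (Da : forall u, is_derive al u (2 / (1 + u ^ 2))).
  { intros u; unfold al; auto_derive; [trivial|]; unfold Rsqr; field; nra. }
  set (Q := fun u => u ^ 4 + 2 * r * u ^ 2 + 1).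
  assert (HQ : forall u, 0 < Q u).
  { intros u; unfold Q, r; assert (0 <= (u ^ 2 - 1) ^ 2) by apply pow2_ge_0.
    assert (0 <= u ^ 2) by apply pow2_ge_0.
    destruct (Req_dec u 0) as [->|Hu]; [lra|].
    assert (0 < u ^ 2) by (apply pow2_gt_0, Hu); nra. }
  assert (Sq : forall u, sqrt (quad m (al u)) = sqrt (Q u) / (1 + u ^ 2)).
  { intros u; unfold al; rewrite quad_landen; fold r; apply sqrt_div_sqr; [apply Rlt_le, HQ|].
    generalize (pow2_ge_0 u); lra. }
  assert (Hs : forall u, 0 < sqrt (Q u)) by (intros; apply sqrt_lt_R0, HQ).
  assert (Es : forall u, sqrt (Q u) ^ 2 = Q u) by (intros; apply pow2_sqrt, Rlt_le, HQ).
  assert (Hc : continuous F (PI / 2)) by (apply continuous_R_of_derive; eexists; apply DF).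
  assert (Hc3 : continuous F3 (PI / 2)) by (apply continuous_R_of_derive; eexists; apply DF3).
  assert (Hal : is_lim al p_infty (PI / 2)).
  { unfold al; apply (is_lim_eq _ (2 * (PI / 2) - PI / 2)); [|field].
    apply is_lim_minus'; [|apply is_lim_const].
    apply (is_lim_scal_l atan 2 p_infty (PI / 2)), is_lim_atan_p. }
  assert (F0 : F (al 0) = - kappa m).
  { unfold al; rewrite atan_0, kappa_eq; replace (2 * 0 - PI / 2) with (- (PI / 2)) by ring.
    apply (RInt_even_opp (fun t => / sqrt (quad m t))).
    - intros; apply quad12_continuous; lra.
    - intros; rewrite quad_even; reflexivity. }
  assert (F30 : F3 (al 0) = - kappa3 m).
  { unfold al; rewrite atan_0; replace (2 * 0 - PI / 2) with (- (PI / 2)) by ring.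
    apply (RInt_even_opp (fun t => / (quad m t * sqrt (quad m t)))).
    - intros; apply quad32_continuous; lra.
    - intros; rewrite quad_even; reflexivity. }
  set (h := fun u => (u ^ 3 + r * u) / sqrt (Q u)).
  assert (Dh : forall u, is_derive h u ((u ^ 6 + 3 * r * u ^ 4 + 3 * u ^ 2 + r) / sqrt (Q u) ^ 3)).
  { intros u; specialize (HQ u); specialize (Hs u); specialize (Es u); unfold h, Q in *.
    assert (DQ : is_derive (fun u => u ^ 4 + 2 * r * u ^ 2 + 1) u (4 * u ^ 3 + 4 * r * u))
      by (auto_derive; [trivial|ring]).
    assert (Dn : is_derive (fun u => u ^ 3 + r * u) u (3 * u ^ 2 + r))
      by (auto_derive; [trivial|ring]).
    evar_last.
    - apply (is_derive_div (fun u => u ^ 3 + r * u) (fun u => sqrt (u ^ 4 + 2 * r * u ^ 2 + 1)));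
        [exact Dn| |apply Rgt_not_eq, Hs].
      apply (is_derive_Rcomp sqrt (fun u => u ^ 4 + 2 * r * u ^ 2 + 1)); [|exact DQ].
      apply is_derive_Reals, derivable_pt_lim_sqrt, HQ.
    - set (s := sqrt _) in *.
      apply (Rmult_eq_reg_r (s ^ 3)); [|apply pow_nonzero; lra].
      field_simplify; try lra. rewrite Es; field. }
  assert (DH : forall u, is_derive (fun u => / 2 * (F (al u) + kappa m)) u (/ sqrt (Q u))).
  { intros u; evar_last.
    - exact (is_derive_scal _ _ (/ 2) _ (is_derive_plus (V := R_NormedModule) _ _ _ _ _
        (is_derive_Rcomp _ _ _ _ _ (DF (al u)) (Da u)) (is_derive_const _ _))).
    - rewrite Sq; specialize (Hs u); assert (0 <= u ^ 2) by apply pow2_ge_0.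
      set (s := sqrt (Q u)) in *; hier_R; field; nra. }
  set (Y := fun u => h u + / 2 * ((F (al u) + kappa m) - 2 * m * (F3 (al u) + kappa3 m))).
  assert (DY : forall u, is_derive Y u (u ^ 2 / sqrt (Q u))).
  { intros u; evar_last.
    - exact (is_derive_plus (V := R_NormedModule) _ _ _ _ _ (Dh u) (is_derive_scal _ _ (/ 2) _
       (is_derive_minus (V := R_NormedModule) _ _ _ _ _
        (is_derive_plus (V := R_NormedModule) _ _ _ _ _
        (is_derive_Rcomp _ _ _ _ _ (DF (al u)) (Da u)) (is_derive_const _ _))
        (is_derive_scal _ _ (2 * m) _ (is_derive_plus (V := R_NormedModule) _ _ _ _ _
        (is_derive_Rcomp _ _ _ _ _ (DF3 (al u)) (Da u)) (is_derive_const _ _)))))).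
    - rewrite Sq; unfold al; rewrite quad_landen; fold r; fold (Q u).
      specialize (Hs u); specialize (Es u); assert (0 <= u ^ 2) by apply pow2_ge_0.
      assert (E : Q u = u ^ 4 + 2 * r * u ^ 2 + 1) by reflexivity.
      set (s := sqrt (Q u)) in *; rewrite <- Es in E |- *.
      replace m with ((1 + r) / 2) by (unfold r; field).
      apply (Rmult_eq_reg_r (s ^ 3)); [|apply pow_nonzero; lra].
      transitivity (u ^ 2 * s ^ 2); [|field; lra].
      hier_R; field_simplify; try (split; nra); try nra.
      }
  exists (fun u => / 2 * (F (al u) + kappa m)), Y.
  refine (conj _ (conj _ (conj (conj _ _) (conj (conj _ _) (conj _ _))))).
  - intros; apply DH.
  - intros; apply DY.
  - rewrite F0; ring.
  - apply continuous_R_of_derive; eexists; apply DH.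
  - unfold Y; rewrite F0, F30; unfold h, Rdiv; ring.
  - apply continuous_R_of_derive; eexists; apply DY.
  - apply (is_lim_eq _ (/ 2 * (kappa m + kappa m))); [|field].
    apply (is_lim_scal_l (fun u => F (al u) + kappa m) (/ 2) p_infty (kappa m + kappa m)).
    apply is_lim_plus'; [|apply is_lim_const].
    rewrite kappa_eq; apply (is_lim_comp_cont F); assumption.
  - apply (is_lim_ext (fun u => (h u - u) +
      / 2 * ((F (al u) + kappa m) - 2 * m * (F3 (al u) + kappa3 m)))); [intros; unfold Y; ring|].
    apply (is_lim_eq _ (0 + / 2 * ((kappa m + kappa m) - 2 * m * (kappa3 m + kappa3 m)))).
    2:{ rewrite kappa3_eq by lra; field. }
    apply is_lim_plus'.
    + apply (is_lim_inv_bound _ 4 2); intros u Hu _; specialize (Hs u); specialize (Es u).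
      unfold h, Q in *; set (s := sqrt _) in *.
      assert (Hr : -1 < r < 1) by (unfold r; lra).
      assert (Hs2 : u ^ 2 + r <= s).
      { apply Rsqr_incr_0_var; [|lra]; unfold Rsqr; nra. }
      assert (H4 : 4 < u ^ 2) by nra; assert (Hu2 : u ^ 2 / 2 <= u ^ 2 + r) by lra.
      replace ((u ^ 3 + r * u) / s - u) with (- ((1 - r ^ 2) * (u / (s * (u ^ 2 + r + s))))).
      * rewrite Rabs_Ropp, Rabs_pos_eq.
        -- apply Rle_trans with (1 * (u / (u ^ 2 / 2 * (u ^ 2 / 2)))).
           ++ apply Rmult_le_compat; [nra| |nra|].
              ** apply Rlt_le, Rdiv_lt_0_compat; [lra|apply Rmult_lt_0_compat; nra].
              ** apply Rmult_le_compat_l; [lra|]; apply Rinv_le_contravar; [nra|].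
                 apply Rmult_le_compat; nra.
           ++ replace (1 * (u / (u ^ 2 / 2 * (u ^ 2 / 2)))) with (4 / u * (/ u) ^ 2) by (field; lra).
              assert (0 < / u) by (apply Rinv_0_lt_compat; lra).
              assert (/ u <= 1) by (rewrite <- Rinv_1; apply Rinv_le_contravar; lra).
              unfold Rdiv; nra.
        -- apply Rmult_le_pos; [nra|]; apply Rlt_le, Rdiv_lt_0_compat; [lra|].
           apply Rmult_lt_0_compat; nra.
      * apply (Rmult_eq_reg_r (s * (u ^ 2 + r + s))); [|apply Rgt_not_eq, Rmult_lt_0_compat; lra].
        field_simplify; try lra. rewrite Es; ring.
    + apply (is_lim_scal_l (fun u => F (al u) + kappa m - 2 * m * (F3 (al u) + kappa3 m)) (/ 2) p_infty
        (kappa m + kappa m - 2 * m * (kappa3 m + kappa3 m))).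
      apply is_lim_minus'.
      * apply is_lim_plus'; [|apply is_lim_const].
        rewrite kappa_eq; apply (is_lim_comp_cont F); assumption.
      * apply (is_lim_scal_l (fun u => F3 (al u) + kappa3 m) (2 * m) p_infty (kappa3 m + kappa3 m)).
        apply is_lim_plus'; [|apply is_lim_const].
        apply (is_lim_comp_cont F3); assumption.
Qed.

(** * Complex multiplication on the real line *)

(** The substitution u = p v: it reduces the quartics of actual cubics to the one-parameter families
    above. *)
Lemma periods_scale p beta gamma A Z :
  0 < p -> periods beta gamma A Z -> periods (p ^ 2 * beta) (p ^ 4 * gamma) (A / p) (p * Z).
Proof.
  intros Hp [H [Y [DH [DY [[H0 CH] [[Y0 CY] [LH LY]]]]]]].
  assert (Dd : forall u, is_derive (fun u => u / p) u (/ p)).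
  { intros u; auto_derive; [trivial|field; lra]. }
  assert (Ep : forall u, sqrt (u ^ 4 + p ^ 2 * beta * u ^ 2 + p ^ 4 * gamma) =
    p ^ 2 * sqrt ((u / p) ^ 4 + beta * (u / p) ^ 2 + gamma)).
  { intros u; transitivity (sqrt ((p ^ 2) ^ 2 * ((u / p) ^ 4 + beta * (u / p) ^ 2 + gamma))).
    - f_equal; field; lra.
    - rewrite sqrt_mult_alt by (apply Rlt_le, pow_lt, pow_lt, Hp).
      rewrite sqrt_pow2 by (apply Rlt_le, pow_lt, Hp); reflexivity. }
  assert (Lp : is_lim (fun u => u / p) p_infty p_infty).
  { apply (is_lim_ext (fun u => / p * u)); [intros u; unfold Rdiv; ring|].
    evar_last; [apply (is_lim_scal_l (fun u => u)), is_lim_id|].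
    simpl; destruct (Rle_dec 0 (/ p)) as [h|h].
    - destruct (Rle_lt_or_eq_dec 0 (/ p) h) as [h'|h']; [reflexivity|].
      generalize (Rinv_0_lt_compat _ Hp); lra.
    - generalize (Rinv_0_lt_compat _ Hp); lra. }
  exists (fun u => / p * H (u / p)), (fun u => p * Y (u / p)).
  refine (conj _ (conj _ (conj (conj _ _) (conj (conj _ _) (conj _ _))))).
  - intros u Hu; assert (Hup : 0 < u / p) by (apply Rdiv_lt_0_compat; assumption).
    evar_last; [exact (is_derive_scal _ _ (/ p) _ (is_derive_Rcomp H (fun u => u / p) u _ _ (DH _ Hup) (Dd u)))|].
    rewrite Ep; unfold Rdiv; rewrite Rinv_mult; generalize (/ sqrt ((u * / p) ^ 4 + beta * (u * / p) ^ 2 + gamma)).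
    intros i; hier_R; field; lra.
  - intros u Hu; assert (Hup : 0 < u / p) by (apply Rdiv_lt_0_compat; assumption).
    evar_last; [exact (is_derive_scal _ _ p _ (is_derive_Rcomp Y (fun u => u / p) u _ _ (DY _ Hup) (Dd u)))|].
    rewrite Ep; unfold Rdiv; rewrite Rinv_mult; generalize (/ sqrt ((u * / p) ^ 4 + beta * (u * / p) ^ 2 + gamma)).
    intros i; hier_R; field; lra.
  - replace (0 / p) with 0 by (field; lra); rewrite H0; ring.
  - apply (continuous_scal_r (V := R_NormedModule) (/ p) (fun u => H (u / p))).
    apply (continuous_comp (fun u => u / p) H); [apply continuous_R_of_derive; eexists; apply Dd|].
    replace (0 / p) with 0 by (field; lra); exact CH.
  - replace (0 / p) with 0 by (field; lra); rewrite Y0; ring.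
  - apply (continuous_scal_r (V := R_NormedModule) p (fun u => Y (u / p))).
    apply (continuous_comp (fun u => u / p) Y); [apply continuous_R_of_derive; eexists; apply Dd|].
    replace (0 / p) with 0 by (field; lra); exact CY.
  - apply (is_lim_eq _ (/ p * A)); [|unfold Rdiv; ring].
    apply (is_lim_scal_l (fun u => H (u / p)) (/ p) p_infty A).
    exact (filterlim_comp _ _ _ _ H _ _ _ Lp LH).
  - apply (is_lim_ext (fun u => p * (Y (u / p) - u / p))); [intros; field; lra|].
    apply (is_lim_scal_l (fun u => Y (u / p) - u / p) p p_infty Z).
    exact (filterlim_comp _ _ _ _ (fun v => Y v - v) _ _ _ Lp LY).
Qed.

Lemma derive_0_const_open (f : R -> R) b :
  0 < b -> (forall x, 0 < x -> is_derive f x 0) -> continuous f 0 -> f b = f 0.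
Proof.
  intros Hb Hf H0; destruct (MVT_gen f 0 b (fun _ => 0)) as [c [_ Hc]]; [| |lra].
  - intros x; rewrite Rmin_left, Rmax_right by lra; intros Hx; apply Hf; lra.
  - intros x; rewrite Rmin_left, Rmax_right by lra; intros Hx.
    destruct (Req_dec x 0) as [->|Hn]; [apply continuity_pt_filterlim, H0|].
    apply (is_derive_continuity_pt _ _ 0), Hf; lra.
Qed.

Lemma IVT_decr (f : R -> R) a b y :
  a < b -> (forall x, a <= x <= b -> continuity_pt f x) -> f b < y < f a ->
  exists x, a <= x <= b /\ f x = y.
Proof.
  intros Hab Hc Hy.
  destruct (IVT_interv (fun x => y - f x) a b) as [x [Hx Ex]]; try lra.
  - intros x Hx; apply (continuity_pt_minus (fun _ => y) f); [apply continuity_pt_const|apply Hc, Hx].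
    intros u v; reflexivity.
  - exists x; split; [exact Hx|lra].
Qed.

Section ComplexMultiplication.

Variables D g2 g3 s e e' mu A Z B ZB : R.
Variables R0 R1 R2 T T1 : R -> R.

Let P x := 4 * x ^ 3 - g2 * x - g3.
Let c1 := 3 * e ^ 2 - g2 / 4.
Let c2 := 3 * e' ^ 2 - g2 / 4.
(** The coordinates x = e + u^2 to the right of [e] and x = e' - w^2 to the left of [e'] absorb the
    branch points: up to sign, dx / sqrt |P| becomes du / sqrt(Q1 u) and dw / sqrt(Q2 w). *)
Let Q1 u := u ^ 4 + 3 * e * u ^ 2 + c1.
Let Q2 u := u ^ 4 + - 3 * e' * u ^ 2 + c2.

Hypothesis HD : 0 < D.
Hypothesis Pe : P e = 0.
Hypothesis Pe' : P e' = 0.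
Hypothesis Hc2 : 0 < c2.
Hypothesis HQ1 : forall u, 0 < u -> 0 < Q1 u.
Hypothesis HQ2 : forall u, 0 < u -> 0 < Q2 u.
Hypothesis Hmu : 0 < P mu.
Hypothesis Hmu' : forall y, y <= mu -> P y <= 0 -> y <= e'.
Hypothesis HA : periods (3 * e) c1 A Z.
Hypothesis HB : periods (- 3 * e') c2 B ZB.

(* [R0] is multiplication by [sqrt (- D)] on the [x]-line, with derivatives [R1] and [R2],
   and [T] the function whose product with [sqrt P] trivializes the second-kind differential. *)
Hypothesis DR0 : forall x, e <= x -> is_derive R0 x (R1 x).
Hypothesis DR1 : forall x, e <= x -> is_derive R1 x (R2 x).
Hypothesis DT : forall x, e <= x -> is_derive T x (T1 x).
Hypothesis R0e : R0 e = e'.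
Hypothesis Eq1 : forall x, e <= x -> D * P (R0 x) = - (P x * R1 x ^ 2).
Hypothesis Eq2 : forall x, e <= x ->
  P x * R2 x + (12 * x ^ 2 - g2) * R1 x / 2 = - D * (6 * R0 x ^ 2 - g2 / 2).
Hypothesis EqT : forall x, e <= x ->
  R0 x + x - s = P x * T1 x + (12 * x ^ 2 - g2) * T x / 2.
Variable C M : R.
Hypothesis R0_oo : forall x, M < x -> Rabs (R0 x + x / D) <= C.
Hypothesis T_oo : forall x, M < x -> Rabs (T x - (1 - / D) / (2 * x)) <= C / x ^ 2.

Lemma P_top u : P (e + u ^ 2) = 4 * u ^ 2 * Q1 u.
Proof.
  unfold P in *; unfold Q1, c1.
  replace (4 * (e + u ^ 2) ^ 3 - g2 * (e + u ^ 2) - g3) with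
    (4 * u ^ 2 * (u ^ 4 + 3 * e * u ^ 2 + (3 * e ^ 2 - g2 / 4)) + (4 * e ^ 3 - g2 * e - g3)) by field.
  rewrite Pe; ring.
Qed.

Lemma P_bottom w : P (e' - w ^ 2) = - (4 * w ^ 2 * Q2 w).
Proof.
  unfold P in *; unfold Q2, c2.
  replace (4 * (e' - w ^ 2) ^ 3 - g2 * (e' - w ^ 2) - g3) with
    (- (4 * w ^ 2 * (w ^ 4 + - 3 * e' * w ^ 2 + (3 * e' ^ 2 - g2 / 4))) + (4 * e' ^ 3 - g2 * e' - g3)) by field.
  rewrite Pe'; ring.
Qed.

Lemma P_pos x : e < x -> 0 < P x.
Proof.
  intros Hx; replace x with (e + sqrt (x - e) ^ 2) by (rewrite pow2_sqrt; lra).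
  assert (Hs : 0 < sqrt (x - e)) by (apply sqrt_lt_R0; lra).
  rewrite P_top; apply Rmult_lt_0_compat; [|apply HQ1, Hs].
  assert (0 < sqrt (x - e) ^ 2) by (apply pow_lt, Hs); lra.
Qed.

Lemma P_neg y : y < e' -> P y < 0.
Proof.
  intros Hx; replace y with (e' - sqrt (e' - y) ^ 2) by (rewrite pow2_sqrt; lra).
  assert (Hs : 0 < sqrt (e' - y)) by (apply sqrt_lt_R0; lra).
  rewrite P_bottom; assert (0 < 4 * sqrt (e' - y) ^ 2 * Q2 (sqrt (e' - y))); [|lra].
  apply Rmult_lt_0_compat; [|apply HQ2, Hs].
  assert (0 < sqrt (e' - y) ^ 2) by (apply pow_lt, Hs); lra.
Qed.

Lemma R0_cont x : e <= x -> continuity_pt R0 x.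
Proof. intros Hx; exact (is_derive_continuity_pt _ _ _ (DR0 x Hx)). Qed.

Lemma R0_unbounded x y : exists z, x < z /\ e < z /\ R0 z < y.
Proof.
  set (z := Rmax (Rmax x e) (Rmax M (D * (C - y))) + 1).
  assert (H1 := Rmax_l (Rmax x e) (Rmax M (D * (C - y)))).
  assert (H2 := Rmax_r (Rmax x e) (Rmax M (D * (C - y)))).
  assert (H3 := Rmax_l x e); assert (H4 := Rmax_r x e).
  assert (H5 := Rmax_l M (D * (C - y))); assert (H6 := Rmax_r M (D * (C - y))).
  exists z; repeat split; try (unfold z; lra).
  assert (Hz := R0_oo z ltac:(unfold z; lra)); apply Rabs_le_between in Hz.
  assert (C - y < z / D) by (apply Rlt_div_r; [exact HD|unfold z; lra]); lra.
Qed.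

Lemma P_R0_nonpos x : e <= x -> P (R0 x) <= 0.
Proof.
  intros Hx; assert (H := Eq1 x Hx).
  assert (0 <= P x) by (destruct (Req_dec x e) as [->|]; [lra|apply Rlt_le, P_pos; lra]).
  assert (0 <= P x * R1 x ^ 2) by (apply Rmult_le_pos; [lra|apply pow2_ge_0]).
  apply (Rmult_le_reg_l D); lra.
Qed.

(** By [Eq1] the image avoids the points where [P] is positive, such as [mu]. Since [R0] is
    unbounded below, a value above [mu] would force it to cross [mu]. *)
Lemma R0_le x : e <= x -> R0 x <= e'.
Proof.
  intros Hx; destruct (Rle_lt_dec (R0 x) mu) as [H|H].
  - apply Hmu'; [exact H|apply P_R0_nonpos, Hx].
  - destruct (R0_unbounded x mu) as [z [H1 [H2 H3]]].
    destruct (IVT_decr R0 x z mu) as [w [Hw Ew]]; [lra| |lra|].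
    + intros; apply R0_cont; lra.
    + assert (P (R0 w) <= 0) by (apply P_R0_nonpos; lra); rewrite Ew in H0; lra.
Qed.

(** If [e'] were reached at some x > e, then [Eq1] and [Eq2] would give R1 = 0 and R2 < 0 there, so
    [R0] would be smaller just before. Its minimum on [e, x] would then be interior, with value
    below [e'] and R1 = 0, against [Eq1]. *)
Lemma R0_lt x : e < x -> R0 x < e'.
Proof.
  intros Hx; destruct (Rle_lt_or_eq_dec _ _ (R0_le x ltac:(lra))) as [H|H]; [exact H|exfalso].
  assert (HP := P_pos x Hx).
  assert (Z1 : R1 x = 0).
  { assert (E := Eq1 x ltac:(lra)); rewrite H, Pe' in E.
    destruct (Req_dec (R1 x) 0) as [|N]; [assumption|].
    assert (0 < P x * R1 x ^ 2) by (apply Rmult_lt_0_compat; [lra|apply pow2_gt_0, N]); lra. }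
  assert (N2 : R2 x < 0).
  { assert (E := Eq2 x ltac:(lra)); rewrite H, Z1 in E.
    assert (0 < D * (2 * c2)) by (apply Rmult_lt_0_compat; lra).
    apply (Rmult_lt_reg_l (P x)); [lra|]. unfold c2 in *; lra. }
  assert (HL : locally x (fun y => y < x -> 0 < R1 y)).
  { assert (Dx := DR1 x ltac:(lra)); apply is_derive_Reals in Dx.
    destruct (Dx (- R2 x) ltac:(lra)) as [del Hdel].
    exists del; intros y0; set (y := y0 : R); intros Hy Hyx.
    assert (Hy' : Rabs (y - x) < del) by exact Hy.
    specialize (Hdel (y - x) ltac:(lra) Hy').
    change (x + (y - x)) with (Rplus x (Rminus y x)) in Hdel; rewrite Rplus_minus in Hdel; rewrite Z1, Rminus_0_r in Hdel.
    apply Rabs_def2 in Hdel; destruct Hdel as [Hdel _].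
    assert (Hq : R1 y / (y - x) < 0) by lra.
    replace (R1 y) with (- (R1 y / (y - x)) * (x - y)) by (field; lra).
    apply Rmult_lt_0_compat; lra. }
  destruct HL as [del Hdel].
  set (y := Rmax (x - del / 2) ((e + x) / 2)).
  assert (Hd := cond_pos del).
  assert (Hy : e < y < x /\ x - del / 2 <= y).
  { unfold y; generalize (Rmax_l (x - del / 2) ((e + x) / 2)) (Rmax_r (x - del / 2) ((e + x) / 2)).
    intros; split; [|assumption]; split; [lra|apply Rmax_lub_lt; lra]. }
  assert (Ly : R0 y < e').
  { destruct (Rle_lt_or_eq_dec _ _ (R0_le y ltac:(lra))) as [h|h]; [exact h|exfalso].
    destruct (MVT_cor2 R0 R1 y x) as [v [Ev Hv]]; [lra| |].
    - intros w Hw; apply is_derive_Reals, DR0; lra.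
    - assert (0 < R1 v).
      { apply Hdel; [|lra]; apply Rabs_def1; change (minus v x) with (v - x); lra. }
      assert (0 < R1 v * (x - y)) by (apply Rmult_lt_0_compat; lra); lra. }
  destruct (continuity_ab_min R0 e x) as [z [Hz1 Hz2]]; [lra|intros; apply R0_cont; lra|].
  assert (Lz : R0 z < e') by (eapply Rle_lt_trans; [apply (Hz1 y); lra|exact Ly]).
  assert (Hz : e < z < x).
  { split; [destruct (Req_dec z e) as [E|]|destruct (Req_dec z x) as [E|]]; try lra;
      rewrite E in Lz; lra. }
  assert (D1z := DR0 z ltac:(lra)); apply is_derive_Reals in D1z.
  assert (Zz : R1 z = 0).
  { assert (pr : derivable_pt R0 z) by (exists (R1 z); exact D1z).
    rewrite <- (deriv_minimum R0 e x z pr); try lra.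
    - symmetry; apply derive_pt_eq_0, D1z.
    - intros; apply Hz1; lra. }
  assert (E := Eq1 z ltac:(lra)); rewrite Zz in E.
  assert (N := P_neg _ Lz).
  assert (D * P (R0 z) < 0) by (rewrite <- (Rmult_0_r D); apply Rmult_lt_compat_l; lra).
  lra.
Qed.

(** [Eq1] forbids zeros of [R1] beyond [e], hence its sign is constant; it is negative because [R0]
    is unbounded below. *)
Lemma R1_neg x : e < x -> R1 x < 0.
Proof.
  intros Hx.
  assert (N : forall y, e < y -> R1 y <> 0).
  { intros y Hy E; assert (H := Eq1 y ltac:(lra)); rewrite E in H.
    assert (Hn := P_neg _ (R0_lt y Hy)).
    assert (D * P (R0 y) < 0) by (rewrite <- (Rmult_0_r D); apply Rmult_lt_compat_l; lra); lra. }
  destruct (Rtotal_order (R1 x) 0) as [H|[H|H]]; [exact H|destruct (N x Hx H)|exfalso].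
  destruct (R0_unbounded x (R0 x)) as [z [H1 [H2 H3]]].
  destruct (MVT_cor2 R0 R1 x z) as [y [Ey Hy]]; [lra| |].
  { intros w Hw; apply is_derive_Reals, DR0; lra. }
  assert (Ny : R1 y < 0).
  { destruct (Rlt_dec (R1 y) 0) as [|h]; [assumption|].
    assert (0 <= R1 y * (z - x)) by (apply Rmult_le_pos; lra); lra. }
  destruct (IVT_decr R1 x y 0) as [w [Hw Ew]]; [lra| |lra|].
  - intros w Hw; apply (is_derive_continuity_pt _ _ _ (DR1 w ltac:(lra))).
  - apply (N w); [lra|exact Ew].
Qed.

(** The map [R0] read in the coordinates [u] and [w]. *)
Let r u := sqrt (e' - R0 (e + u ^ 2)).

Lemma r_pos u : 0 < u -> 0 < r u.
Proof.
  intros Hu; apply sqrt_lt_R0.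
  assert (0 < u ^ 2) by (apply pow_lt, Hu).
  assert (R0 (e + u ^ 2) < e') by (apply R0_lt; lra); lra.
Qed.

Lemma r_sqr u : r u ^ 2 = e' - R0 (e + u ^ 2).
Proof.
  apply pow2_sqrt; assert (0 <= u ^ 2) by apply pow2_ge_0.
  assert (R0 (e + u ^ 2) <= e') by (apply R0_le; lra); lra.
Qed.

Lemma r_0 : r 0 = 0.
Proof.
  unfold r; replace (e + 0 ^ 2) with e by ring; rewrite R0e.
  replace (e' - e') with 0 by ring; apply sqrt_0.
Qed.

Lemma r_derive u : 0 < u -> is_derive r u (sqrt D * sqrt (Q2 (r u)) / sqrt (Q1 u)).
Proof.
  intros Hu; assert (Hu2 : 0 < u ^ 2) by (apply pow_lt, Hu).
  assert (Hr := r_pos u Hu); assert (Er := r_sqr u).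
  assert (S1 := sqrt_lt_R0 _ (HQ1 u Hu)); assert (S2 := sqrt_lt_R0 _ (HQ2 _ Hr)).
  assert (SD := sqrt_lt_R0 _ HD).
  assert (E1 : sqrt (Q1 u) ^ 2 = Q1 u) by (apply pow2_sqrt, Rlt_le, HQ1, Hu).
  assert (E2 : sqrt (Q2 (r u)) ^ 2 = Q2 (r u)) by (apply pow2_sqrt, Rlt_le, HQ2, Hr).
  assert (ED : sqrt D ^ 2 = D) by (apply pow2_sqrt; lra).
  assert (ER : R1 (e + u ^ 2) = - (sqrt D * r u * sqrt (Q2 (r u)) / (u * sqrt (Q1 u)))).
  { assert (E := Eq1 (e + u ^ 2) ltac:(lra)); assert (N := R1_neg (e + u ^ 2) ltac:(lra)).
    rewrite P_top in E; replace (R0 (e + u ^ 2)) with (e' - r u ^ 2) in E by lra.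
    rewrite P_bottom in E.
    (* [Eq1] only determines the square of [R1]; [R1_neg] selects the root. *)
    assert (X : (- R1 (e + u ^ 2)) = sqrt D * r u * sqrt (Q2 (r u)) / (u * sqrt (Q1 u))); [|lra].
    apply Rsqr_inj; [lra| |].
    - apply Rlt_le, Rdiv_lt_0_compat; repeat apply Rmult_lt_0_compat; assumption.
    - rewrite !Rsqr_pow2.
      set (a := sqrt (Q1 u)) in *; set (b := sqrt (Q2 (r u))) in *; set (d := sqrt D) in *.
      rewrite <- E1, <- E2, <- ED in E.
      apply (Rmult_eq_reg_r (u ^ 2 * a ^ 2)); [|apply Rgt_not_eq, Rmult_lt_0_compat; [lra|apply pow_lt, S1]].
      field_simplify; lra. }
  unfold r; evar_last.
  - apply (is_derive_Rcomp sqrt (fun u => e' - R0 (e + u ^ 2))).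
    + apply is_derive_Reals, derivable_pt_lim_sqrt; fold (r u) in *; nra.
    + assert (Du : is_derive (fun u => e + u ^ 2) u (2 * u)) by (auto_derive; [trivial|ring]).
      exact (is_derive_minus (V := R_NormedModule) _ _ _ _ _ (is_derive_const e' u)
        (is_derive_Rcomp R0 (fun u => e + u ^ 2) u _ _ (DR0 (e + u ^ 2) ltac:(lra)) Du)).
  - fold (r u); rewrite ER.
    set (a := sqrt (Q1 u)) in *; set (b := sqrt (Q2 (r u))) in *; set (d := sqrt D) in *.
    hier_R; field; lra.
Qed.

Lemma r_continuous_0 : continuous r 0.
Proof.
  apply continuity_pt_filterlim.
  apply (continuity_pt_comp (fun u => e' - R0 (e + u ^ 2)) sqrt).
  - apply continuity_pt_minus; [apply continuity_pt_const; intros x y; reflexivity|].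
    apply (continuity_pt_comp (fun u => e + u ^ 2) R0).
    + apply continuity_pt_filterlim, (continuous_R_of_derive (fun u => e + u ^ 2)); auto_derive; trivial.
    + replace (e + 0 ^ 2) with e by ring; apply R0_cont; lra.
  - apply continuity_pt_sqrt; replace (e + 0 ^ 2) with e by ring; rewrite R0e; lra.
Qed.

Lemma sqrt_Q1_bound u : 1 < u -> Rabs (sqrt (Q1 u) - u ^ 2) <= 3 * Rabs e + Rabs c1.
Proof.
  intros Hu; assert (Hu2 : 1 < u ^ 2) by nra.
  assert (S1 := sqrt_lt_R0 _ (HQ1 u ltac:(lra))).
  assert (E1 : sqrt (Q1 u) ^ 2 = Q1 u) by (apply pow2_sqrt, Rlt_le, HQ1; lra).
  set (a := sqrt (Q1 u)) in *.
  replace (a - u ^ 2) with ((3 * e * u ^ 2 + c1) / (a + u ^ 2)).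
  2:{ apply (Rmult_eq_reg_r (a + u ^ 2)); [|lra]; field_simplify; try lra.
      rewrite E1; unfold Q1; ring. }
  unfold Rdiv; rewrite Rabs_mult, (Rabs_pos_eq (/ _)) by (apply Rlt_le, Rinv_0_lt_compat; lra).
  apply Rle_div_l; [lra|].
  eapply Rle_trans; [apply Rabs_triang|].
  rewrite !Rabs_mult, (Rabs_pos_eq 3), (Rabs_pos_eq (u ^ 2)) by lra.
  generalize (Rabs_pos e) (Rabs_pos c1); intros; nra.
Qed.

(** [R0_oo] gives r^2 = u^2 / D + O(1), and dividing the difference of squares by the sum leaves
    O(1/u). A bounded error on [r] itself would spoil the regularization. *)
Lemma is_lim_r : is_lim (fun u => r u - u / sqrt D) p_infty 0.
Proof.
  assert (SD := sqrt_lt_R0 _ HD).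
  assert (ED : sqrt D ^ 2 = D) by (apply pow2_sqrt; lra).
  set (Cr := Rabs e' + Rabs e / D + C).
  apply (is_lim_inv_bound _ (Cr * sqrt D) (Rmax 1 (M - e))); intros u Hu Hu0.
  assert (H1 := Rmax_l 1 (M - e)); assert (H2 := Rmax_r 1 (M - e)).
  assert (Hu2 : u < u ^ 2) by nra.
  assert (Hr := r_pos u Hu0); assert (Er := r_sqr u).
  assert (HR := R0_oo (e + u ^ 2) ltac:(lra)).
  set (d := sqrt D) in *.
  assert (Hq : 0 < u / d) by (apply Rdiv_lt_0_compat; assumption).
  replace (r u - u / d) with ((r u ^ 2 - u ^ 2 / D) / (r u + u / d)).
  2:{ assert (0 < r u * d) by (apply Rmult_lt_0_compat; lra).
      rewrite <- ED; field; split; lra. }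
  unfold Rdiv at 1; rewrite Rabs_mult, (Rabs_pos_eq (/ _)) by (apply Rlt_le, Rinv_0_lt_compat; lra).
  assert (HC : Rabs (r u ^ 2 - u ^ 2 / D) <= Cr).
  { rewrite Er; replace (e' - R0 (e + u ^ 2) - u ^ 2 / D) with
      (e' + (e / D + - (R0 (e + u ^ 2) + (e + u ^ 2) / D))) by (field; lra).
    eapply Rle_trans; [apply Rabs_triang|]; unfold Cr; rewrite Rplus_assoc.
    apply Rplus_le_compat_l; eapply Rle_trans; [apply Rabs_triang|].
    unfold Rdiv at 1; rewrite Rabs_mult, (Rabs_pos_eq (/ D)) by (apply Rlt_le, Rinv_0_lt_compat; lra).
    rewrite Rabs_Ropp; unfold Rdiv in *; lra. }
  assert (HC0 := Rle_trans _ _ _ (Rabs_pos _) HC).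
  apply Rle_trans with (Cr * / (u / d)).
  - apply Rmult_le_compat; [apply Rabs_pos| |exact HC|].
    + apply Rlt_le, Rinv_0_lt_compat; lra.
    + apply Rinv_le_contravar; lra.
  - right; field; lra.
Qed.

(** sqrt P grows like 2 u^3 and [T] is (1 - 1/D) / (2 u^2) with error O(1/u^4), so the product is (1
    - 1/D) u + O(1/u). *)
Lemma is_lim_exact_part :
  is_lim (fun u => sqrt (P (e + u ^ 2)) * T (e + u ^ 2) - u + u / D) p_infty 0.
Proof.
  set (C1 := 3 * Rabs e + Rabs c1).
  set (M' := Rmax (Rmax 2 (M - e)) (2 * Rabs e)).
  assert (HC1 : 0 <= C1) by (unfold C1; generalize (Rabs_pos e) (Rabs_pos c1); lra).
  set (k := (1 - / D)).
  apply (is_lim_inv_bound _ (2 * (Rabs k * (C1 + Rabs e) + 4 * ((1 + C1) * C))) M'); intros u Hu Hu0.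
  assert (H1 := Rmax_l (Rmax 2 (M - e)) (2 * Rabs e)); assert (H2 := Rmax_r (Rmax 2 (M - e)) (2 * Rabs e)).
  assert (H3 := Rmax_l 2 (M - e)); assert (H4 := Rmax_r 2 (M - e)); fold M' in H1, H2.
  assert (Hu1 : 2 < u) by lra; assert (Hu2 : 2 * u < u ^ 2) by nra.
  set (x := e + u ^ 2).
  assert (Hx : u ^ 2 / 2 <= x <= 2 * u ^ 2).
  { assert (Ha := Rle_abs e); assert (Hb := Rle_abs (- e)); rewrite Rabs_Ropp in Hb.
    unfold x; lra. }
  assert (HT := T_oo x ltac:(unfold x; lra)).
  assert (S1 := sqrt_lt_R0 _ (HQ1 u Hu0)); assert (B1 := sqrt_Q1_bound u ltac:(lra)).
  assert (EP : sqrt (P x) = 2 * u * sqrt (Q1 u)).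
  { unfold x; rewrite P_top, sqrt_mult_alt by lra.
    replace (4 * u ^ 2) with ((2 * u) ^ 2) by ring; rewrite sqrt_pow2 by lra; reflexivity. }
  rewrite EP; set (a := sqrt (Q1 u)) in *; fold C1 in B1; fold k in HT.
  set (w := T x - k / (2 * x)) in *.
  assert (Hx0 : 0 < x) by lra.
  replace (2 * u * a * T x - u + u / D) with
    (k * (u * (a - u ^ 2 - e) / x) + 2 * u * a * w).
  2:{ unfold w, k; replace (u ^ 2) with (x - e) by (unfold x; ring); field; split; [|lra].
      intros E; rewrite E in HD; lra. }
  assert (Ha : a <= u ^ 2 * (1 + C1)).
  { assert (a - u ^ 2 <= C1) by (eapply Rle_trans; [apply Rle_abs|exact B1]). nra. }
  assert (Hix : / x <= 2 / u ^ 2).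
  { replace (2 / u ^ 2) with (/ (u ^ 2 / 2)) by (field; lra); apply Rinv_le_contravar; lra. }
  assert (Hi0 : 0 < / x) by (apply Rinv_0_lt_compat, Hx0).
  assert (HC0 : 0 <= C / x ^ 2) by (eapply Rle_trans; [apply Rabs_pos|exact HT]).
  assert (HC : 0 <= C).
  { replace C with (C / x ^ 2 * x ^ 2) by (field; lra); apply Rmult_le_pos; [exact HC0|apply pow2_ge_0]. }
  assert (Hx2 : C / x ^ 2 <= C * (2 / u ^ 2) ^ 2).
  { unfold Rdiv at 1; apply Rmult_le_compat_l; [exact HC|].
    rewrite <- pow_inv; apply pow_incr; lra. }
  eapply Rle_trans; [apply Rabs_triang|].
  assert (T1' : Rabs (k * (u * (a - u ^ 2 - e) / x)) <= 2 * (Rabs k * (C1 + Rabs e)) / u).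
  { rewrite Rabs_mult; unfold Rdiv at 1; rewrite !Rabs_mult, (Rabs_pos_eq u), (Rabs_pos_eq (/ x)) by lra.
    assert (Hae : Rabs (a - u ^ 2 - e) <= C1 + Rabs e).
    { eapply Rle_trans; [apply (Rabs_triang (a - u ^ 2) (- e))|]; rewrite Rabs_Ropp; lra. }
    replace (2 * (Rabs k * (C1 + Rabs e)) / u) with (Rabs k * (u * (C1 + Rabs e) * (2 / u ^ 2))) by (field; lra).
    apply Rmult_le_compat_l; [apply Rabs_pos|].
    apply Rmult_le_compat; [|lra| |exact Hix].
    - apply Rmult_le_pos; [lra|apply Rabs_pos].
    - apply Rmult_le_compat_l; lra. }
  assert (T2' : Rabs (2 * u * a * w) <= 8 * ((1 + C1) * C) / u).
  { rewrite !Rabs_mult, (Rabs_pos_eq 2), (Rabs_pos_eq u), (Rabs_pos_eq a) by lra.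
    replace (8 * ((1 + C1) * C) / u) with (2 * u * (u ^ 2 * (1 + C1)) * (C * (2 / u ^ 2) ^ 2)) by (field; lra).
    apply Rmult_le_compat; [nra|apply Rabs_pos| |lra].
    apply Rmult_le_compat_l; [lra|exact Ha]. }
  replace (2 * (Rabs k * (C1 + Rabs e) + 4 * ((1 + C1) * C)) / u) with
    (2 * (Rabs k * (C1 + Rabs e)) / u + 8 * ((1 + C1) * C) / u) by (field; lra).
  lra.
Qed.

Lemma is_lim_r_infty : is_lim r p_infty p_infty.
Proof.
  assert (SD := sqrt_lt_R0 _ HD).
  apply (is_lim_ext (fun u => (r u - u / sqrt D) + / sqrt D * u)); [intros; field; lra|].
  eapply is_lim_plus; [exact is_lim_r|apply is_lim_scal_l, is_lim_id|].
  simpl; assert (Hi := Rinv_0_lt_compat _ SD).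
  destruct (Rle_dec 0 (/ sqrt D)) as [h|h]; [|lra].
  destruct (Rle_lt_or_eq_dec 0 (/ sqrt D) h) as [h'|h']; [reflexivity|lra].
Qed.

(** [EqT] says that sqrt P times [T] is a primitive of (R0 + x - s) dx / sqrt P, and dx / sqrt P =
    du / sqrt(Q1 u). *)
Lemma sqrt_P_derive u : 0 < u ->
  is_derive (fun u => sqrt (P (e + u ^ 2)) * T (e + u ^ 2)) u
    ((R0 (e + u ^ 2) + (e + u ^ 2) - s) / sqrt (Q1 u)).
Proof.
  intros Hu; assert (Hu2 : 0 < u ^ 2) by (apply pow_lt, Hu).
  set (x := e + u ^ 2); assert (HP : 0 < P x) by (apply P_pos; unfold x; lra).
  assert (S1 := sqrt_lt_R0 _ (HQ1 u Hu)).
  assert (EP : sqrt (P x) = 2 * u * sqrt (Q1 u)).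
  { unfold x; rewrite P_top, sqrt_mult_alt by lra.
    replace (4 * u ^ 2) with ((2 * u) ^ 2) by ring; rewrite sqrt_pow2 by lra; reflexivity. }
  assert (EPP : sqrt (P x) ^ 2 = P x) by (apply pow2_sqrt; lra).
  assert (Du : is_derive (fun u => e + u ^ 2) u (2 * u)) by (auto_derive; [trivial|ring]).
  assert (DP : is_derive P x (12 * x ^ 2 - g2)) by (unfold P; auto_derive; [trivial|ring]).
  assert (DS : is_derive (fun x => sqrt (P x)) x ((12 * x ^ 2 - g2) * / (2 * sqrt (P x)))).
  { apply (is_derive_Rcomp sqrt P); [|exact DP]; apply is_derive_Reals, derivable_pt_lim_sqrt, HP. }
  assert (Hx : e <= x) by (unfold x; lra).
  assert (DST := is_derive_Rmult _ _ _ _ _ DS (DT x Hx)).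
  evar_last; [exact (is_derive_Rcomp (fun x => sqrt (P x) * T x) (fun u => e + u ^ 2) u _ _ DST Du)|].
  rewrite (EqT x Hx); set (w := sqrt (P x)) in *; rewrite <- EPP, EP.
  set (a := sqrt (Q1 u)) in *; hier_R; field; lra.
Qed.

Lemma sqrt_P_continuous_0 : continuous (fun u => sqrt (P (e + u ^ 2)) * T (e + u ^ 2)) 0.
Proof.
  assert (E0 : e + 0 ^ 2 = e) by ring.
  assert (Cu : continuity_pt (fun u => e + u ^ 2) 0).
  { apply continuity_pt_filterlim, (continuous_R_of_derive (fun u => e + u ^ 2)); auto_derive; trivial. }
  apply continuity_pt_filterlim.
  apply (continuity_pt_mult (fun u => sqrt (P (e + u ^ 2))) (fun u => T (e + u ^ 2))).
  - apply (continuity_pt_comp (fun u => P (e + u ^ 2)) sqrt).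
    + apply continuity_pt_filterlim, (continuous_R_of_derive (fun u => P (e + u ^ 2))).
      unfold P; auto_derive; trivial.
    + apply continuity_pt_sqrt; rewrite E0, Pe; lra.
  - apply (continuity_pt_comp (fun u => e + u ^ 2) T); [exact Cu|].
    rewrite E0; exact (is_derive_continuity_pt _ _ _ (DT e (Rle_refl e))).
Qed.

Lemma cm_periods : B = sqrt D * A /\ Z = ZB / sqrt D + (s - e - e') * A.
Proof.
  destruct HA as [H1 [Y1 [DH1 [DY1 [[H10 CH1] [[Y10 CY1] [LH1 LY1]]]]]]].
  destruct HB as [H2 [Y2 [DH2 [DY2 [[H20 CH2] [[Y20 CY2] [LH2 LY2]]]]]]].
  assert (SD := sqrt_lt_R0 _ HD).
  assert (ED : sqrt D ^ 2 = D) by (apply pow2_sqrt; lra).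
  assert (Cr : forall G : R -> R, continuous G 0 -> continuous (fun u => G (r u)) 0).
  { intros G HG; apply (continuous_comp r G); [exact r_continuous_0|rewrite r_0; exact HG]. }
  assert (First : forall u, 0 < u -> H2 (r u) = sqrt D * H1 u).
  { intros u Hu.
    assert (E : H2 (r u) - sqrt D * H1 u = H2 (r 0) - sqrt D * H1 0).
    - apply (derive_0_const_open (fun u => H2 (r u) - sqrt D * H1 u) u Hu).
      + intros v Hv; evar_last.
        * exact (is_derive_minus (V := R_NormedModule) _ _ _ _ _
            (is_derive_Rcomp H2 r v _ _ (DH2 _ (r_pos v Hv)) (r_derive v Hv))
            (is_derive_scal _ _ (sqrt D) _ (DH1 v Hv))).
        * assert (S1 := sqrt_lt_R0 _ (HQ1 v Hv)); assert (S2 := sqrt_lt_R0 _ (HQ2 _ (r_pos v Hv))).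
          fold (Q1 v); fold (Q2 (r v)).
          set (a := sqrt (Q1 v)) in *; set (b := sqrt (Q2 (r v))) in *; hier_R; field; lra.
      + apply (continuous_minus (V := R_NormedModule) (fun u => H2 (r u)) (fun u => sqrt D * H1 u)).
        * apply Cr, CH2.
        * apply (continuous_scal_r (V := R_NormedModule) (sqrt D) H1), CH1.
    - rewrite r_0, H10, H20 in E; lra. }
  assert (Lr : is_lim (fun u => H2 (r u)) p_infty B).
  { exact (filterlim_comp _ _ _ r H2 _ _ _ is_lim_r_infty LH2). }
  assert (EB : B = sqrt D * A).
  { assert (L : is_lim (fun u => H2 (r u)) p_infty (sqrt D * A)).
    - apply (is_lim_ext_loc (fun u => sqrt D * H1 u)).
      + exists 0; intros u Hu; symmetry; apply First, Hu.
      + apply (is_lim_scal_l H1 (sqrt D) p_infty A), LH1.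
    - apply is_lim_unique in Lr; apply is_lim_unique in L; rewrite Lr in L; injection L; trivial. }
  split; [exact EB|].
  (* The left side differentiates to (u^2 - r^2 + e + e' - s) / sqrt(Q1 u), whose numerator is R0 +
     x - s; both sides vanish at 0. *)
  assert (Second : forall u, 0 < u -> Y1 u - / sqrt D * Y2 (r u) + (e + e' - s) * H1 u
     = sqrt (P (e + u ^ 2)) * T (e + u ^ 2)).
  { intros u Hu.
    set (f := fun u => Y1 u - / sqrt D * Y2 (r u) + (e + e' - s) * H1 u
      - sqrt (P (e + u ^ 2)) * T (e + u ^ 2)).
    assert (E : f u = f 0).
    - apply (derive_0_const_open f u Hu).
      + intros v Hv; evar_last.
        * exact (is_derive_minus (V := R_NormedModule) _ _ _ _ _
            (is_derive_plus (V := R_NormedModule) _ _ _ _ _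
             (is_derive_minus (V := R_NormedModule) _ _ _ _ _ (DY1 v Hv)
            (is_derive_scal _ _ (/ sqrt D) _ (is_derive_Rcomp Y2 r v _ _ (DY2 _ (r_pos v Hv)) (r_derive v Hv))))
            (is_derive_scal _ _ (e + e' - s) _ (DH1 v Hv))) (sqrt_P_derive v Hv)).
        * assert (S1 := sqrt_lt_R0 _ (HQ1 v Hv)); assert (S2 := sqrt_lt_R0 _ (HQ2 _ (r_pos v Hv))).
          fold (Q1 v); fold (Q2 (r v)); assert (Er := r_sqr v).
          replace (R0 (e + v ^ 2)) with (e' - r v ^ 2) by lra.
          set (a := sqrt (Q1 v)) in *; set (b := sqrt (Q2 (r v))) in *; hier_R; field; lra.
      + apply (continuous_minus (V := R_NormedModule)
          (fun u => Y1 u - / sqrt D * Y2 (r u) + (e + e' - s) * H1 u)); [|exact sqrt_P_continuous_0].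
        apply (continuous_plus (V := R_NormedModule) (fun u => Y1 u - / sqrt D * Y2 (r u))).
        * apply (continuous_minus (V := R_NormedModule) Y1); [exact CY1|].
          apply (continuous_scal_r (V := R_NormedModule) (/ sqrt D) (fun u => Y2 (r u))), Cr, CY2.
        * apply (continuous_scal_r (V := R_NormedModule) (e + e' - s) H1), CH1.
    - unfold f in E; rewrite r_0, H10, Y10, Y20 in E.
      replace (e + 0 ^ 2) with e in E by ring; rewrite Pe, sqrt_0 in E; lra. }
  (* The same function is evaluated at infinity twice: from the regularized integrals, and from the
     exact part, where - u + r / sqrt D cancels the growth (1 - 1/D) u. *)
  assert (Lim1 : is_lim (fun u => (Y1 u - u) - / sqrt D * (Y2 (r u) - r u) + (e + e' - s) * H1 u)
     p_infty (Z - / sqrt D * ZB + (e + e' - s) * A)).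
  { apply is_lim_plus'; [apply is_lim_minus'; [exact LY1|]|].
    - apply (is_lim_scal_l (fun u => Y2 (r u) - r u) (/ sqrt D) p_infty ZB).
      exact (filterlim_comp _ _ _ r (fun v => Y2 v - v) _ _ _ is_lim_r_infty LY2).
    - apply (is_lim_scal_l H1 (e + e' - s) p_infty A), LH1. }
  assert (Lim2 : is_lim (fun u => (Y1 u - u) - / sqrt D * (Y2 (r u) - r u) + (e + e' - s) * H1 u)
     p_infty (0 + / sqrt D * 0)).
  { apply (is_lim_ext_loc (fun u => (sqrt (P (e + u ^ 2)) * T (e + u ^ 2) - u + u / D)
      + / sqrt D * (r u - u / sqrt D))).
    - exists 0; intros u Hu; rewrite <- (Second u Hu).
      replace (u / D) with (u / sqrt D ^ 2) by (rewrite ED; reflexivity); field; lra.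
    - apply is_lim_plus'; [exact is_lim_exact_part|].
      apply (is_lim_scal_l (fun u => r u - u / sqrt D) (/ sqrt D) p_infty 0), is_lim_r. }
  apply is_lim_unique in Lim1; apply is_lim_unique in Lim2; rewrite Lim1 in Lim2.
  injection Lim2; unfold Rdiv; lra.
Qed.

End ComplexMultiplication.

(** * The quadratic relation between period and quasi-period *)

(** Complex multiplication expresses [B] and [ZB] by [A] and [Z]; eliminating them from Legendre's
    bilinear relation leaves [A] and [Z] alone. *)
Lemma cm_quadratic_relation D s e e' A Z B ZB Lg :
  0 < D -> B = sqrt D * A -> Z = ZB / sqrt D + (s - e - e') * A ->
  A * ZB + B * Z + (e - e') * A * B = Lg ->
  2 * A * Z + (2 * e - s) * A ^ 2 = Lg / sqrt D.
Proof.
  intros HD EB EZ EL; assert (SD := sqrt_lt_R0 _ HD).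
  assert (EZB : ZB = sqrt D * (Z - (s - e - e') * A)) by (rewrite EZ; field; lra).
  rewrite <- EL, EB, EZB; field; lra.
Qed.

(** Common end of both types, with [h] equal to 1 for type II and 1/2 for type I. [C * w ^ 2] is
    sqrt (1 - X), and the relation between [s] and a / b makes the left sides proportional with
    factor 4 C / b. *)
Lemma normalized_formula (h D s p C w X f f1 a b : R) :
  0 < D -> 0 < p -> 0 < C -> 0 < w -> 0 < h -> b <> 0 ->
  (C * w ^ 2) ^ 2 = 1 - X ->
  s / p ^ 2 = 2 / 3 * C * (6 * a / b - 1) ->
  (2 / 3 * C + s / p ^ 2) * f ^ 2 + 8 * C * X * f * f1 = 4 * h / (PI * sqrt D * w ^ 2) ->
  a * f ^ 2 + b * (2 * X * f * f1) = b * h / (sqrt (1 - X) * sqrt D * PI).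
Proof.
  intros HD Hp HC Hw Hh Hb EX Es E.
  assert (SD := sqrt_lt_R0 _ HD); assert (HPI := PI_RGT_0).
  assert (Hw2 : 0 < w ^ 2) by (apply pow_lt, Hw).
  rewrite <- EX, sqrt_pow2 by (apply Rlt_le, Rmult_lt_0_compat; assumption).
  rewrite Es in E.
  apply (Rmult_eq_reg_l (4 * C / b)).
  - transitivity ((2 / 3 * C + 2 / 3 * C * (6 * a / b - 1)) * f ^ 2 + 8 * C * X * f * f1).
    + field; exact Hb.
    + rewrite E; field; repeat split; lra.
  - unfold Rdiv; apply Rmult_integral_contrapositive_currified; [lra|apply Rinv_neq_0_compat, Hb].
Qed.

Lemma weight_sqr_pow2 t : t < 1 -> (weight t ^ 2) ^ 2 = / (1 - t).
Proof. intros Ht; rewrite <- weight_pow4 by exact Ht; ring. Qed.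

(** * Type II: the quadratic relation on a cubic with one real root *)

Section TypeII.

Variables g2 g3 e : R.
Let P x := 4 * x ^ 3 - g2 * x - g3.
Let c1 := 3 * e ^ 2 - g2 / 4.
(** Scaling by the fourth root of [c1] normalizes the constant term of the quartic to 1; comparison
    of the middle terms then gives 2 m - 1 = r. *)
Let p := sqrt (sqrt c1).
Let r := 3 * e / (2 * p ^ 2).
Let m := (1 + r) / 2.
Let t := m * (1 - m).
Let X := 1 - 27 * g3 ^ 2 / g2 ^ 3.

Hypothesis Hg2 : 0 < g2.
Hypothesis He : g2 < 3 * e ^ 2.
Hypothesis He0 : 0 < e.
Hypothesis Pe : P e = 0.
Hypothesis HX : 27 * g3 ^ 2 < 2 * g2 ^ 3.

Lemma II_c1 : 0 < c1.
Proof. unfold c1; lra. Qed.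

Lemma II_p : 0 < p /\ p ^ 4 = c1.
Proof.
  assert (H := II_c1); split.
  - apply sqrt_lt_R0, sqrt_lt_R0, H.
  - replace (p ^ 4) with ((p ^ 2) ^ 2) by ring; unfold p.
    rewrite (pow2_sqrt (sqrt c1)) by apply sqrt_pos; apply pow2_sqrt; lra.
Qed.

Lemma II_r : 0 < r < 1 /\ r ^ 2 = 9 * e ^ 2 / (4 * c1) /\ 2 * p ^ 2 * r = 3 * e.
Proof.
  destruct II_p as [Hp Ep]; assert (H := II_c1).
  assert (Hp2 : 0 < p ^ 2) by (apply pow_lt, Hp).
  assert (E2 : r ^ 2 = 9 * e ^ 2 / (4 * c1)).
  { unfold r; rewrite <- Ep; field; lra. }
  assert (Hr : 0 < r) by (apply Rdiv_lt_0_compat; lra).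
  assert (r ^ 2 < 1) by (rewrite E2; apply Rlt_div_l; unfold c1; lra).
  repeat split; [exact Hr|nra|exact E2|unfold r; field; lra].
Qed.

Lemma II_t : 1 / 2 < m < 1 /\ t = (1 - r ^ 2) / 4 /\ 1 - 16 * t = 3 * g2 / (4 * c1) /\
  1 + 32 * t = 9 * (e ^ 2 - g2 / 4) / c1.
Proof.
  destruct II_r as [Hr [E2 _]]; assert (H := II_c1).
  assert (Et : t = (1 - r ^ 2) / 4) by (unfold t, m; field).
  repeat split; try (unfold m; lra); try exact Et; rewrite Et, E2; unfold c1 in *; field; lra.
Qed.

Lemma II_quartic u : 0 < u -> 0 < u ^ 4 + 3 * e * u ^ 2 + c1.
Proof.
  intros Hu; assert (H := II_c1); assert (0 < u ^ 2) by (apply pow_lt, Hu).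
  assert (0 < u ^ 4) by (apply pow_lt, Hu); nra.
Qed.

(** Completing the square leaves (3 e^2 - g2) / 4, which is positive because the other two roots of
    the cubic are not real. *)
Lemma II_quartic' u : 0 < u ^ 4 + - 3 * e * u ^ 2 + c1.
Proof.
  replace (u ^ 4 + - 3 * e * u ^ 2 + c1) with ((u ^ 2 - 3 / 2 * e) ^ 2 + (3 * e ^ 2 - g2) / 4)
    by (unfold c1; field).
  generalize (pow2_ge_0 (u ^ 2 - 3 / 2 * e)); lra.
Qed.

Lemma II_periods :
  periods (3 * e) c1 (kappa m / p) (p * ((1 - 2 * m) * kappa m + 4 * m * (1 - m) * kappa' m)) /\
  periods (- 3 * e) c1 (kappa (1 - m) / p)
    (p * ((2 * m - 1) * kappa (1 - m) + 4 * m * (1 - m) * kappa' (1 - m))).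
Proof.
  destruct II_p as [Hp Ep]; destruct II_r as [Hr [_ Er]]; destruct II_t as [Hm _]; split.
  - assert (H := periods_scale p _ _ _ _ Hp (periods_II m ltac:(lra))).
    replace (3 * e) with (p ^ 2 * (2 * (2 * m - 1))) by (rewrite <- Er; unfold m; field).
    rewrite <- Ep, <- (Rmult_1_r (p ^ 4)); exact H.
  - assert (H := periods_scale p _ _ _ _ Hp (periods_II (1 - m) ltac:(lra))).
    replace (- 3 * e) with (p ^ 2 * (2 * (2 * (1 - m) - 1)))
      by (replace (- 3 * e) with (- (3 * e)) by ring; rewrite <- Er; unfold m; field).
    rewrite <- Ep, <- (Rmult_1_r (p ^ 4)).
    replace (2 * m - 1) with (1 - 2 * (1 - m)) by ring.
    replace (4 * m * (1 - m)) with (4 * (1 - m) * (1 - (1 - m))) by ring; exact H.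
Qed.

Lemma II_formula D s A Z B ZB a b :
  0 < D -> b <> 0 -> s * g2 = 3 * g3 * (6 * a / b - 1) -> 0 < g3 ->
  A = kappa m / p -> Z = p * ((1 - 2 * m) * kappa m + 4 * m * (1 - m) * kappa' m) ->
  B = kappa (1 - m) / p ->
  ZB = p * ((2 * m - 1) * kappa (1 - m) + 4 * m * (1 - m) * kappa' (1 - m)) ->
  B = sqrt D * A -> Z = ZB / sqrt D + (s - e - e) * A ->
  a * phi X ^ 2 + b * (2 * X * phi X * phi1 X) = b * 1 / (sqrt (1 - X) * sqrt D * PI).
Proof.
  intros HD Hb Hs Hg3 EA EZ EB EZB R1 R2.
  destruct II_p as [Hp Ep]; destruct II_r as [Hr [Er2 Er]]; destruct II_t as [Hm [Et [E16 E32]]].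
  assert (Hc := II_c1); assert (HPI := PI_RGT_0); assert (SD := sqrt_lt_R0 _ HD).
  assert (Hp2 : 0 < p ^ 2) by (apply pow_lt, Hp).
  assert (Hd : 0 < 1 - 16 * t) by (rewrite E16; apply Rdiv_lt_0_compat; lra).
  (* Four times the value of [legendre]: the quasi-periods contain 4 m (1 - m) times [kappa'], and
     the terms in [kappa m * kappa (1 - m)] cancel. *)
  assert (Q := cm_quadratic_relation D s e e A Z B ZB (- PI) HD R1 R2).
  assert (Leg := legendre_relation m ltac:(lra)); unfold legendre in Leg.
  rewrite EA, EB, EZ, EZB in Q.
  specialize (Q ltac:(transitivity (4 * (kappa m * (m * (1 - m) * kappa' (1 - m)) +
    kappa (1 - m) * (m * (1 - m) * kappa' m))); [field; lra|rewrite Leg; field])).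
  assert (EX : X_II t = X).
  (* This identity exhibits 1 - X as (1 - 4 t)(1 + 32 t)^2 / (1 - 16 t)^3, with 1 - 4 t = r^2. *)
  { unfold X_II; replace (- 108 * t) with ((1 - 16 * t) ^ 3 - (1 - 4 * t) * (1 + 32 * t) ^ 2) by ring.
    replace (1 - 4 * t) with (r ^ 2) by lra; rewrite E16, E32, Er2; unfold X.
    replace g3 with (4 * e ^ 3 - g2 * e) by (unfold P in Pe; lra); field; lra. }
  (* Equivalent to X > -1, which is the hypothesis [HX]. *)
  assert (Hlt : 108 * t < (1 - 16 * t) ^ 3).
  { assert (H3 : 0 < (1 - 16 * t) ^ 3) by (apply pow_lt, Hd).
    assert (- 1 < X_II t).
    { rewrite EX; unfold X; assert (27 * g3 ^ 2 / g2 ^ 3 < 2); [|lra].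
      apply Rlt_div_l; [apply pow_lt, Hg2|lra]. }
    unfold X_II in H; apply (Rmult_lt_compat_r _ _ _ H3) in H.
    unfold Rdiv in H; rewrite Rmult_assoc, Rinv_l in H by lra; lra. }
  destruct (kappa_II m Hm ltac:(fold t; lra) Hlt) as [K0 K1]; fold t in K0, K1.
  rewrite EX in K0, K1.
  set (w := weight (16 * t)) in *; assert (Hw : 0 < w) by apply weight_pos.
  assert (Ew : (w ^ 2) ^ 2 = / (1 - 16 * t)) by (apply weight_sqr_pow2; lra).
  set (C := r * (1 + 32 * t) / (1 - 16 * t)).
  assert (EC : C = 9 * g3 / (2 * p ^ 2 * g2)).
  { unfold C; rewrite E16, E32; unfold r.
    replace g3 with (4 * e ^ 3 - g2 * e) by (unfold P in Pe; lra); field; lra. }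
  apply (normalized_formula 1 D s p C w X (phi X) (phi1 X) a b); trivial; try lra.
  - rewrite EC; apply Rdiv_lt_0_compat; [lra|]; apply Rmult_lt_0_compat; lra.
  - rewrite Rpow_mult_distr, Ew, EC, E16; unfold X.
    replace ((9 * g3 / (2 * p ^ 2 * g2)) ^ 2) with (81 * g3 ^ 2 / (4 * p ^ 4 * g2 ^ 2)) by (field; lra).
    rewrite Ep; field; lra.
  - rewrite EC; apply (Rmult_eq_reg_r g2); [|lra].
    replace (s / p ^ 2 * g2) with (s * g2 / p ^ 2) by (field; lra); rewrite Hs; field; lra.
  - rewrite K0, K1 in Q; set (f := phi X) in *; set (f1 := phi1 X) in *.
    assert (EX' : X = - 108 * t / (1 - 16 * t) ^ 3) by (symmetry; exact EX).
    assert (Ee : e = 2 / 3 * p ^ 2 * r) by lra.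
    assert (E2m : 1 - 2 * m = - r) by (unfold m; field).
    rewrite E2m in Q; replace (4 * m * (1 - m)) with (4 * t) in Q by (unfold t; ring).
    apply (Rmult_eq_reg_l (- (PI ^ 2 / 4 * w ^ 2))).
    + transitivity (- PI / sqrt D).
      * rewrite <- Q; rewrite EX', Ee at 1; unfold C; field. repeat split; lra.
      * field; repeat split; lra.
    + assert (0 < PI ^ 2 / 4 * w ^ 2); [|lra].
      apply Rmult_lt_0_compat; [|apply pow_lt, Hw]; assert (0 < PI ^ 2) by (apply pow_lt, HPI); lra.
Qed.

End TypeII.

(** * Type I: the quadratic relation on a cubic with three real roots *)

Section TypeI.

Variables e1 e2 e3 : R.
Let g2 := - (4 * (e1 * e2 + e1 * e3 + e2 * e3)).
Let g3 := 4 * e1 * e2 * e3.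
Let p := sqrt (e1 - e3).
Let m := (e1 - e2) / (e1 - e3).
Let t := m * (1 - m).
Let X := 1 - 27 * g3 ^ 2 / g2 ^ 3.

Hypothesis Hsum : e1 + e2 + e3 = 0.
Hypothesis He23 : e3 < e2.
Hypothesis He2 : e2 < 0.

Lemma I_p : 0 < p /\ p ^ 2 = e1 - e3.
Proof. split; [apply sqrt_lt_R0; lra|apply pow2_sqrt; lra]. Qed.

(** As the roots sum to 0, m > 1/2 is the same as e2 < 0; this places [m] in the range of
    [kappa_I]. *)
Lemma I_m : 1 / 2 < m < 1 /\ p ^ 2 * m = e1 - e2 /\ p ^ 2 * (1 - m) = e2 - e3.
Proof.
  destruct I_p as [Hp Ep]; rewrite Ep; unfold m; repeat split; try (field; lra).
  - apply -> Rlt_div_r; lra.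
  - apply Rlt_div_l; lra.
Qed.

Lemma I_periods :
  periods (3 * e1) (3 * e1 ^ 2 - g2 / 4) (kappa m / p)
    (p * (- m * kappa m + 2 * m * (1 - m) * kappa' m)) /\
  periods (- 3 * e3) (3 * e3 ^ 2 - g2 / 4) (kappa (1 - m) / p)
    (p * (- (1 - m) * kappa (1 - m) + 2 * m * (1 - m) * kappa' (1 - m))).
Proof.
  destruct I_p as [Hp Ep]; destruct I_m as [Hm [Em Em']].
  assert (E2 : e2 = - (e1 + e3)) by lra; split.
  - assert (H := periods_scale p _ _ _ _ Hp (periods_I m ltac:(lra))).
    replace (3 * e1) with (p ^ 2 * (1 + m)) by (rewrite Rmult_plus_distr_l, Em, Ep; lra).
    replace (3 * e1 ^ 2 - g2 / 4) with (p ^ 4 * m); [exact H|].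
    replace (p ^ 4 * m) with (p ^ 2 * (p ^ 2 * m)) by ring; rewrite Em, Ep; unfold g2.
    rewrite E2; field.
  - assert (H := periods_scale p _ _ _ _ Hp (periods_I (1 - m) ltac:(lra))).
    replace (- 3 * e3) with (p ^ 2 * (1 + (1 - m))) by (rewrite Rmult_plus_distr_l, Em', Ep; lra).
    replace (2 * m * (1 - m)) with (2 * (1 - m) * (1 - (1 - m))) by ring.
    replace (3 * e3 ^ 2 - g2 / 4) with (p ^ 4 * (1 - m)); [exact H|].
    replace (p ^ 4 * (1 - m)) with (p ^ 2 * (p ^ 2 * (1 - m))) by ring; rewrite Em', Ep; unfold g2.
    rewrite E2; field.
Qed.

Lemma I_formula D s A Z B ZB a b :
  0 < D -> b <> 0 -> s * g2 = 3 * g3 * (6 * a / b - 1) ->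
  A = kappa m / p -> Z = p * (- m * kappa m + 2 * m * (1 - m) * kappa' m) ->
  B = kappa (1 - m) / p ->
  ZB = p * (- (1 - m) * kappa (1 - m) + 2 * m * (1 - m) * kappa' (1 - m)) ->
  B = sqrt D * A -> Z = ZB / sqrt D + (s - e1 - e3) * A ->
  a * phi X ^ 2 + b * (2 * X * phi X * phi1 X) = b * (1 / 2) / (sqrt (1 - X) * sqrt D * PI).
Proof.
  intros HD Hb Hs EA EZ EB EZB R1 R2.
  destruct I_p as [Hp Ep]; destruct I_m as [Hm [Em Em']].
  assert (HPI := PI_RGT_0); assert (SD := sqrt_lt_R0 _ HD).
  assert (Hp2 : 0 < p ^ 2) by (apply pow_lt, Hp).
  assert (Ht : 0 < t < 1 / 4) by (unfold t; nra).
  (* Twice the value of [legendre]: here (e1 - e3) A B compensates the terms - m and - (1 - m) of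
     the two quasi-periods. *)
  assert (Q := cm_quadratic_relation D s e1 e3 A Z B ZB (- PI / 2) HD R1 R2).
  assert (Leg := legendre_relation m ltac:(lra)); unfold legendre in Leg.
  rewrite EA, EB, EZ, EZB in Q.
  specialize (Q ltac:(rewrite <- Ep; transitivity (2 * (kappa m * (m * (1 - m) * kappa' (1 - m)) +
    kappa (1 - m) * (m * (1 - m) * kappa' m))); [field; lra|rewrite Leg; field])).
  assert (Ee1 : e1 = p ^ 2 * (1 + m) / 3) by lra.
  assert (Ee2 : e2 = p ^ 2 * (1 - 2 * m) / 3) by lra.
  assert (Ee3 : e3 = p ^ 2 * (m - 2) / 3) by lra.
  assert (Eg2 : g2 = 4 / 3 * p ^ 4 * (1 - t)).
  { unfold g2, t; rewrite Ee1, Ee2, Ee3; field. }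
  assert (Eg3 : g3 = 4 / 27 * p ^ 6 * ((2 * m - 1) * (2 + t))).
  { unfold g3, t; rewrite Ee1, Ee2, Ee3; field. }
  assert (EX : X_I t = X).
  { unfold X_I, X; rewrite Eg2, Eg3; unfold t in *; field; lra. }
  destruct (kappa_I m Hm) as [K0 K1]; fold t in K0, K1.
  rewrite EX in K0, K1.
  set (w := weight t) in *; assert (Hw : 0 < w) by apply weight_pos.
  assert (Ew : (w ^ 2) ^ 2 = / (1 - t)) by (apply weight_sqr_pow2; lra).
  set (C := (2 * m - 1) * (2 + t) / (2 * (1 - t))).
  apply (normalized_formula (1 / 2) D s p C w X (phi X) (phi1 X) a b); trivial; try lra.
  - unfold C; apply Rdiv_lt_0_compat; [apply Rmult_lt_0_compat|]; lra.
  - rewrite Rpow_mult_distr, Ew; rewrite <- EX; unfold C, X_I, t in *; field; lra.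
  - apply (Rmult_eq_reg_r g2).
    + replace (s / p ^ 2 * g2) with (s * g2 / p ^ 2) by (field; lra); rewrite Hs, Eg3, Eg2.
      unfold C; field; lra.
    + rewrite Eg2; apply Rgt_not_eq; repeat apply Rmult_lt_0_compat; try lra; apply pow_lt, Hp.
  - rewrite K0, K1 in Q; set (f := phi X) in *; set (f1 := phi1 X) in *.
    assert (EX' : X = 27 * t ^ 2 / (4 * (1 - t) ^ 3)) by (symmetry; exact EX).
    apply (Rmult_eq_reg_l (- (PI ^ 2 / 4 * w ^ 2))).
    + transitivity (- PI / 2 / sqrt D).
      * rewrite <- Q; rewrite EX', Ee1 at 1; unfold C, t in *; field; repeat split; lra.
      * field; repeat split; lra.
    + assert (0 < PI ^ 2 / 4 * w ^ 2); [|lra].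
      apply Rmult_lt_0_compat; [|apply pow_lt, Hw]; assert (0 < PI ^ 2) by (apply pow_lt, HPI); lra.
Qed.

End TypeI.

(** * Maps defined by a kernel polynomial *)

(** f = a + O(1/x) at infinity. A mere limit would not give the error terms that [R0_oo] and [T_oo]
    demand. *)
Definition asym (f : R -> R) (a : R) : Prop :=
  exists C M, forall x, M < x -> 1 < x -> Rabs (f x - a) <= C / x.

Lemma asym_norm f a : asym f a ->
  exists C M, 0 <= C /\ 1 <= M /\ forall x, M < x -> Rabs (f x - a) <= C / x.
Proof.
  intros [C [M H]]; exists (Rabs C), (Rmax 1 M); split; [apply Rabs_pos|split; [apply Rmax_l|]].
  intros x Hx; assert (1 < x) by (eapply Rle_lt_trans; [apply Rmax_l|exact Hx]).
  assert (M < x) by (eapply Rle_lt_trans; [apply Rmax_r|exact Hx]).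
  eapply Rle_trans; [apply H; assumption|].
  unfold Rdiv; apply Rmult_le_compat_r; [apply Rlt_le, Rinv_0_lt_compat; lra|apply Rle_abs].
Qed.

Lemma asym_ext f g a : (forall x, 0 < x -> f x = g x) -> asym f a -> asym g a.
Proof.
  intros E [C [M H]]; exists C, M; intros x H1 H2; rewrite <- E by lra; apply H; assumption.
Qed.

Lemma asym_ext_loc f g a M0 : (forall x, M0 < x -> f x = g x) -> asym f a -> asym g a.
Proof.
  intros E [C [M H]]; exists C, (Rmax M M0); intros x H1 H2.
  assert (M < x) by (eapply Rle_lt_trans; [apply Rmax_l|exact H1]).
  assert (M0 < x) by (eapply Rle_lt_trans; [apply Rmax_r|exact H1]).
  rewrite <- E by assumption; apply H; assumption.
Qed.

Lemma asym_const a : asym (fun _ => a) a.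
Proof.
  exists 0, 0; intros x _ Hx; rewrite Rminus_diag, Rabs_R0; unfold Rdiv; lra.
Qed.

Lemma asym_inv_x : asym (fun x => / x) 0.
Proof.
  exists 1, 0; intros x _ Hx; assert (0 < / x) by (apply Rinv_0_lt_compat; lra).
  rewrite Rminus_0_r, Rabs_pos_eq by lra; unfold Rdiv; lra.
Qed.

Lemma asym_plus f g a b : asym f a -> asym g b -> asym (fun x => f x + g x) (a + b).
Proof.
  intros [C1 [M1 H1]] [C2 [M2 H2]]; exists (C1 + C2), (Rmax M1 M2); intros x Hx H.
  assert (Hx1 : M1 < x) by (eapply Rle_lt_trans; [apply Rmax_l|exact Hx]).
  assert (Hx2 : M2 < x) by (eapply Rle_lt_trans; [apply Rmax_r|exact Hx]).
  replace (f x + g x - (a + b)) with ((f x - a) + (g x - b)) by ring.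
  eapply Rle_trans; [apply Rabs_triang|]; specialize (H1 x Hx1 H); specialize (H2 x Hx2 H).
  unfold Rdiv in *; lra.
Qed.

Lemma asym_mult f g a b : asym f a -> asym g b -> asym (fun x => f x * g x) (a * b).
Proof.
  intros Hf Hg; apply asym_norm in Hf; apply asym_norm in Hg.
  destruct Hf as [C1 [M1 [P1 [Q1 H1]]]], Hg as [C2 [M2 [P2 [Q2 H2]]]].
  exists (C1 * (Rabs b + C2) + Rabs a * C2), (Rmax M1 M2); intros x Hx H.
  assert (Hx1 : M1 < x) by (eapply Rle_lt_trans; [apply Rmax_l|exact Hx]).
  assert (Hx2 : M2 < x) by (eapply Rle_lt_trans; [apply Rmax_r|exact Hx]).
  specialize (H1 x Hx1); specialize (H2 x Hx2).
  replace (f x * g x - a * b) with ((f x - a) * (b + (g x - b)) + a * (g x - b)) by ring.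
  eapply Rle_trans; [apply Rabs_triang|]; rewrite !Rabs_mult.
  assert (Hi : 0 < / x) by (apply Rinv_0_lt_compat; lra).
  assert (Hi1 : / x <= 1) by (rewrite <- Rinv_1; apply Rinv_le_contravar; lra).
  assert (H3 : Rabs (b + (g x - b)) <= Rabs b + C2).
  { eapply Rle_trans; [apply Rabs_triang|]; apply Rplus_le_compat_l.
    eapply Rle_trans; [exact H2|]; unfold Rdiv; rewrite <- (Rmult_1_r C2) at 2.
    apply Rmult_le_compat_l; assumption. }
  replace ((C1 * (Rabs b + C2) + Rabs a * C2) / x) with (C1 / x * (Rabs b + C2) + Rabs a * (C2 / x))
    by (field; lra).
  apply Rplus_le_compat.
  - apply Rmult_le_compat; try apply Rabs_pos; assumption.
  - apply Rmult_le_compat_l; [apply Rabs_pos|exact H2].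
Qed.

Lemma asym_inv g b : b <> 0 -> asym g b -> asym (fun x => / g x) (/ b).
Proof.
  intros Hb Hg; apply asym_norm in Hg; destruct Hg as [C [M [HC [HM H]]]].
  assert (Hb' := Rabs_pos_lt _ Hb).
  exists (2 * C / Rabs b ^ 2), (Rmax M (2 * C / Rabs b)); intros x Hx _.
  assert (Hx1 : M < x) by (eapply Rle_lt_trans; [apply Rmax_l|exact Hx]).
  assert (Hx2 : 2 * C / Rabs b < x) by (eapply Rle_lt_trans; [apply Rmax_r|exact Hx]).
  specialize (H x Hx1); apply Rlt_div_l in Hx2; [|exact Hb'].
  assert (HCx : C / x < Rabs b / 2) by (apply Rlt_div_l; lra).
  assert (Hg : Rabs b / 2 <= Rabs (g x)).
  { assert (Rabs b <= Rabs (g x) + Rabs (b - g x)).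
    { replace b with (g x + (b - g x)) at 1 by ring; apply Rabs_triang. }
    rewrite Rabs_minus_sym in H0; lra. }
  assert (Hg0 : g x <> 0) by (intros E; rewrite E, Rabs_R0 in Hg; lra).
  replace (/ g x - / b) with ((b - g x) * / (g x * b)) by (field; split; assumption).
  rewrite Rabs_mult, Rabs_inv, Rabs_mult, Rabs_minus_sym.
  replace (2 * C / Rabs b ^ 2 / x) with (C / x * / (Rabs b / 2 * Rabs b)) by (field; lra).
  apply Rmult_le_compat; [apply Rabs_pos| |exact H|].
  - apply Rlt_le, Rinv_0_lt_compat, Rmult_lt_0_compat; lra.
  - apply Rinv_le_contravar; [apply Rmult_lt_0_compat; lra|].
    apply Rmult_le_compat_r; lra.
Qed.

Lemma asym_eq f a b : asym f a -> a = b -> asym f b.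
Proof. intros H <-; exact H. Qed.

Lemma asym_shift f a x0 : asym f a -> asym (fun x => f (x - x0)) a.
Proof.
  intros Hf; apply asym_norm in Hf; destruct Hf as [C [M [HC [HM H]]]].
  exists (2 * C), (Rmax (M + x0) (2 * Rabs x0)); intros x Hx Hx'.
  assert (H1 : M + x0 < x) by (eapply Rle_lt_trans; [apply Rmax_l|exact Hx]).
  assert (H2 : 2 * Rabs x0 < x) by (eapply Rle_lt_trans; [apply Rmax_r|exact Hx]).
  eapply Rle_trans; [apply H; lra|].
  assert (H3 := Rle_abs x0).
  replace (2 * C / x) with (C * / (x / 2)) by (field; lra).
  apply Rmult_le_compat_l; [exact HC|]; apply Rinv_le_contravar; lra.
Qed.

Lemma asym_inv_pow k : asym (fun x => / x ^ S k) 0.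
Proof.
  induction k as [|k IH].
  - apply (asym_ext (fun x => / x)); [intros; f_equal; ring|exact asym_inv_x].
  - apply (asym_ext (fun x => / x * / x ^ S k)).
    + intros x Hx; change (x ^ S (S k)) with (x * x ^ S k); rewrite Rinv_mult; reflexivity.
    + apply (asym_eq _ (0 * 0)); [apply asym_mult; [exact asym_inv_x|exact IH]|ring].
Qed.

Section KernelFunction.

Variables D g2 g3 s e e' mu A Z B ZB n : R.
Variables v0 v1 v2 v3 v4 : R -> R.

Let P x := 4 * x ^ 3 - g2 * x - g3.
Let c1 := 3 * e ^ 2 - g2 / 4.
Let c2 := 3 * e' ^ 2 - g2 / 4.

Hypothesis HD : 0 < D.
Hypothesis Hn : D = 2 * n + 1.
Hypothesis Pe : P e = 0.
Hypothesis Pe' : P e' = 0.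
Hypothesis Hc2 : 0 < c2.
Hypothesis HQ1 : forall u, 0 < u -> 0 < u ^ 4 + 3 * e * u ^ 2 + c1.
Hypothesis HQ2 : forall u, 0 < u -> 0 < u ^ 4 + - 3 * e' * u ^ 2 + c2.
Hypothesis Hmu : 0 < P mu.
Hypothesis Hmu' : forall y, y <= mu -> P y <= 0 -> y <= e'.
Hypothesis HA : periods (3 * e) c1 A Z.
Hypothesis HB : periods (- 3 * e') c2 B ZB.

Hypothesis D0 : forall x, e <= x -> is_derive v0 x (v1 x).
Hypothesis D1 : forall x, e <= x -> is_derive v1 x (v2 x).
Hypothesis D2 : forall x, e <= x -> is_derive v2 x (v3 x).
Hypothesis D3 : forall x, e <= x -> is_derive v3 x (v4 x).
Hypothesis Hv : forall x, e <= x -> 0 < v0 x.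
Hypothesis Lim1 : asym (fun x => x * (v1 x / v0 x)) n.
Hypothesis Lim2 : asym (fun x => x ^ 2 * (v2 x / v0 x)) (n * (n - 1)).
(* Hirota's bilinear form of the equation [p'' = 6 p^2 - g2 / 2] satisfied by the function
   [z -> p(sqrt (- D) z)] with [p] the Weierstrass function. *)
Hypothesis Bilinear : forall x, e <= x ->
  let w2 := P x * v2 x + (12 * x ^ 2 - g2) / 2 * v1 x in
  let w2' := P x * v3 x + 3 / 2 * (12 * x ^ 2 - g2) * v2 x + 12 * x * v1 x in
  let w2'' := P x * v4 x + 5 / 2 * (12 * x ^ 2 - g2) * v3 x + 48 * x * v2 x + 12 * v1 x in
  v0 x * (P x * w2'' + (12 * x ^ 2 - g2) / 2 * w2' - 12 * D * (x - s) * w2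
    - D * (6 * x ^ 2 - 6 * D * (x - s) ^ 2 + (D - 1) / 2 * g2) * v0 x)
  + P x * v1 x * (12 * D * (x - s) * v1 x - 4 * w2') + 3 * w2 ^ 2 = 0.
Hypothesis Image : (12 * e ^ 2 - g2) * v1 e = 2 * D * (e + e' - s) * v0 e.

(** [l1] to [l4] are the successive derivatives of log v0. *)
Let l1 x := v1 x / v0 x.
Let l2 x := v2 x / v0 x - l1 x ^ 2.
Let l3 x := v3 x / v0 x - v2 x / v0 x * l1 x - 2 * l1 x * l2 x.
Let l4 x := v4 x / v0 x - v3 x / v0 x * l1 x - (v3 x / v0 x - v2 x / v0 x * l1 x) * l1 x
  - v2 x / v0 x * l2 x - 2 * (l2 x ^ 2 + l1 x * l3 x).

(** For the invariant derivation sqrt P d/dx, applying it twice to a function f gives P f'' + P' f'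
    / 2; the bracket is this with f = log v0. [T] is then [l1 / D] and [EqT] holds by
    construction. *)
Let R0 x := - x + s + / D * (P x * l2 x + (12 * x ^ 2 - g2) / 2 * l1 x).
Let R1 x := - 1 + / D * (P x * l3 x + 3 / 2 * (12 * x ^ 2 - g2) * l2 x + 12 * x * l1 x).
Let R2 x := / D * (P x * l4 x + 5 / 2 * (12 * x ^ 2 - g2) * l3 x + 48 * x * l2 x + 12 * l1 x).
Let T x := / D * l1 x.
Let T1 x := / D * l2 x.

Lemma is_derive_quotient (f g : R -> R) x df dg :
  is_derive f x df -> is_derive g x dg -> g x <> 0 ->
  is_derive (fun x => f x / g x) x (df / g x - f x / g x * (dg / g x)).
Proof.
  intros Hf Hg H; evar_last; [exact (is_derive_div f g x df dg Hf Hg H)|].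
  hier_R; field; exact H.
Qed.

Lemma kernel_l1 x : e <= x -> is_derive l1 x (l2 x).
Proof.
  intros Hx; assert (H := Hv x Hx).
  evar_last; [exact (is_derive_quotient v1 v0 x _ _ (D1 x Hx) (D0 x Hx) ltac:(lra))|].
  unfold l2, l1; hier_R; ring.
Qed.

Lemma kernel_l2 x : e <= x -> is_derive l2 x (l3 x).
Proof.
  intros Hx; assert (H := Hv x Hx); assert (E := kernel_l1 x Hx).
  evar_last.
  - apply (is_derive_minus (V := R_NormedModule) (fun x => v2 x / v0 x) (fun x => l1 x ^ 2)).
    + exact (is_derive_quotient v2 v0 x _ _ (D2 x Hx) (D0 x Hx) ltac:(lra)).
    + apply (is_derive_ext (fun x => l1 x * l1 x)); [intros; eqR; ring|].
      exact (is_derive_Rmult _ _ _ _ _ E E).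
  - unfold l3, l1; hier_R; ring.
Qed.

Lemma kernel_l3 x : e <= x -> is_derive l3 x (l4 x).
Proof.
  intros Hx; assert (H := Hv x Hx); assert (E1 := kernel_l1 x Hx); assert (E2 := kernel_l2 x Hx).
  evar_last.
  - exact (is_derive_minus (V := R_NormedModule) _ _ _ _ _
      (is_derive_minus (V := R_NormedModule) _ _ _ _ _
        (is_derive_quotient v3 v0 x _ _ (D3 x Hx) (D0 x Hx) ltac:(lra))
        (is_derive_Rmult _ _ _ _ _ (is_derive_quotient v2 v0 x _ _ (D2 x Hx) (D0 x Hx) ltac:(lra)) E1))
      (is_derive_Rmult _ _ _ _ _ (is_derive_scal _ _ 2 _ E1) E2)).
  - unfold l4; unfold l1 at 1; hier_R; unfold l1; ring.
Qed.

Lemma kernel_P x : is_derive P x (12 * x ^ 2 - g2).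
Proof. unfold P; auto_derive; [trivial|ring]. Qed.

Lemma kernel_P' x c : is_derive (fun x => c * (12 * x ^ 2 - g2)) x (c * (24 * x)).
Proof. auto_derive; [trivial|ring]. Qed.

Lemma kernel_R0 x : e <= x -> is_derive R0 x (R1 x).
Proof.
  intros Hx; assert (E1 := kernel_l1 x Hx); assert (E2 := kernel_l2 x Hx).
  apply (is_derive_ext (fun x => (- x + s) + / D * (P x * l2 x + / 2 * (12 * x ^ 2 - g2) * l1 x))).
  { intros y; unfold R0; eqR; field; lra. }
  assert (Ex : is_derive (fun x => - x + s) x (- 1)) by (auto_derive; [trivial|ring]).
  evar_last.
  - exact (is_derive_plus (V := R_NormedModule) _ _ _ _ _ Ex (is_derive_scal _ _ (/ D) _
      (is_derive_plus (V := R_NormedModule) _ _ _ _ _ (is_derive_Rmult _ _ _ _ _ (kernel_P x) E2)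
        (is_derive_Rmult _ _ _ _ _ (kernel_P' x (/ 2)) E1)))).
  - unfold R1; hier_R; field; lra.
Qed.

Lemma kernel_R1 x : e <= x -> is_derive R1 x (R2 x).
Proof.
  intros Hx; assert (E1 := kernel_l1 x Hx); assert (E2 := kernel_l2 x Hx); assert (E3 := kernel_l3 x Hx).
  assert (Ex : is_derive (fun x => 12 * x) x 12) by (auto_derive; [trivial|ring]).
  evar_last.
  - exact (is_derive_plus (V := R_NormedModule) _ _ _ _ _ (is_derive_const (- 1) x)
      (is_derive_scal _ _ (/ D) _
      (is_derive_plus (V := R_NormedModule) _ _ _ _ _
      (is_derive_plus (V := R_NormedModule) _ _ _ _ _ (is_derive_Rmult _ _ _ _ _ (kernel_P x) E3)
        (is_derive_Rmult _ _ _ _ _ (kernel_P' x (3 / 2)) E2)) (is_derive_Rmult _ _ _ _ _ Ex E1)))).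
  - unfold R2; hier_R; field; lra.
Qed.

(** Expressed by [l1] to [l4], the bilinear relation is D v0^2 times this equation, so only division
    by a positive factor remains. *)
Lemma kernel_Eq2 x : e <= x ->
  P x * R2 x + (12 * x ^ 2 - g2) * R1 x / 2 = - D * (6 * R0 x ^ 2 - g2 / 2).
Proof.
  intros Hx; assert (H := Hv x Hx); assert (HB' := Bilinear x Hx); cbv zeta in HB'.
  assert (F1 : v1 x = v0 x * l1 x) by (unfold l1; field; lra).
  assert (F2 : v2 x = v0 x * (l2 x + l1 x ^ 2)) by (unfold l2; field; lra).
  assert (F3 : v3 x = v0 x * (l3 x + 3 * l1 x * l2 x + l1 x ^ 3)).
  { unfold l3; rewrite F2; field; lra. }
  assert (F4 : v4 x = v0 x * (l4 x + 4 * l1 x * l3 x + 3 * l2 x ^ 2 + 6 * l1 x ^ 2 * l2 x + l1 x ^ 4)).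
  { unfold l4; rewrite F3, F2; field; lra. }
  rewrite F1, F2, F3, F4 in HB'.
  apply Rminus_diag_uniq; apply (Rmult_eq_reg_l (D * v0 x ^ 2)).
  2:{ apply Rgt_not_eq, Rmult_lt_0_compat; [exact HD|apply pow_lt, H]. }
  rewrite Rmult_0_r, <- HB'; unfold R0, R1, R2.
  generalize (P x) (l1 x) (l2 x) (l3 x) (l4 x) (v0 x); intros; field; lra.
Qed.

Lemma kernel_R0e : R0 e = e'.
Proof.
  assert (H := Hv e (Rle_refl e)); unfold R0; rewrite Pe; unfold l1.
  replace ((12 * e ^ 2 - g2) / 2 * (v1 e / v0 e)) with ((12 * e ^ 2 - g2) * v1 e / (2 * v0 e))
    by (field; lra).
  rewrite Image; field; lra.
Qed.

(** First integral of the second-order equation: the derivative of D P(R0) + P R1^2 is 2 R1 times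
    the equation [kernel_Eq2]. The constant is 0, because at [e] both [e] and its image [e'] are
    roots of [P]. *)
Lemma kernel_Eq1 x : e <= x -> D * P (R0 x) = - (P x * R1 x ^ 2).
Proof.
  intros Hx; set (f := fun x => D * P (R0 x) + P x * (R1 x * R1 x)).
  assert (E : f x = f e).
  { apply derive_0_const; intros y; rewrite Rmin_right, Rmax_left by lra; intros Hy.
    assert (E1 := kernel_R1 y ltac:(lra)).
    evar_last.
    - exact (is_derive_plus (V := R_NormedModule) _ _ _ _ _
       (is_derive_scal _ _ D _ (is_derive_Rcomp P R0 y _ _ (kernel_P (R0 y)) (kernel_R0 y ltac:(lra))))
       (is_derive_Rmult _ _ _ _ _ (kernel_P y) (is_derive_Rmult _ _ _ _ _ E1 E1))).
    - assert (E2 := kernel_Eq2 y ltac:(lra)).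
      transitivity (2 * R1 y * (P y * R2 y + (12 * y ^ 2 - g2) * R1 y / 2 - - D * (6 * R0 y ^ 2 - g2 / 2))).
      + hier_R; field.
      + rewrite E2; ring. }
  unfold f in E; rewrite kernel_R0e, Pe, Pe' in E; lra.
Qed.

Lemma asym_l2 : asym (fun x => x ^ 2 * l2 x) (- n).
Proof.
  apply (asym_ext (fun x => x ^ 2 * (v2 x / v0 x) + - 1 * (x * (v1 x / v0 x) * (x * (v1 x / v0 x))))).
  - intros x _; unfold l2, l1; ring.
  - apply (asym_eq _ (n * (n - 1) + - 1 * (n * n))); [|ring].
    apply asym_plus; [exact Lim2|apply asym_mult; [apply asym_const|apply asym_mult; exact Lim1]].
Qed.

(** The leading terms give 4 (- n) + 6 n = 2 n = D - 1, hence R0 is asymptotic to - x / D. *)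
Lemma kernel_asym : asym (fun x => / x * (P x * l2 x + (12 * x ^ 2 - g2) / 2 * l1 x)) (2 * n).
Proof.
  apply (asym_ext (fun x => (4 + (- g2 * / x ^ 2 + - g3 * / x ^ 3)) * (x ^ 2 * l2 x)
    + (6 + - g2 / 2 * / x ^ 2) * (x * (v1 x / v0 x)))).
  - intros x Hx; fold (l1 x); unfold P; field; lra.
  - apply (asym_eq _ ((4 + (- g2 * 0 + - g3 * 0)) * (- n) + (6 + - g2 / 2 * 0) * n)); [|field].
    apply asym_plus; apply asym_mult; try exact asym_l2; try exact Lim1.
    + apply asym_plus; [apply asym_const|].
      apply asym_plus; apply asym_mult; try apply asym_const; apply asym_inv_pow.
    + apply asym_plus; [apply asym_const|].
      apply asym_mult; [apply asym_const|apply asym_inv_pow].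
Qed.

Lemma kernel_cm_periods : B = sqrt D * A /\ Z = ZB / sqrt D + (s - e - e') * A.
Proof.
  destruct (asym_norm _ _ kernel_asym) as [C1 [M1 [HC1 [HM1 H1]]]].
  destruct (asym_norm _ _ Lim1) as [C2 [M2 [HC2 [HM2 H2]]]].
  assert (HDi : 0 < / D) by (apply Rinv_0_lt_compat, HD).
  set (C := Rabs s + C1 / D + C2 / D).
  assert (P1 : 0 <= C1 / D) by (apply Rmult_le_pos; lra).
  assert (P2 : 0 <= C2 / D) by (apply Rmult_le_pos; lra).
  apply (cm_periods D g2 g3 s e e' mu A Z B ZB R0 R1 R2 T T1) with (C := C) (M := Rmax M1 M2);
    try assumption.
  - exact kernel_R0.
  - exact kernel_R1.
  - intros x Hx; apply (is_derive_scal l1 x (/ D)), kernel_l1, Hx.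
  - exact kernel_R0e.
  - exact kernel_Eq1.
  - exact kernel_Eq2.
  - intros x Hx; unfold R0, T1, T; fold (P x); field; lra.
  - intros x Hx; assert (Hx1 : M1 < x) by (eapply Rle_lt_trans; [apply Rmax_l|exact Hx]).
    specialize (H1 x Hx1); unfold R0; set (q := P x * l2 x + _) in *.
    replace (- x + s + / D * q + x / D) with (s + x / D * (/ x * q - 2 * n)).
    2:{ replace (2 * n) with (D - 1) by lra; field; lra. }
    eapply Rle_trans; [apply Rabs_triang|]; unfold C; rewrite Rplus_assoc; apply Rplus_le_compat_l.
    assert (0 < x / D) by (apply Rdiv_lt_0_compat; lra).
    rewrite Rabs_mult, (Rabs_pos_eq (x / D)) by lra.
    apply Rle_trans with (x / D * (C1 / x)); [apply Rmult_le_compat_l; lra|].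
    replace (x / D * (C1 / x)) with (C1 / D) by (field; lra); lra.
  - intros x Hx; assert (Hx2 : M2 < x) by (eapply Rle_lt_trans; [apply Rmax_r|exact Hx]).
    specialize (H2 x Hx2); unfold T; fold (l1 x) in H2.
    replace (/ D * l1 x - (1 - / D) / (2 * x)) with (/ D * / x * (x * l1 x - n)).
    2:{ replace n with ((D - 1) / 2) by lra; field; lra. }
    assert (Hix : 0 < / x) by (apply Rinv_0_lt_compat; lra).
    assert (HDx : 0 < / D * / x) by (apply Rmult_lt_0_compat; lra).
    rewrite Rabs_mult, (Rabs_pos_eq (/ D * / x)) by lra.
    apply Rle_trans with (/ D * / x * (C2 / x)); [apply Rmult_le_compat_l; lra|].
    replace (/ D * / x * (C2 / x)) with (C2 / D * / x ^ 2) by (field; lra).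
    unfold Rdiv at 2; apply Rmult_le_compat_r; [apply Rlt_le, Rinv_0_lt_compat, pow_lt; lra|].
    unfold C; generalize (Rabs_pos s); lra.
Qed.

End KernelFunction.

(** * Certificates for kernel polynomials *)

Fixpoint peval (p : list Z) (x : R) : R :=
  match p with [] => 0 | a :: p' => IZR a + x * peval p' x end.

Fixpoint padd (p q : list Z) : list Z :=
  match p, q with
  | [], _ => q
  | _, [] => p
  | a :: p', b :: q' => (a + b)%Z :: padd p' q'
  end.

Definition pscal (k : Z) (p : list Z) : list Z := map (Z.mul k) p.

Definition psub (p q : list Z) : list Z := padd p (map Z.opp q).

Fixpoint pmul_naive (p q : list Z) : list Z :=
  match p with [] => [] | a :: p' => padd (pscal a q) (0%Z :: pmul_naive p' q) end.

Fixpoint evens (p : list Z) : list Z :=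
  match p with [] => [] | [a] => [a] | a :: _ :: p' => a :: evens p' end.

Definition odds (p : list Z) : list Z := match p with [] => [] | _ :: p' => evens p' end.

Fixpoint interleave0 (p : list Z) : list Z :=
  match p with [] => [] | a :: p' => a :: 0%Z :: interleave0 p' end.

Definition interleave (p q : list Z) : list Z := padd (interleave0 p) (0%Z :: interleave0 q).

(* Karatsuba's algorithm on the splitting into even and odd parts. *)
Fixpoint karatsuba (n : nat) (p q : list Z) : list Z :=
  match n with
  | O => pmul_naive p q
  | S n' =>
    match p, q with
    | [], _ => []
    | _, [] => []
    | [a], _ => pscal a q
    | _, [b] => pscal b p
    | _, _ =>
      let r0 := karatsuba n' (evens p) (evens q) in
      let r1 := karatsuba n' (odds p) (odds q) in
      let r := karatsuba n' (padd (evens p) (odds p)) (padd (evens q) (odds q)) in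
      interleave (padd r0 (0%Z :: r1)) (psub r (padd r0 r1))
    end
  end.

(** Eight halvings exhaust lists of up to 256 coefficients; beyond that depth the naive product
    takes over. *)
Definition pmul : list Z -> list Z -> list Z := karatsuba 8.

Fixpoint pderiv_from (k : Z) (p : list Z) : list Z :=
  match p with [] => [] | a :: p' => (k * a)%Z :: pderiv_from (k + 1) p' end.

Definition pderiv (p : list Z) : list Z :=
  match p with [] => [] | _ :: p' => pderiv_from 1 p' end.

Fixpoint pshift (c : Z) (p : list Z) : list Z :=
  match p with
  | [] => []
  | a :: p' => let q := pshift c p' in padd [a] (padd (pscal c q) (0%Z :: q))
  end.

(* Candidate quotient by [4 x^3 + p2 x^2 + p1 x + p0] of a polynomial given by its reversed list of
   coefficients; it is multiplied back by the cubic in [check_image]. *)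
Fixpoint pdiv_rev (n : nat) (p2 p1 p0 : Z) (r acc : list Z) : list Z :=
  match n, r with
  | S n', a :: r' =>
    let k := (a / 4)%Z in
    pdiv_rev n' p2 p1 p0 (psub r' [k * p2; k * p1; k * p0]%Z) (k :: acc)
  | _, _ => acc
  end.

(** * Soundness of the arithmetic on coefficient lists *)

Lemma peval_padd p q x : peval (padd p q) x = peval p x + peval q x.
Proof.
  revert q; induction p as [|a p IH]; intros [|b q]; simpl; try ring.
  rewrite IH, plus_IZR; ring.
Qed.

Lemma peval_pscal k p x : peval (pscal k p) x = IZR k * peval p x.
Proof.
  unfold pscal; induction p as [|a p IH]; cbn [peval map]; [ring|].
  rewrite IH, mult_IZR; ring.
Qed.

Lemma peval_psub p q x : peval (psub p q) x = peval p x - peval q x.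
Proof.
  unfold psub; rewrite peval_padd; unfold Rminus; f_equal.
  induction q as [|b q IH]; cbn [peval map]; [ring|]; rewrite IH, opp_IZR; ring.
Qed.

Lemma peval_pmul_naive p q x : peval (pmul_naive p q) x = peval p x * peval q x.
Proof.
  induction p as [|a p IH]; cbn [pmul_naive peval]; [ring|].
  rewrite peval_padd, peval_pscal; cbn [peval]; rewrite IH; ring.
Qed.

Lemma peval_evens_odds p x : peval p x = peval (evens p) (x ^ 2) + x * peval (odds p) (x ^ 2).
Proof.
  assert (H : forall n p, (length p <= n)%nat ->
    peval p x = peval (evens p) (x ^ 2) + x * peval (odds p) (x ^ 2)).
  { clear p; intros n; induction n as [|n IH]; intros p Hp.
    - destruct p; [simpl; ring|simpl in Hp; lia].
    - destruct p as [|a [|b p]]; try (simpl; ring).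
      cbn [peval evens odds]; change (evens (b :: p)) with (odds (a :: b :: p)); simpl in Hp.
      rewrite (IH p) by lia.
      destruct p as [|c p]; cbn [peval evens odds]; ring. }
  apply (H (length p)); lia.
Qed.

Lemma peval_interleave p q x :
  peval (interleave p q) x = peval p (x ^ 2) + x * peval q (x ^ 2).
Proof.
  assert (H : forall p, peval (interleave0 p) x = peval p (x ^ 2)).
  { clear; induction p as [|a p IH]; cbn [interleave0 peval]; [reflexivity|].
    rewrite IH; ring. }
  unfold interleave; rewrite peval_padd; cbn [peval]; rewrite !H; ring.
Qed.

Lemma peval_karatsuba n p q x : peval (karatsuba n p q) x = peval p x * peval q x.
Proof.
  revert p q x; induction n as [|n IH]; intros p q x; [apply peval_pmul_naive|].
  destruct p as [|a [|a' p]]; destruct q as [|b [|b' q]]; cbn [karatsuba];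
    try (rewrite peval_pscal; simpl; ring); try (simpl; ring).
  set (P := a :: a' :: p); set (Q := b :: b' :: q).
  rewrite peval_interleave, peval_psub, !peval_padd; cbn [peval].
  rewrite !IH, !peval_padd, (peval_evens_odds P x), (peval_evens_odds Q x); ring.
Qed.

Lemma peval_pmul p q x : peval (pmul p q) x = peval p x * peval q x.
Proof. apply peval_karatsuba. Qed.

Lemma peval_pderiv_from k p x :
  peval (pderiv_from k p) x = IZR k * peval p x + x * peval (pderiv p) x.
Proof.
  revert k; induction p as [|a p IH]; intros k; cbn [pderiv_from peval pderiv]; [ring|].
  rewrite !IH, plus_IZR, mult_IZR; ring.
Qed.

Lemma is_derive_peval p x : is_derive (peval p) x (peval (pderiv p) x).
Proof.
  revert x; induction p as [|a p IH]; intros x; cbn [peval].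
  - apply (is_derive_const (V := R_NormedModule)).
  - evar_last.
    + exact (is_derive_plus (V := R_NormedModule) _ _ _ _ _ (is_derive_const (IZR a) x)
        (is_derive_Rmult _ _ _ _ _ (is_derive_id x) (IH x))).
    + cbn [pderiv]; rewrite peval_pderiv_from; hier_R; ring.
Qed.

Lemma peval_pshift c p x : peval (pshift c p) x = peval p (x + IZR c).
Proof.
  induction p as [|a p IH]; cbn [pshift]; [reflexivity|].
  rewrite !peval_padd, peval_pscal; cbn [peval]; rewrite IH; ring.
Qed.

Lemma peval_zero p x : forallb (Z.eqb 0) p = true -> peval p x = 0.
Proof.
  induction p as [|a p IH]; cbn [forallb peval]; [reflexivity|].
  intros H; apply andb_prop in H; destruct H as [H1 H2]; apply Z.eqb_eq in H1.
  rewrite (IH H2), <- H1; ring.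
Qed.

Lemma peval_nonneg p x : forallb (Z.leb 0) p = true -> 0 <= x -> 0 <= peval p x.
Proof.
  induction p as [|a p IH]; cbn [forallb peval]; intros H Hx; [lra|].
  apply andb_prop in H; destruct H as [H1 H2]; apply Z.leb_le, IZR_le in H1.
  specialize (IH H2 Hx); assert (0 <= x * peval p x) by (apply Rmult_le_pos; assumption); lra.
Qed.

Lemma asym_peval a p :
  asym (fun x => peval (a :: p) x / x ^ length p) (IZR (last (a :: p) 0%Z)).
Proof.
  revert a; induction p as [|b p IH]; intros a.
  - apply (asym_ext (fun _ => IZR a)); [intros; simpl; field|apply asym_const].
  - apply (asym_ext (fun x => IZR a * / x ^ S (length p) + peval (b :: p) x / x ^ length p)).
    + intros x Hx; change (peval (a :: b :: p) x) with (IZR a + x * peval (b :: p) x).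
      change (x ^ length (b :: p)) with (x * x ^ length p).
      change (x ^ S (length p)) with (x * x ^ length p).
      field; split; [apply pow_nonzero|]; lra.
    + change (last (a :: b :: p) 0%Z) with (last (b :: p) 0%Z).
      apply (asym_eq _ (IZR a * 0 + IZR (last (b :: p) 0%Z))); [|ring].
      apply asym_plus; [|apply IH].
      apply asym_mult; [apply asym_const|apply asym_inv_pow].
Qed.

Lemma asym_peval_length p n a :
  length p = S n -> last p 0%Z = a -> asym (fun x => peval p x / x ^ n) (IZR a).
Proof.
  destruct p as [|b p]; simpl length; intros E <-; [discriminate|].
  injection E as <-; apply asym_peval.
Qed.

Lemma asym_ratio x0 : asym (fun x => x / (x - x0)) 1.
Proof.
  apply (asym_ext_loc (fun x => 1 + x0 * / (x - x0)) _ _ (x0 + 1)).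
  - intros x Hx; field; lra.
  - apply (asym_eq _ (1 + x0 * 0)); [|ring].
    apply asym_plus; [apply asym_const|apply asym_mult; [apply asym_const|]].
    apply (asym_shift (fun x => / x)), asym_inv_x.
Qed.

Section Certificate.

(* The cubic is [4 x^3 - 2 h x - g3], [s] its multiplier constant, [D = 2 n + 1] the degree,
   and [l] lists the coefficients of the kernel polynomial in powers of [x - x0]. *)
Variables (n : nat) (x0 h g3 s : Z) (l : list Z).

Let D : Z := (2 * Z.of_nat n + 1)%Z.
Let lx : list Z := [x0; 1%Z].
Let lx2 : list Z := [x0 * x0; 2 * x0; 1]%Z.
Let ls : list Z := [x0 - s; 1]%Z.
(** The cubic expanded at [x0]. Writing [g2] as 2 h gives P' / 2, encoded by [lP'], integer
    coefficients. *)
Let lP : list Z := [4 * (x0 * x0 * x0) - 2 * h * x0 - g3; 12 * (x0 * x0) - 2 * h; 12 * x0; 4]%Z.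
Let lP' : list Z := [6 * x0 * x0 - h; 12 * x0; 6]%Z.
Let l1 := pderiv l.
Let l2 := pderiv l1.
Let l3 := pderiv l2.
Let l4 := pderiv l3.

(** The left side of the bilinear equation. Products with a factor of at most four coefficients are
    naive, hence of linear cost; Karatsuba serves the three products of two long lists. *)
Definition bilinear_form : list Z :=
  let w := padd (pmul_naive lP l2) (pmul_naive lP' l1) in
  let w' := padd (pmul_naive lP l3) (padd (pscal 3 (pmul_naive lP' l2)) (pscal 12 (pmul_naive lx l1))) in
  let w'' := padd (padd (pmul_naive lP l4) (pscal 5 (pmul_naive lP' l3)))
    (padd (pscal 48 (pmul_naive lx l2)) (pscal 12 l1)) in
  let c := [6 * x0 * x0 - 6 * D * ((x0 - s) * (x0 - s)) + (D - 1) * h; 12 * x0 - 12 * D * (x0 - s); 6 - 6 * D]%Z in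
  let M := psub (padd (pmul_naive lP w'') (pmul_naive lP' w'))
    (padd (pscal (12 * D) (pmul_naive ls w)) (pscal D (pmul_naive c l))) in
  let N := psub (pscal (12 * D) (pmul_naive ls l1)) (pscal 4 w') in
  padd (padd (pmul l M) (pmul (pmul_naive lP l1) N)) (pscal 3 (pmul w w)).

Definition check_bilinear : bool := forallb (Z.eqb 0) bilinear_form.

(* Otherwise conversion runs Karatsuba's algorithm on the symbolic list [l]. *)
Strategy expand [bilinear_form check_bilinear].

Definition check_degree : bool :=
  Nat.leb 2 n && Nat.eqb (length l) (S n) && Z.eqb (last l 0%Z) 1 &&
  Nat.eqb (length l1) n && Z.eqb (last l1 0%Z) (Z.of_nat n) &&
  Nat.eqb (length l2) (n - 1) && Z.eqb (last l2 0%Z) (Z.of_nat n * (Z.of_nat n - 1)).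

(** [e0] is an integer at which the cubic is negative, hence to the left of its top root. Expanded
    at [e0], the kernel polynomial has nonnegative coefficients and a positive constant term, so it
    is positive from there on. The Taylor shift may be split into several steps. *)
Definition check_positive (sh : list Z) : bool :=
  let e0 := (x0 + fold_right Z.add 0 sh)%Z in
  match fold_right pshift l sh with
  | [] => false
  | a :: q => Z.ltb 0 a && forallb (Z.leb 0) q
  end && Z.ltb (4 * (e0 * e0 * e0) - 2 * h * e0 - g3) 0.

(* Its vanishing at the real root of the cubic says that multiplication by [sqrt (- D)] fixes the
   real 2-torsion point. *)
Definition image_form : list Z :=
  psub (pmul_naive lP' l1) (pscal D (pmul_naive [2 * x0 - s; 2]%Z l)).

Definition check_image : bool :=
  let f := image_form in
  forallb (Z.eqb 0) (psub f (pmul_naive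
    (pdiv_rev (length f - 3) (12 * x0) (12 * (x0 * x0) - 2 * h) (4 * (x0 * x0 * x0) - 2 * h * x0 - g3) (rev f) []) lP)).

Ltac push_IZR :=
  rewrite ?plus_IZR, ?mult_IZR, ?minus_IZR, ?mult_IZR, ?minus_IZR, ?plus_IZR, ?mult_IZR, ?minus_IZR, ?mult_IZR.

Lemma peval_lx y : peval lx y = IZR x0 + y.
Proof. unfold lx; cbn [peval]; ring. Qed.

Lemma peval_ls y : peval ls y = IZR x0 + y - IZR s.
Proof. unfold ls; cbn [peval]; push_IZR; ring. Qed.

Lemma peval_lP y :
  peval lP y = 4 * (IZR x0 + y) ^ 3 - IZR (2 * h) * (IZR x0 + y) - IZR g3.
Proof. unfold lP; cbn [peval]; push_IZR; ring. Qed.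

Lemma peval_lP' y : peval lP' y = (12 * (IZR x0 + y) ^ 2 - IZR (2 * h)) / 2.
Proof. unfold lP'; cbn [peval]; push_IZR; field. Qed.

Lemma peval_lc y :
  peval [6 * x0 * x0 - 6 * D * ((x0 - s) * (x0 - s)) + (D - 1) * h;
    12 * x0 - 12 * D * (x0 - s); 6 - 6 * D]%Z y =
  6 * (IZR x0 + y) ^ 2 - 6 * IZR D * (IZR x0 + y - IZR s) ^ 2 + (IZR D - 1) / 2 * IZR (2 * h).
Proof. cbn [peval]; push_IZR; field. Qed.

Lemma Certificate_bilinear (HB : check_bilinear = true) y :
  let x := IZR x0 + y in
  let P := 4 * x ^ 3 - IZR (2 * h) * x - IZR g3 in
  let v := peval l y in let v1 := peval l1 y in let v2 := peval l2 y in
  let v3 := peval l3 y in let v4 := peval l4 y in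
  let w2 := P * v2 + (12 * x ^ 2 - IZR (2 * h)) / 2 * v1 in
  let w2' := P * v3 + 3 / 2 * (12 * x ^ 2 - IZR (2 * h)) * v2 + 12 * x * v1 in
  let w2'' := P * v4 + 5 / 2 * (12 * x ^ 2 - IZR (2 * h)) * v3 + 48 * x * v2 + 12 * v1 in
  v * (P * w2'' + (12 * x ^ 2 - IZR (2 * h)) / 2 * w2' - 12 * IZR D * (x - IZR s) * w2
    - IZR D * (6 * x ^ 2 - 6 * IZR D * (x - IZR s) ^ 2 + (IZR D - 1) / 2 * IZR (2 * h)) * v)
  + P * v1 * (12 * IZR D * (x - IZR s) * v1 - 4 * w2') + 3 * w2 ^ 2 = 0.
Proof.
  intros; rewrite <- (peval_zero _ y HB); unfold bilinear_form.
  repeat rewrite ?peval_padd, ?peval_psub, ?peval_pscal, ?peval_pmul, ?peval_pmul_naive.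
  rewrite peval_lP, peval_lP', peval_lx, peval_ls, peval_lc, (mult_IZR 12 D).
  fold x v v1 v2 v3 v4; fold P; unfold w2, w2', w2''; clearbody x P v v1 v2 v3 v4.
  generalize (IZR (2 * h)) (IZR D) (IZR s); intros; field.
Qed.

Lemma IZR_D : IZR D = 2 * INR n + 1.
Proof. unfold D; rewrite plus_IZR, mult_IZR, <- INR_IZR_INZ; reflexivity. Qed.

Lemma Certificate_image (HI : check_image = true) y :
  let x := IZR x0 + y in
  4 * x ^ 3 - IZR (2 * h) * x - IZR g3 = 0 ->
  (12 * x ^ 2 - IZR (2 * h)) * peval l1 y = 2 * IZR D * (x + x - IZR s) * peval l y.
Proof.
  cbv zeta; intros HP; assert (H := peval_zero _ y HI).
  rewrite peval_psub, peval_pmul_naive in H.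
  assert (EP : peval lP y = 0).
  { rewrite <- HP; unfold lP; cbn [peval].
    rewrite ?plus_IZR, ?mult_IZR, ?minus_IZR, ?mult_IZR, ?minus_IZR, ?mult_IZR; ring. }
  rewrite EP, Rmult_0_r, Rminus_0_r in H; unfold image_form in H.
  rewrite peval_psub, peval_pscal, !peval_pmul_naive in H; unfold lP' in H; cbn [peval] in H.
  rewrite ?plus_IZR, ?mult_IZR, ?minus_IZR, ?mult_IZR, ?minus_IZR, ?mult_IZR in H.
  apply Rminus_diag_uniq; rewrite <- (Rmult_0_r 2), <- H.
  rewrite ?mult_IZR; ring.
Qed.

Lemma peval_shifts sh x :
  peval (fold_right pshift l sh) x = peval l (x + IZR (fold_right Z.add 0%Z sh)).
Proof.
  revert x; induction sh as [|c sh IH]; intros x; cbn [fold_right].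
  - f_equal; ring.
  - rewrite peval_pshift, IH, plus_IZR; f_equal; ring.
Qed.

Lemma Certificate_positive sh (HV : check_positive sh = true) (e : R) :
  4 * e ^ 3 - IZR (2 * h) * e - IZR g3 = 0 ->
  (forall x, e < x -> 0 < 4 * x ^ 3 - IZR (2 * h) * x - IZR g3) ->
  forall x, e <= x -> 0 < peval l (x - IZR x0).
Proof.
  intros Pe HP x Hx; unfold check_positive in HV; apply andb_prop in HV; destruct HV as [H1 H2].
  set (c := fold_right Z.add 0%Z sh) in *; set (e0 := (x0 + c)%Z) in *.
  apply Z.ltb_lt, IZR_lt in H2.
  assert (He0 : IZR e0 < e).
  { destruct (Rlt_dec (IZR e0) e) as [|N]; [assumption|exfalso].
    assert (0 <= 4 * IZR e0 ^ 3 - IZR (2 * h) * IZR e0 - IZR g3).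
    { destruct (Req_dec e (IZR e0)) as [<-|Hne]; [lra|apply Rlt_le, HP; lra]. }
    rewrite !minus_IZR, !mult_IZR in H2; rewrite mult_IZR in H; lra. }
  set (y := x - IZR e0).
  replace (x - IZR x0) with (y + IZR c) by (unfold y, e0; rewrite plus_IZR; ring).
  unfold c; rewrite <- peval_shifts.
  destruct (fold_right pshift l sh) as [|a q]; [discriminate|].
  apply andb_prop in H1; destruct H1 as [H1 H3]; apply Z.ltb_lt, IZR_lt in H1.
  cbn [peval]; assert (Hy : 0 < y) by (unfold y; lra).
  assert (0 <= y * peval q y) by (apply Rmult_le_pos; [lra|apply peval_nonneg; [exact H3|lra]]); lra.
Qed.

(** Degrees and leading coefficients of the polynomial and its first two derivatives are verified by
    computation. The passage from powers of x - x0 to powers of x costs a factor x / (x - x0), which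
    is 1 + O(1/x). *)
Lemma Certificate_asym (HD : check_degree = true) :
  asym (fun x => x * (peval l1 (x - IZR x0) / peval l (x - IZR x0))) (INR n) /\
  asym (fun x => x ^ 2 * (peval l2 (x - IZR x0) / peval l (x - IZR x0))) (INR n * (INR n - 1)).
Proof.
  unfold check_degree in HD; rewrite !andb_true_iff in HD.
  destruct HD as [[[[[[Hn H0] H0'] H1] H1'] H2] H2'].
  apply Nat.leb_le in Hn; apply Nat.eqb_eq in H0, H1, H2; apply Z.eqb_eq in H0', H1', H2'.
  destruct n as [|[|k]] eqn:En; try lia.
  assert (A0 := asym_shift _ _ (IZR x0) (asym_peval_length _ _ _ H0 H0')).
  assert (A1 := asym_shift _ _ (IZR x0) (asym_peval_length _ _ _ H1 H1')).
  assert (H2n : length l2 = S k) by lia.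
  assert (A2 := asym_shift _ _ (IZR x0) (asym_peval_length _ _ _ H2n H2')).
  assert (Ar := asym_ratio (IZR x0)).
  assert (Ai := asym_inv _ 1 R1_neq_R0 A0).
  assert (Dn : forall x, Rabs (IZR x0) + 1 < x -> x - IZR x0 <> 0).
  { intros x Hx; generalize (Rle_abs (IZR x0)); lra. }
  rewrite <- INR_IZR_INZ in A1; rewrite mult_IZR, minus_IZR, <- INR_IZR_INZ in A2.
  split.
  - apply (asym_ext_loc (fun x => (x / (x - IZR x0)) * (peval l1 (x - IZR x0) / (x - IZR x0) ^ (S k)
      * / (peval l (x - IZR x0) / (x - IZR x0) ^ S (S k)))) _ _ (Rabs (IZR x0) + 1)).
    + intros x Hx; specialize (Dn x Hx); unfold Rdiv; rewrite !Rinv_mult, Rinv_inv.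
      set (i := / peval l _); change ((x - IZR x0) ^ S (S k)) with ((x - IZR x0) * (x - IZR x0) ^ S k).
      field; split; [apply pow_nonzero|]; exact Dn.
    + apply (asym_eq _ (1 * (INR (S (S k)) * / 1))); [|field].
      apply asym_mult; [exact Ar|apply asym_mult; assumption].
  - apply (asym_ext_loc (fun x => ((x / (x - IZR x0)) * (x / (x - IZR x0)))
      * (peval l2 (x - IZR x0) / (x - IZR x0) ^ k
      * / (peval l (x - IZR x0) / (x - IZR x0) ^ S (S k)))) _ _ (Rabs (IZR x0) + 1)).
    + intros x Hx; specialize (Dn x Hx); unfold Rdiv; rewrite !Rinv_mult, Rinv_inv.
      set (i := / peval l _).
      change ((x - IZR x0) ^ S (S k)) with ((x - IZR x0) * ((x - IZR x0) * (x - IZR x0) ^ k)).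
      field; split; [apply pow_nonzero|]; exact Dn.
    + apply (asym_eq _ ((1 * 1) * (INR (S (S k)) * (INR (S (S k)) - 1) * / 1))); [|field].
      apply asym_mult; [apply asym_mult; exact Ar|apply asym_mult; assumption].
Qed.

End Certificate.

(** * The two families of series *)

(** At rho = sqrt (g2 / 3) the cubic equals rho^3 - g3 < 0. Starting the intermediate value theorem
    there, rather than at 0, yields g2 < 3 e^2 at once. *)
Lemma top_root g2 g3 :
  0 < g2 -> 0 < g3 -> g2 ^ 3 < 27 * g3 ^ 2 ->
  exists e, 0 < e /\ g2 < 3 * e ^ 2 /\ 4 * e ^ 3 - g2 * e - g3 = 0.
Proof.
  intros H2 H3 H; set (rho := sqrt (g2 / 3)).
  assert (Hr : 0 < rho) by (apply sqrt_lt_R0; lra).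
  assert (Er : rho ^ 2 = g2 / 3) by (apply pow2_sqrt; lra).
  assert (Hlt : rho ^ 3 < g3).
  { apply Rsqr_incrst_0; [|apply Rlt_le, pow_lt, Hr|lra]; rewrite !Rsqr_pow2.
    replace ((rho ^ 3) ^ 2) with ((rho ^ 2) ^ 3) by ring; rewrite Er; lra. }
  assert (Hrho : 4 * rho ^ 3 - g2 * rho - g3 < 0).
  { replace (4 * rho ^ 3) with (4 * rho ^ 2 * rho) by ring; rewrite Er.
    replace (rho ^ 3) with (rho ^ 2 * rho) in Hlt by ring; rewrite Er in Hlt; lra. }
  assert (Hbig : rho < 1 + g2 + g3).
  { apply Rsqr_incrst_0; [|lra|lra]; rewrite !Rsqr_pow2, Er; nra. }
  destruct (IVT_interv (fun x => 4 * x ^ 3 - g2 * x - g3) rho (1 + g2 + g3)) as [e [He Ee]].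
  - intros x _; apply (is_derive_continuity_pt _ _ (12 * x ^ 2 - g2)); auto_derive; [trivial|ring].
  - exact Hbig.
  - exact Hrho.
  - assert (1 <= (1 + g2 + g3) ^ 2) by nra.
    set (y := 1 + g2 + g3).
    assert (Hy : 1 <= y) by (unfold y; lra); assert (y <= y ^ 2) by nra.
    assert (y ^ 2 <= y ^ 3) by nra; assert (g2 * y <= (y - 1) * y) by (apply Rmult_le_compat_r; unfold y; lra).
    assert (g3 < y) by (unfold y; lra); nra.
  - exists e; split; [lra|split; [|exact Ee]].
    assert (Hne : e <> rho) by (intros ->; lra).
    assert (rho < e) by (destruct (Rle_lt_or_eq_dec rho e (proj1 He)); [assumption|subst; contradiction]).
    nra.
Qed.

Lemma certificate_II (n : nat) (x0 h g3 s a b : Z) (l sh : list Z) :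
  check_degree n l = true -> check_bilinear n x0 h g3 s l = true ->
  check_positive x0 h g3 l sh = true -> check_image n x0 h g3 s l = true ->
  0 < IZR h -> 0 < IZR g3 -> 8 * IZR h ^ 3 < 27 * IZR g3 ^ 2 < 16 * IZR h ^ 3 ->
  b <> 0%Z -> (s * (2 * h) * b = 3 * g3 * (6 * a - b))%Z ->
  let X := 1 - 27 * IZR g3 ^ 2 / (8 * IZR h ^ 3) in
  IZR a * phi X ^ 2 + IZR b * (2 * X * phi X * phi1 X) =
    IZR b * 1 / (sqrt (1 - X) * sqrt (2 * INR n + 1) * PI).
Proof.
  intros Hdeg Hbil Hpos Him Hh Hg3 HX Hb Hs X.
  set (g2 := IZR (2 * h)).
  assert (Eg2 : g2 = 2 * IZR h) by (unfold g2; rewrite mult_IZR; ring).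
  assert (Hg2 : 0 < g2) by lra.
  assert (Eg : g2 ^ 3 = 8 * IZR h ^ 3) by (rewrite Eg2; ring).
  destruct (top_root g2 (IZR g3) Hg2 Hg3 ltac:(lra)) as [e [He0 [He Pe]]].
  assert (HbR : IZR b <> 0) by (apply not_0_IZR, Hb).
  assert (HsR : IZR s * g2 = 3 * IZR g3 * (6 * IZR a / IZR b - 1)).
  { apply (f_equal IZR) in Hs; rewrite !mult_IZR, minus_IZR, mult_IZR in Hs.
    rewrite Eg2; apply (Rmult_eq_reg_r (IZR b)); [|exact HbR].
    transitivity (IZR s * (2 * IZR h) * IZR b); [ring|rewrite Hs; field; exact HbR]. }
  assert (EX : X = 1 - 27 * IZR g3 ^ 2 / g2 ^ 3) by (rewrite Eg; reflexivity).
  rewrite EX.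
  set (D := 2 * INR n + 1).
  assert (HD : 0 < D) by (unfold D; generalize (pos_INR n); lra).
  destruct (II_periods g2 e Hg2 He He0) as [PA PB].
  set (p := sqrt (sqrt (3 * e ^ 2 - g2 / 4))) in *.
  set (m := (1 + 3 * e / (2 * p ^ 2)) / 2) in *.
  assert (Top : forall x, e < x -> 0 < 4 * x ^ 3 - g2 * x - IZR g3).
  { intros x Hx; set (u := x - e).
    replace (4 * x ^ 3 - g2 * x - IZR g3) with
      (4 * u * (u ^ 2 + 3 * e * u + (3 * e ^ 2 - g2 / 4)) + (4 * e ^ 3 - g2 * e - IZR g3))
      by (unfold u; field).
    rewrite Pe, Rplus_0_r; assert (0 < u) by (unfold u; lra).
    repeat apply Rmult_lt_0_compat; try lra.
    assert (0 < u ^ 2) by (apply pow_lt; assumption).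
    assert (0 < 3 * e * u) by (repeat apply Rmult_lt_0_compat; lra); lra. }
  assert (Shift : forall f df : R -> R, (forall y, is_derive f y (df y)) ->
    forall x, is_derive (fun x => f (x - IZR x0)) x (df (x - IZR x0))).
  { intros f df Hf x; evar_last.
    - apply (is_derive_Rcomp f (fun x => x - IZR x0) x); [apply Hf|].
      instantiate (1 := 1); auto_derive; [trivial|ring].
    - ring. }
  destruct (Certificate_asym n x0 l Hdeg) as [A1 A2].
  assert (ED : IZR (2 * Z.of_nat n + 1) = D) by (apply IZR_D).
  set (l1 := pderiv l) in *; set (l2 := pderiv l1) in *.
  set (l3 := pderiv l2) in *; set (l4 := pderiv l3) in *.
  assert (Ex : forall x, IZR x0 + (x - IZR x0) = x) by (intros; ring).
  (* With a single real root, [e'] is [e] itself, and any point to its right can serve as [mu]. *)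
  edestruct (kernel_cm_periods D g2 (IZR g3) (IZR s) e e (e + 1)) as [R1 R2];
    [exact HD|reflexivity|exact Pe|exact Pe|..].
  - lra.
  - apply II_quartic; assumption.
  - intros; apply II_quartic'; assumption.
  - apply Top; lra.
  - intros y _ Hy; destruct (Rle_lt_dec y e) as [|Hlt]; [assumption|specialize (Top y Hlt); lra].
  - exact PA.
  - exact PB.
  - exact (fun x _ => Shift _ _ (is_derive_peval l) x).
  - exact (fun x _ => Shift _ _ (is_derive_peval l1) x).
  - exact (fun x _ => Shift _ _ (is_derive_peval l2) x).
  - exact (fun x _ => Shift _ _ (is_derive_peval l3) x).
  - exact (Certificate_positive x0 h g3 l sh Hpos e Pe Top).
  - exact A1.
  - exact A2.
  - intros x _; cbv zeta.
    assert (H := Certificate_bilinear n x0 h g3 s l Hbil (x - IZR x0)); cbv zeta in H.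
    rewrite Ex, ED in H; exact H.
  - assert (H := Certificate_image n x0 h g3 s l Him (e - IZR x0)); cbv zeta in H.
    rewrite Ex, ED in H; exact (H Pe).
  - eapply (II_formula g2 (IZR g3) e Hg2 He He0 Pe ltac:(lra) D (IZR s)).
    + exact HD.
    + exact HbR.
    + exact HsR.
    + exact Hg3.
    + reflexivity.
    + reflexivity.
    + reflexivity.
    + reflexivity.
    + exact R1.
    + exact R2.
Qed.

(** In the ratio of consecutive terms, the even factors of (6n + 6)! / (6n)! cancel against (3n +
    3)! / (3n)! and leave 8 (6n + 1)(6n + 3)(6n + 5) / (n + 1)^3, where 8 * 6^3 = 1728. *)
Lemma c_clausen n : c n = 1728 ^ n * clausen n.
Proof.
  induction n as [|n IH].
  - unfold c; simpl; field.
  - transitivity (c n * (1728 * ((INR n + 1 / 6) * (INR n + 1 / 2) * (INR n + 5 / 6) / (INR n + 1) ^ 3))).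
    2:{ rewrite IH; cbn [clausen pow]; ring. }
    unfold c.
    replace (6 * S n)%nat with (S (S (S (S (S (S (6 * n))))))) by lia.
    replace (3 * S n)%nat with (S (S (S (3 * n)))) by lia.
    repeat rewrite (fact_simpl (S _)), mult_INR.
    rewrite (fact_simpl (6 * n)), (fact_simpl (3 * n)), (fact_simpl n), !mult_INR, !S_INR, !mult_INR.
    simpl (INR 6); simpl (INR 3).
    assert (Hn := pos_INR n); assert (F1 := INR_fact_neq_0 n).
    assert (F3 := INR_fact_neq_0 (3 * n)).
    field; repeat split; try assumption; lra.
Qed.

(** Here c_n / j^n is the n-th term of Clausen's series at X; the part linear in n is the Euler
    operator applied to the square of [phi]. *)
Lemma series_value X j a b :
  Rabs X < 1 -> j * X = 1728 ->
  infinite_sum (fun n => c n * (a + b * INR n) / j ^ n)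
    (a * phi X ^ 2 + b * (2 * X * phi X * phi1 X)).
Proof.
  intros HX Hj; apply is_series_Reals.
  assert (Hj0 : j <> 0) by (intros E; rewrite E in Hj; lra).
  assert (A := analytic1_clausen); assert (At := analytic1_theta _ A).
  assert (S0 : is_series (fun n => clausen n * X ^ n) (phi X ^ 2)).
  { rewrite <- clausen_identity by exact HX; apply (proj1 (is_pseries_R _ _ _)), PSeries_correct, analytic1_ex; assumption. }
  assert (S1 : is_series (fun n => theta clausen n * X ^ n) (2 * X * phi X * phi1 X)).
  { assert (E : PSeries (theta clausen) X = X * (2 * (phi X * phi1 X))).
    - apply (PSeries_theta clausen (fun y => phi y * phi y) X _ A HX).
      + intros y Hy; rewrite clausen_identity by exact Hy; ring.
      + assert (D0 := is_derive_phi X HX).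
        evar_last; [exact (is_derive_Rmult _ _ _ _ _ D0 D0)|hier_R; ring].
    - replace (2 * X * phi X * phi1 X) with (PSeries (theta clausen) X) by (rewrite E; ring).
      apply (proj1 (is_pseries_R _ _ _)), PSeries_correct, analytic1_ex; assumption. }
  assert (Sum := is_series_plus _ _ _ _ (is_series_scal a _ _ S0) (is_series_scal b _ _ S1)).
  eapply is_series_ext; [|exact Sum].
  intros n; unfold theta; hier_R; rewrite c_clausen.
  replace 1728 with (j * X); rewrite Rpow_mult_distr; field; apply pow_nonzero, Hj0.
Qed.

(** Squaring removes the radicals, so that each constant only requires an equality of rational
    numbers. *)
Lemma ramanujan_constant X D b h d q :
  0 < D -> X < 1 -> 0 < b -> 0 < h -> 0 < d -> q * ((1 - X) * D) = (b * h * d) ^ 2 ->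
  b * h / (sqrt (1 - X) * sqrt D * PI) = sqrt q / (d * PI).
Proof.
  intros HD HX Hb Hh Hd E; assert (HPI := PI_RGT_0).
  assert (Hp : 0 < (1 - X) * D) by (apply Rmult_lt_0_compat; lra).
  assert (Hs := sqrt_lt_R0 _ Hp).
  rewrite <- sqrt_mult by lra.
  assert (Hq : 0 <= q).
  { apply (Rmult_le_reg_r ((1 - X) * D)); [exact Hp|]; rewrite E, Rmult_0_l; apply pow2_ge_0. }
  assert (Eq : sqrt q * sqrt ((1 - X) * D) = b * h * d).
  { rewrite <- sqrt_mult by lra; rewrite E; apply sqrt_pow2.
    apply Rlt_le; repeat apply Rmult_lt_0_compat; assumption. }
  set (r := sqrt ((1 - X) * D)) in *.
  replace (sqrt q) with (b * h * d / r) by (rewrite <- Eq; field; lra).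
  field; lra.
Qed.

Lemma ramanujan_II (n : nat) (x0 h g3 s a b : Z) (l sh : list Z) (j d q : R) :
  check_degree n l = true -> check_bilinear n x0 h g3 s l = true ->
  check_positive x0 h g3 l sh = true -> check_image n x0 h g3 s l = true ->
  0 < IZR h -> 0 < IZR g3 -> 8 * IZR h ^ 3 < 27 * IZR g3 ^ 2 < 16 * IZR h ^ 3 ->
  (0 < b)%Z -> (s * (2 * h) * b = 3 * g3 * (6 * a - b))%Z -> 0 < d ->
  let X := 1 - 27 * IZR g3 ^ 2 / (8 * IZR h ^ 3) in
  j * X = 1728 -> q * ((1 - X) * (2 * INR n + 1)) = (IZR b * d) ^ 2 ->
  infinite_sum (fun n => c n * (IZR a + IZR b * INR n) / j ^ n) (sqrt q / (d * PI)).
Proof.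
  intros H1 H2 H3 H4 Hh Hg3 HX Hb Hs Hd X Hj Hq.
  assert (Hh3 : 0 < 8 * IZR h ^ 3) by (assert (0 < IZR h ^ 3) by (apply pow_lt, Hh); lra).
  assert (HX' : -1 < X < 0).
  { unfold X; assert (1 < 27 * IZR g3 ^ 2 / (8 * IZR h ^ 3)) by (apply -> Rlt_div_r; lra).
    assert (27 * IZR g3 ^ 2 / (8 * IZR h ^ 3) < 2) by (apply Rlt_div_l; lra); lra. }
  rewrite <- (ramanujan_constant X (2 * INR n + 1) (IZR b) 1 d q).
  - assert (E := certificate_II n x0 h g3 s a b l sh H1 H2 H3 H4 Hh Hg3 HX ltac:(lia) Hs).
    cbv zeta in E; fold X in E; rewrite <- E.
    apply series_value; [apply Rabs_def1; lra|exact Hj].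
  - generalize (pos_INR n); lra.
  - lra.
  - apply IZR_lt, Hb.
  - lra.
  - exact Hd.
  - rewrite Hq; ring.
Qed.

(** * Type II evaluations *)

(** Opposite points of the kernel share an abscissa, whence the degree (D - 1) / 2. This list is in
    powers of x + 5, constant term first; each later list is centred at its own [x0]. *)
Definition kernel_7 : list Z :=
  [-83; -149; -1; 1]%Z.

Lemma ramanujan_7 :
  infinite_sum (fun n => c n * (8 + 63 * INR n) / (- 15 ^ 3) ^ n)
    (sqrt (15 ^ 3) / (3 * PI)).
Proof.
  (* Curve with g2 = 560 and g3 = 3136. The multiplier s = -4 matches the series by -4 * 560 * 63 =
     3 * 3136 * (6 * 8 - 63), and -5 + 18 = 13 lies below the real root. *)
  apply (ramanujan_II 3 (-5) 280 3136 (-4) 8 63 kernel_7 [18]%Z).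
  1-4: vm_cast_no_check (eq_refl true).
  - lra.
  - lra.
  - split; lra.
  - reflexivity.
  - reflexivity.
  - lra.
  - field.
  - rewrite INR_IZR_INZ; simpl (IZR (Z.of_nat _)); field.
Qed.

Definition kernel_11 : list Z :=
  [241; 587; -35; -137; 2; 1]%Z.

Lemma ramanujan_11 :
  infinite_sum (fun n => c n * (15 + 154 * INR n) / (- 32 ^ 3) ^ n)
    (sqrt (32 ^ 3) / (4 * PI)).
Proof.
  apply (ramanujan_II 5 (-4) 132 847 (-4) 15 154 kernel_11 [13]%Z).
  1-4: vm_cast_no_check (eq_refl true).
  - lra.
  - lra.
  - split; lra.
  - reflexivity.
  - reflexivity.
  - lra.
  - field.
  - rewrite INR_IZR_INZ; simpl (IZR (Z.of_nat _)); field.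
Qed.

Definition kernel_19 : list Z :=
  [37; 7; -1299; 4040; -3852; 298; 856; -203; 2; 1]%Z.

Lemma ramanujan_19 :
  infinite_sum (fun n => c n * (25 + 342 * INR n) / (- 96 ^ 3) ^ n)
    (sqrt (96 ^ 3) / (12 * PI)).
Proof.
  apply (ramanujan_II 9 (-4) 76 361 (-4) 25 342 kernel_19 [11]%Z).
  1-4: vm_cast_no_check (eq_refl true).
  - lra.
  - lra.
  - split; lra.
  - reflexivity.
  - reflexivity.
  - lra.
  - field.
  - rewrite INR_IZR_INZ; simpl (IZR (Z.of_nat _)); field.
Qed.

(** The zero constant term reflects the root x = -3, abscissa of a 3-torsion point: the kernel is
    cyclic of order 27 and contains a subgroup of order 3. *)
Definition kernel_27 : list Z :=
  [0; 1; 24; 201; 590; -585; -5895; -7014; 2718; 3978; -382; -213; 15; 1]%Z.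

Lemma ramanujan_27 :
  infinite_sum (fun n => c n * (31 + 506 * INR n) / (- (3 * 160 ^ 3)) ^ n)
    (sqrt (3 * 160 ^ 3) / (36 * PI)).
Proof.
  apply (ramanujan_II 13 (-3) 60 253 (-4) 31 506 kernel_27 [9]%Z).
  1-4: vm_cast_no_check (eq_refl true).
  - lra.
  - lra.
  - split; lra.
  - reflexivity.
  - reflexivity.
  - lra.
  - field.
  - rewrite INR_IZR_INZ; simpl (IZR (Z.of_nat _)); field.
Qed.

Definition kernel_43 : list Z :=
  [-173; 7205; 117988; -10243902; 185843236; -1166818104; -1787765861; 48023608133; -140905848395;
   -63359138998; 517162133835; -196924259408; -225511892352; 74773251830; 12522501465; -3126487586;
   -40911761; 17243550; -259343; -11120; 159; 1]%Z.

Lemma ramanujan_43 :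
  infinite_sum (fun n => c n * (263 + 5418 * INR n) / (- 960 ^ 3) ^ n)
    (sqrt (960 ^ 3) / (36 * PI)).
Proof.
  apply (ramanujan_II 21 (-17) 1720 38829 (-24) 263 5418 kernel_43 [50]%Z).
  1-4: vm_cast_no_check (eq_refl true).
  - lra.
  - lra.
  - split; lra.
  - reflexivity.
  - reflexivity.
  - lra.
  - field.
  - rewrite INR_IZR_INZ; simpl (IZR (Z.of_nat _)); field.
Qed.

Definition kernel_67 : list Z :=
  [2425263034072141; -75188919363111189; 979544933154583837; -6423330389395057655;
   13455753176627398884; 130691350635358349991; -1432848346263236582781; 7474109637000361850641;
   -25457002279632210501157; 60220325708974745992962; -97229911346940319009695;
   92758870706195856425640; -7154491644984434961258; -130345463439595621793811;
   218213334162607986850712; -186536254089016910655882; 81537065428568126128063;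
   -1677439766947661537979; -17535799582627401292067; 8268521509710891564141;
   -1098214589111912513782; -202914068032543573832; 61878194297660674419; -2146897077649454214;
   -388505470898033887; 21448699005515527; 287445386003827; -24353375072882; 127931992354;
   4390771039; -36001008; -104353; 896; 1]%Z.

Lemma ramanujan_67 :
  infinite_sum (fun n => c n * (10177 + 261702 * INR n) / (- 5280 ^ 3) ^ n)
    (sqrt (5280 ^ 3) / (12 * PI)).
Proof.
  apply (ramanujan_II 33 (-50) 14740 974113 (-76) 10177 261702 kernel_67 [149]%Z).
  1-4: vm_cast_no_check (eq_refl true).
  - lra.
  - lra.
  - split; lra.
  - reflexivity.
  - reflexivity.
  - lra.
  - field.
  - rewrite INR_IZR_INZ; simpl (IZR (Z.of_nat _)); field.
Qed.

Definition kernel_163 : list Z :=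
  [-358725372138467321814507651953796370521767676407132909;
   -37036911082267610882952030910517780929156348660978435681;
   -1794747115674805272343919466085344684978113149546402010424;
   -53575017697980928932998195763634313723964365234332231379071;
   -1074646806602791735419677681802295201969519973125009567524016;
   -14333519629632347077528645615029974955533496990073335649792410;
   -98475858611922735942157382789853104356815091761251925008813503;
   703692760176994969834749238171844008358370710090481398130735732;
   33709878421644292314313752884354755218911718214572427626098130547;
   605831675063450760303897934305019301445335593588271234683031884025;
   7689727907430525035701585411639624860336507961236184963980107497352;
   77442405986130204629182698410331950343525845300016449718119875700647;
   647408624349685217119883849557259511522588683614942990747177481214859;
   4595046766453867925673275384679214551180380289311059002868985290796732;
   28025448925713243076081855528690871828019904887339043018920043921428245;
   147701820793008620592184542479456736099121817510869998720841057036995228;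
   672652278195931370757067082111701576391398845626968968420253748340928510;
   2629091339326424806254930786440679266302722994351567648047058859026073774;
   8657081252470897231312825013460751381604203900241499561541295227519690192;
   22924942652960394707272817865218937823263133018924447971858280322803275666;
   42110023540349062126749206988227257965669220526742881631395513305151691422;
   10989908330984314356781662755423291477278552226309543629327557050394770381;
   -318250164880489646637772882285062982781305121396972989091230443835568714288;
   -1711735466772368235530224526117444034148222661542653101636904992042481338547;
   -5986342714687633649534939275814888042921419460261480434856568679474829819793;
   -16454769573684154636337527557027329814776328939667816501309565426772222557028;
   -37369617871066060679072925842070206399007384747381932374710193616761442574685;
   -70957383707019676657703331157767513629157333485327576026722042681372890589706;
   -111421302706984481958405794708289161138989506174450946249093232269860493904025;
   -138491798917352044040077105869379643458007563120563557140469611059683013384517;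
   -117610705546470869170184433829661614148647167834978659450211163794318485472184;
   -14614221996487672894361410508415489935571827515126164954710881408084284049189;
   176117986437029409534345159196541394949210372795415375029982556193769095618583;
   407734661632340430240084795655457345876564009048035931176925228017406662964367;
   587883363800165859451675841190351169991654064287841291642692419810653002098832;
   626724568516595483101964462371073091442017005463612107562016113170470808451802;
   498541017042578603737196280648612688482469577838955363421042136853885819420399;
   266062433030976884165006583044501983071664425660951039395740402684099485993050;
   40632703133278439213566283299753453073816035001587180242724025813669034524005;
   -91808921614748494428620318039317768345775928247956143893263289274366252358205;
   -117199068870227132644304822714044342752715465591518700860884500820053811003383;
   -79786646573416996036482583736977686365498035047013240259371287328144696327707;
   -33444009083000508974731555721364153589612755428973814329326719161031239466656;
   -5970051237773179445213062620157053881959999937089911463979677297092554207440;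
   2515501487164907133812869291795555427939214215501960601038941761741962536211;
   2310933471088469312558829083867204946765436665222808714524944137882256468114;
   796539838734973444093422990955238946923938739711241735544556077379194069596;
   102560921326423843030304209173420345040801986873586801429556821241016213611;
   -23000987735999451485683387601962198617369749865945097732395124164918781965;
   -11618509639903377707676513633091311562303677344458155580679674702867039324;
   -1527556723530322373585327325071200561000108438277950270551183306885643997;
   87368070579526903987470999990006896496250973086749089666057817926546100;
   41590452220263465269896211849083358135669221996761921840204824327472983;
   2380942846592539030680670230205894801746873243859768355045496238936819;
   -248664452665201737484482725153364840741204477644739726550174058607536;
   -24814777604490336701325975619195730797368142018760187243226510593344;
   337700237589354137779674420261412356488807643081695303237942479189;
   68281888284307045356329374555753424075488621349588614176359225353;
   155835753163512133118813625797218400820312375448808521445325064;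
   -66220962648026404102922394169777903048461691108082170923385958;
   -308054745847684804560323156998420863229223843851545391337348;
   24318338127691467168524637062318138071845555379801982654156;
   83607481385668555912856197366587911815426996159158059701;
   -3446898032151083531329422516989077201055221592539105387;
   -5711271634585835763964550465679018299622640270356045;
   187660375164067582179953832019737734720480397938691;
   49914247885593551498280199311496070843512329391;
   -3836865593787863010072323540985497707320118231; 2241355422895705666224059570968808803748678;
   28155767228345111583099075465444060211816; -29221778465884636518145289322883603416;
   -67434580625816970839872963891228146; 90061737503576779515407033516130;
   39160707699292238686928002612; -80931443484807292227353194; 6359402960885783214492;
   21212344077743253341; -4437261761307475; -1633206536742; 283382506; 49081; 1]%Z.

Lemma ramanujan_163 :
  infinite_sum (fun n => c n * (13591409 + 545140134 * INR n) / (- 640320 ^ 3) ^ n)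
    (sqrt (640320 ^ 3) / (12 * PI)).
Proof.
  (* The shift 2544 is split into signed powers of two; it leads to -851 + 2544 = 1693, where the
     cubic is still negative. *)
  apply (ramanujan_II 81 (-851) 4348840 4936546769 (-1448) 13591409 545140134 kernel_163 [2048; 512; -16]%Z).
  1-4: vm_cast_no_check (eq_refl true).
  - lra.
  - lra.
  - split; lra.
  - reflexivity.
  - reflexivity.
  - lra.
  - field.
  - rewrite INR_IZR_INZ; simpl (IZR (Z.of_nat _)); field.
Qed.

(** * Type I evaluations *)

(** The kernel enters as functions rather than as coefficient lists, because for even D it is not a
    polynomial and [n] is a half-integer. Complex multiplication sends the top root e1 to the bottom
    root e3. *)
Lemma ramanujan_I (e1 e2 e3 D n s g2 g3 a b j d q : R) (v0 v1 v2 v3 v4 : R -> R) :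
  e1 + e2 + e3 = 0 -> e3 < e2 -> e2 < 0 ->
  g2 = - (4 * (e1 * e2 + e1 * e3 + e2 * e3)) -> g3 = 4 * e1 * e2 * e3 ->
  0 < n -> D = 2 * n + 1 ->
  (forall x, e1 <= x -> is_derive v0 x (v1 x)) -> (forall x, e1 <= x -> is_derive v1 x (v2 x)) ->
  (forall x, e1 <= x -> is_derive v2 x (v3 x)) -> (forall x, e1 <= x -> is_derive v3 x (v4 x)) ->
  (forall x, e1 <= x -> 0 < v0 x) ->
  asym (fun x => x * (v1 x / v0 x)) n -> asym (fun x => x ^ 2 * (v2 x / v0 x)) (n * (n - 1)) ->
  (forall x, e1 <= x ->
    let P := 4 * x ^ 3 - g2 * x - g3 in
    let w2 := P * v2 x + (12 * x ^ 2 - g2) / 2 * v1 x in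
    let w2' := P * v3 x + 3 / 2 * (12 * x ^ 2 - g2) * v2 x + 12 * x * v1 x in
    let w2'' := P * v4 x + 5 / 2 * (12 * x ^ 2 - g2) * v3 x + 48 * x * v2 x + 12 * v1 x in
    v0 x * (P * w2'' + (12 * x ^ 2 - g2) / 2 * w2' - 12 * D * (x - s) * w2
      - D * (6 * x ^ 2 - 6 * D * (x - s) ^ 2 + (D - 1) / 2 * g2) * v0 x)
    + P * v1 x * (12 * D * (x - s) * v1 x - 4 * w2') + 3 * w2 ^ 2 = 0) ->
  (12 * e1 ^ 2 - g2) * v1 e1 = 2 * D * (e1 + e3 - s) * v0 e1 ->
  0 < b -> s * g2 = 3 * g3 * (6 * a / b - 1) -> 0 < d ->
  let X := 1 - 27 * g3 ^ 2 / g2 ^ 3 in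
  0 < X < 1 -> j * X = 1728 -> q * ((1 - X) * D) = (b * (1 / 2) * d) ^ 2 ->
  infinite_sum (fun n => c n * (a + b * INR n) / j ^ n) (sqrt q / (d * PI)).
Proof.
  intros Hsum H32 H2 E2 E3 Hn ED D0 D1 D2 D3 Hv L1 L2 Hbil Him Hb Hs Hd X HX Hj Hq.
  assert (HD : 0 < D) by lra.
  assert (Fact : forall x, 4 * x ^ 3 - g2 * x - g3 = 4 * ((x - e1) * (x - e2) * (x - e3))).
  { intros x; rewrite E2, E3; replace e1 with (- (e2 + e3)) by lra; ring. }
  destruct (I_periods e1 e2 e3 Hsum H32 H2) as [PA PB]; rewrite <- E2 in PA, PB.
  set (p := sqrt (e1 - e3)) in *; set (m := (e1 - e2) / (e1 - e3)) in *.
  assert (Pos : forall u r1 r2, 0 < u -> 0 < r1 -> 0 < r2 -> 0 < (u ^ 2 + r1) * (u ^ 2 + r2)).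
  { intros u r1 r2 Hu Hr1 Hr2; assert (0 < u ^ 2) by (apply pow_lt, Hu).
    apply Rmult_lt_0_compat; lra. }
  (* The midpoint of e3 and e2 lies on the oval, where the cubic is positive, and so separates (-
     oo, e3] from the rest of the set where it is not. *)
  edestruct (kernel_cm_periods D g2 g3 s e1 e3 ((e2 + e3) / 2)) as [R1 R2];
    [exact HD|exact ED|rewrite Fact; ring|rewrite Fact; ring|..].
  - replace (3 * e3 ^ 2 - g2 / 4) with ((e1 - e3) * (e2 - e3)).
    + apply Rmult_lt_0_compat; lra.
    + rewrite E2; replace e1 with (- (e2 + e3)) by lra; field.
  - intros u Hu; replace (u ^ 4 + 3 * e1 * u ^ 2 + (3 * e1 ^ 2 - g2 / 4)) with
      ((u ^ 2 + (e1 - e2)) * (u ^ 2 + (e1 - e3))); [apply Pos; lra|].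
    rewrite E2; replace e1 with (- (e2 + e3)) by lra; field.
  - intros u Hu; replace (u ^ 4 + - 3 * e3 * u ^ 2 + (3 * e3 ^ 2 - g2 / 4)) with
      ((u ^ 2 + (e1 - e3)) * (u ^ 2 + (e2 - e3))); [apply Pos; lra|].
    rewrite E2; replace e1 with (- (e2 + e3)) by lra; field.
  - rewrite Fact.
    assert (0 < (e1 - (e2 + e3) / 2) * (e2 - (e2 + e3) / 2) * ((e2 + e3) / 2 - e3))
      by (repeat apply Rmult_lt_0_compat; lra).
    lra.
  - intros y Hy HP; rewrite Fact in HP; destruct (Rle_lt_dec y e3) as [|Hlt]; [assumption|].
    assert (0 < (e1 - y) * (e2 - y) * (y - e3)) by (repeat apply Rmult_lt_0_compat; lra).
    lra.
  - exact PA.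
  - exact PB.
  - exact D0.
  - exact D1.
  - exact D2.
  - exact D3.
  - exact Hv.
  - exact L1.
  - exact L2.
  - exact Hbil.
  - exact Him.
  - rewrite <- (ramanujan_constant X D b (1 / 2) d q) by lra.
    assert (F : a * phi X ^ 2 + b * (2 * X * phi X * phi1 X) =
      b * (1 / 2) / (sqrt (1 - X) * sqrt D * PI)).
    { unfold X; rewrite E3, E2.
      eapply (I_formula e1 e2 e3 Hsum H32 H2 D s).
      - exact HD.
      - lra.
      - rewrite <- E2, <- E3; exact Hs.
      - reflexivity.
      - reflexivity.
      - reflexivity.
      - reflexivity.
      - exact R1.
      - exact R2. }
    rewrite <- F.
    apply series_value; [apply Rabs_def1; lra|exact Hj].
Qed.

Lemma is_derive_sqrt_mult (f : R -> R) x0 x df l :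
  x0 < x -> is_derive f x df -> l = sqrt (x - x0) * (df + f x / (2 * (x - x0))) ->
  is_derive (fun x => sqrt (x - x0) * f x) x l.
Proof.
  intros Hx Hf ->; assert (Hs := sqrt_lt_R0 (x - x0) ltac:(lra)).
  assert (E : sqrt (x - x0) ^ 2 = x - x0) by (apply pow2_sqrt; lra).
  assert (Ds : is_derive (fun x => sqrt (x - x0)) x (/ (2 * sqrt (x - x0)))).
  { auto_derive; [lra|]; unfold Rminus in *; field; lra. }
  evar_last; [exact (is_derive_Rmult _ _ _ _ _ Ds Hf)|].
  set (y := sqrt (x - x0)) in *; rewrite <- E; field; lra.
Qed.

(* In even degree the kernel contains the point [(e3, 0)], which contributes the factor
   [sqrt (x - e3)] to the kernel function. *)
Ltac nonzero :=
  repeat split; apply Rgt_not_eq; repeat apply Rmult_lt_0_compat; lra.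

(** Order Z[sqrt (- 2)]. The only kernel point besides the origin is (-2, 0), so n = 1/2 and every
    derivative is sqrt (x + 2) times a rational function. *)
Lemma ramanujan_2 :
  infinite_sum (fun n => c n * (3 + 28 * INR n) / (20 ^ 3) ^ n)
    (sqrt (20 ^ 3) / (8 * PI)).
Proof.
  assert (Hs : 0 < sqrt 2) by (apply sqrt_lt_R0; lra).
  assert (E : sqrt 2 ^ 2 = 2) by (apply pow2_sqrt; lra).
  set (r := sqrt 2) in *; assert (Hr : 14 / 10 < r < 15 / 10) by nra.
  assert (Hsq : forall x, 1 + 3 / 2 * r <= x -> 0 < sqrt (x - - 2)) by (intros; apply sqrt_lt_R0; lra).
  apply (ramanujan_I (1 + 3 / 2 * r) (1 - 3 / 2 * r) (- 2) 2 (1 / 2) (- 1) 30 28 3 28 _ _ _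
    (fun x => sqrt (x - - 2) * 1) (fun x => sqrt (x - - 2) * (1 / (2 * (x + 2))))
    (fun x => sqrt (x - - 2) * (- 1 / (4 * (x + 2) ^ 2)))
    (fun x => sqrt (x - - 2) * (3 / (8 * (x + 2) ^ 3)))
    (fun x => sqrt (x - - 2) * (- 15 / (16 * (x + 2) ^ 4)))); try lra.
  - intros x Hx; apply (is_derive_sqrt_mult _ _ _ 0); [lra|auto_derive; [trivial|ring]|field; lra].
  - intros x Hx; apply (is_derive_sqrt_mult _ _ _ (- 1 / (2 * (x + 2) ^ 2)));
      [lra|auto_derive; [lra|field; lra]|field; lra].
  - intros x Hx; apply (is_derive_sqrt_mult _ _ _ (1 / (2 * (x + 2) ^ 3)));
      [lra|auto_derive; [nonzero|field; lra]|field; lra].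
  - intros x Hx; apply (is_derive_sqrt_mult _ _ _ (- 9 / (8 * (x + 2) ^ 4)));
      [lra|auto_derive; [nonzero|field; lra]|field; lra].
  - intros x Hx; specialize (Hsq x Hx); lra.
  - apply (asym_ext_loc (fun x => 1 / 2 * (x / (x - - 2))) _ _ (1 + 3 / 2 * r)).
    + intros x Hx; specialize (Hsq x ltac:(lra)); field; lra.
    + apply (asym_eq _ (1 / 2 * 1)); [|ring]; apply asym_mult; [apply asym_const|apply asym_ratio].
  - apply (asym_ext_loc (fun x => - (1 / 4) * (x / (x - - 2) * (x / (x - - 2)))) _ _ (1 + 3 / 2 * r)).
    + intros x Hx; specialize (Hsq x ltac:(lra)); field; lra.
    + apply (asym_eq _ (- (1 / 4) * (1 * 1))); [|field].
      apply asym_mult; [apply asym_const|apply asym_mult; apply asym_ratio].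
  - intros x Hx; specialize (Hsq x Hx); cbv zeta; field; lra.
  - assert (K : (12 * (1 + 3 / 2 * r) ^ 2 - 30) / (2 * (1 + 3 / 2 * r + 2)) = 6 * r).
    { apply (Rmult_eq_reg_r (2 * (1 + 3 / 2 * r + 2))); [|lra].
      field_simplify; lra. }
    transitivity (sqrt (1 + 3 / 2 * r - - 2) *
      ((12 * (1 + 3 / 2 * r) ^ 2 - 30) / (2 * (1 + 3 / 2 * r + 2)))); [field; lra|].
    rewrite K; field.
Qed.

(** Order Z[sqrt (- 3)]. The kernel is generated by a 3-torsion point of abscissa -3/2, hence a
    linear kernel polynomial. *)
Lemma ramanujan_3 :
  infinite_sum (fun n => c n * (1 + 11 * INR n) / (2 * 30 ^ 3) ^ n)
    (sqrt (2 * 30 ^ 3) / (72 * PI)).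
Proof.
  assert (Hs : 0 < sqrt 3) by (apply sqrt_lt_R0; lra).
  assert (E : sqrt 3 ^ 2 = 3) by (apply pow2_sqrt; lra).
  set (r := sqrt 3) in *; assert (Hr : 17 / 10 < r < 18 / 10) by nra.
  apply (ramanujan_I ((1 + 2 * r) / 2) (- 1) ((1 - 2 * r) / 2) 3 1 (- 1) 15 11 1 11 _ _ _
    (fun x => x + 3 / 2) (fun _ => 1) (fun _ => 0) (fun _ => 0) (fun _ => 0)); try lra.
  - intros x _; auto_derive; [trivial|ring].
  - intros x _; auto_derive; [trivial|ring].
  - intros x _; auto_derive; [trivial|ring].
  - intros x _; auto_derive; [trivial|ring].
  - intros x Hx; lra.
  - apply (asym_ext (fun x => x / (x - - (3 / 2)))); [|apply asym_ratio].
    intros x Hx; field; lra.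
  - apply (asym_ext (fun _ => 0)); [intros x Hx; unfold Rdiv; ring|].
    apply (asym_eq _ 0); [apply asym_const|ring].
  - intros x _; cbv zeta; field.
Qed.

(** Order Z[2 i]. The kernel is cyclic of order 4: (-1, 0) gives the square root, and the two points
    of order 4 share the abscissa -3/2. *)
Lemma ramanujan_4 :
  infinite_sum (fun n => c n * (5 + 63 * INR n) / (66 ^ 3) ^ n)
    (sqrt (2 * 66 ^ 3) / (48 * PI)).
Proof.
  assert (Hs : 0 < sqrt 2) by (apply sqrt_lt_R0; lra).
  assert (E : sqrt 2 ^ 2 = 2) by (apply pow2_sqrt; lra).
  set (r := sqrt 2) in *; assert (Hr : 14 / 10 < r < 15 / 10) by nra.
  assert (Hsq : forall x, (1 + 2 * r) / 2 <= x -> 0 < sqrt (x - - 1)) by (intros; apply sqrt_lt_R0; lra).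
  apply (ramanujan_I ((1 + 2 * r) / 2) ((1 - 2 * r) / 2) (- 1) 4 (3 / 2) (- 1) 11 7 5 63 _ _ _
    (fun x => sqrt (x - - 1) * (x + 3 / 2))
    (fun x => sqrt (x - - 1) * (1 + (x + 3 / 2) / (2 * (x + 1))))
    (fun x => sqrt (x - - 1) * (1 / (x + 1) - (x + 3 / 2) / (4 * (x + 1) ^ 2)))
    (fun x => sqrt (x - - 1) * (- 3 / (4 * (x + 1) ^ 2) + 3 * (x + 3 / 2) / (8 * (x + 1) ^ 3)))
    (fun x => sqrt (x - - 1) * (3 / (2 * (x + 1) ^ 3) - 15 * (x + 3 / 2) / (16 * (x + 1) ^ 4)))); try lra.
  - intros x Hx; apply (is_derive_sqrt_mult _ _ _ 1); [lra|auto_derive; [trivial|ring]|field; lra].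
  - intros x Hx; apply (is_derive_sqrt_mult _ _ _ (1 / (2 * (x + 1)) - (x + 3 / 2) / (2 * (x + 1) ^ 2)));
      [lra|auto_derive; [lra|field; lra]|field; lra].
  - intros x Hx; apply (is_derive_sqrt_mult _ _ _ (- 5 / (4 * (x + 1) ^ 2) + (x + 3 / 2) / (2 * (x + 1) ^ 3)));
      [lra| |field; lra].
    auto_derive; [nonzero|field; lra].
  - intros x Hx; apply (is_derive_sqrt_mult _ _ _ (15 / (8 * (x + 1) ^ 3) - 9 * (x + 3 / 2) / (8 * (x + 1) ^ 4)));
      [lra| |field; lra].
    auto_derive; [nonzero|field; lra].
  - intros x Hx; apply Rmult_lt_0_compat; [exact (Hsq x Hx)|lra].
  - apply (asym_ext_loc (fun x => x / (x - - (3 / 2)) + 1 / 2 * (x / (x - - 1))) _ _ ((1 + 2 * r) / 2)).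
    + intros x Hx; specialize (Hsq x ltac:(lra)); field; lra.
    + apply (asym_eq _ (1 + 1 / 2 * 1)); [|field].
      apply asym_plus; [|apply asym_mult; [apply asym_const|]]; apply asym_ratio.
  - apply (asym_ext_loc (fun x => x / (x - - (3 / 2)) * (x / (x - - 1))
      + - (1 / 4) * (x / (x - - 1) * (x / (x - - 1)))) _ _ ((1 + 2 * r) / 2)).
    + intros x Hx; specialize (Hsq x ltac:(lra)); field; lra.
    + apply (asym_eq _ (1 * 1 + - (1 / 4) * (1 * 1))); [|field].
      apply asym_plus; [apply asym_mult; apply asym_ratio|].
      apply asym_mult; [apply asym_const|apply asym_mult; apply asym_ratio].
  - intros x Hx; specialize (Hsq x Hx); cbv zeta; field; lra.
  - set (e := (1 + 2 * r) / 2) in *.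
    (* The image condition cleared of its root and denominators; since e3 = s = -1, the quantity e1
       + e3 - s is just [e]. *)
    assert (K : (12 * e ^ 2 - 11) * (2 * (e + 1) + (e + 3 / 2)) = 16 * (e * ((e + 3 / 2) * (e + 1)))).
    { unfold e; field_simplify; replace (r ^ 3) with (2 * r) by (replace (r ^ 3) with (r ^ 2 * r) by ring; rewrite E; ring); lra. }
    transitivity (sqrt (e - - 1) * (((12 * e ^ 2 - 11) * (2 * (e + 1) + (e + 3 / 2))) / (2 * (e + 1))));
      [field; unfold e; lra|].
    rewrite K; field; unfold e; lra.
Qed.

(** Order Z[sqrt (- 7)], of index 2 in the order behind [ramanujan_7]: same D, but a curve with
    three real roots. *)
Lemma ramanujan_7' :
  infinite_sum (fun n => c n * (8 + 133 * INR n) / (255 ^ 3) ^ n)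
    (sqrt (255 ^ 3) / (162 * PI)).
Proof.
  assert (Hs : 0 < sqrt 7) by (apply sqrt_lt_R0; lra).
  assert (E : sqrt 7 ^ 2 = 7) by (apply pow2_sqrt; lra).
  set (r := sqrt 7) in *; assert (Hr : 264 / 100 < r < 265 / 100) by nra.
  apply (ramanujan_I ((7 + 8 * r) / 2) (- 7) ((7 - 8 * r) / 2) 7 3 (- 9) 595 2793 8 133 _ _ _
    (* A cubic in 2 x, namely (2x)^3 + 63 (2x)^2 + 1211 (2x) + 7357. The factor 8 that clears
       denominators is harmless, all conditions being homogeneous in v. *)
    (peval [7357; 2422; 252; 8]%Z) (peval [2422; 504; 24]%Z) (peval [504; 48]%Z) (peval [48]%Z)
    (peval [])); try lra.
  - intros x _; apply is_derive_peval.
  - intros x _; apply is_derive_peval.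
  - intros x _; apply is_derive_peval.
  - intros x _; apply is_derive_peval.
  - intros x Hx; cbn [peval]; assert (0 < x) by lra; assert (0 < x * x) by nra; nra.
  - apply (asym_ext (fun x => peval [2422; 504; 24]%Z x / x ^ 2 * / (peval [7357; 2422; 252; 8]%Z x / x ^ 3))).
    + intros x Hx; cbn [peval]; field; split; [|lra];
      apply Rgt_not_eq; assert (0 < x * x) by nra; nra.
    + apply (asym_eq _ (24 * / 8)); [|field].
      apply asym_mult; [|apply asym_inv; [lra|]]; apply asym_peval_length; reflexivity.
  - apply (asym_ext (fun x => peval [504; 48]%Z x / x ^ 1 * / (peval [7357; 2422; 252; 8]%Z x / x ^ 3))).
    + intros x Hx; cbn [peval]; field; split; [|lra];
      apply Rgt_not_eq; assert (0 < x * x) by nra; nra.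
    + apply (asym_eq _ (48 * / 8)); [|field].
      apply asym_mult; [|apply asym_inv; [lra|]]; apply asym_peval_length; reflexivity.
  - intros x Hx; cbv zeta; cbn [peval]; field.
  - assert (Q : ((7 + 8 * r) / 2) ^ 2 - 7 * ((7 + 8 * r) / 2) - 399 / 4 = 0) by lra.
    replace ((7 + 8 * r) / 2 + (7 - 8 * r) / 2) with 7 by field.
    set (e := (7 + 8 * r) / 2) in *; cbn [peval].
    apply Rminus_diag_uniq; transitivity ((288 * e ^ 2 + 6272 * e + 30968) * (e ^ 2 - 7 * e - 399 / 4)).
    + field.
    + rewrite Q; ring.
Qed.

Theorem mainTheorem2 :
  infinite_sum (fun n => c n * (8 + 63 * INR n) / (- 15 ^ 3) ^ n)
    (sqrt (15 ^ 3) / (3 * PI)) /\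
  infinite_sum (fun n => c n * (3 + 28 * INR n) / (20 ^ 3) ^ n)
    (sqrt (20 ^ 3) / (8 * PI)) /\
  infinite_sum (fun n => c n * (15 + 154 * INR n) / (- 32 ^ 3) ^ n)
    (sqrt (32 ^ 3) / (4 * PI)) /\
  infinite_sum (fun n => c n * (1 + 11 * INR n) / (2 * 30 ^ 3) ^ n)
    (sqrt (2 * 30 ^ 3) / (72 * PI)) /\
  infinite_sum (fun n => c n * (5 + 63 * INR n) / (66 ^ 3) ^ n)
    (sqrt 2 * sqrt (66 ^ 3) / (48 * PI)) /\
  infinite_sum (fun n => c n * (25 + 342 * INR n) / (- 96 ^ 3) ^ n)
    (sqrt (96 ^ 3) / (12 * PI)) /\
  infinite_sum (fun n => c n * (31 + 506 * INR n) / (- (3 * 160 ^ 3)) ^ n)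
    (sqrt (3 * 160 ^ 3) / (36 * PI)) /\
  infinite_sum (fun n => c n * (8 + 133 * INR n) / (255 ^ 3) ^ n)
    (sqrt (255 ^ 3) / (162 * PI)) /\
  infinite_sum (fun n => c n * (263 + 5418 * INR n) / (- 960 ^ 3) ^ n)
    (sqrt (960 ^ 3) / (36 * PI)) /\
  infinite_sum (fun n => c n * (10177 + 261702 * INR n) / (- 5280 ^ 3) ^ n)
    (sqrt (5280 ^ 3) / (12 * PI)) /\
  infinite_sum
    (fun n => c n * (13591409 + 545140134 * INR n) / (- 640320 ^ 3) ^ n)
    (sqrt (640320 ^ 3) / (12 * PI)).
Proof.
  repeat split.
  - exact ramanujan_7.
  - exact ramanujan_2.
  - exact ramanujan_11.
  - exact ramanujan_3.
  - rewrite <- sqrt_mult by lra; exact ramanujan_4.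
  - exact ramanujan_19.
  - exact ramanujan_27.
  - exact ramanujan_7'.
  - exact ramanujan_43.
  - exact ramanujan_67.
  - exact ramanujan_163.
Qed.
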